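(* Let $\rho$ be a conformal metric on a domain $D\subset\mathbf{C}$, let $\omega\in D$, $r>0$, and let $\gamma$ be a geodesic line contained in a geodesic disk $D_\rho(\omega,r)\subset D$. Let $\Omega\subset\mathbf{C}$ be a hyperbolic domain and let $f:\Omega\to\gamma$ be a $\rho$-harmonic mapping. Then for all $z_1,z_2\in\Omega$, $$d_\rho(f(z_1),f(z_2))\le \frac{4r}{\pi}\,d_h(z_1,z_2),$$ where $d_h$ is the hyperbolic distance on $\Omega$. Moreover the inequality is sharp: the constant $4/\pi$ cannot be replaced by a smaller constant valid for all such data.
   Context: $\mathbf{U}=\{z\in\mathbf{C}:|z|<1\}$ is the unit disk. A conformal metric on a domain $D\subset\mathbf{C}$ is a positive function $\rho\in C^1(D)$; the $\rho$-length of a curve $\Gamma\subset D$ is $\int_\Gamma\rho(w)\,|dw|$, and $d_\rho(w_1,w_2)$ is the infimum of $\rho$-lengths of curves in $D$ joining $w_1$ and $w_2$. The geodesic disk is $D_\rho(\omega,r)=\{w\in D: d_\rho(w,\omega)<r\}$. A geodesic line is a smooth arc $\gamma\subset D$ such that for any two points $w_1,w_2\in\gamma$, $d_\rho(w_1,w_2)$ equals the $\rho$-length of the part of $\gamma$ between $w_1$ and $w_2$. For a domain $\Omega\subset\mathbf{C}$, a $C^2$ mapping $f:\Omega\to D$ is called $\rho$-harmonic if $$f_{z\bar z}+\big((\partial_w\log\rho^2)\circ f\big)\, f_z f_{\bar z}=0\quad\text{in }\Omega,$$ where $f_z,f_{\bar z}$ are the Wirtinger derivatives. A mapping into $\gamma$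 is $\rho$-harmonic if it is so as a mapping into $D$. A domain $\Omega$ is called hyperbolic if there is a conformal bijection $k:\mathbf{U}\to\Omega$. The hyperbolic distance on $\mathbf{U}$ is $d_h(z,w)=\tanh^{-1}\left|\frac{z-w}{1-\bar z w}\right|$, and on a hyperbolic domain $\Omega$ it is $d_h(z_1,z_2)=d_h(k^{-1}(z_1),k^{-1}(z_2))$ (independent of the choice of $k$). *)

(* Defs.v *)
From Stdlib Require Import Reals ClassicalEpsilon.
From Coquelicot Require Import Coquelicot.

Local Open Scope R_scope.

(** * Domains *)

Definition connected (A : C -> Prop) : Prop :=
  forall U V : C -> Prop, open U -> open V ->
    (forall z, A z -> U z \/ V z) ->
    (exists z, A z /\ U z) -> (exists z, A z /\ V z) ->
    exists z, A z /\ U z /\ V z.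

Definition planar_domain (D : C -> Prop) : Prop :=
  open D /\ (exists z, D z) /\ connected D.

(** * Partial and Wirtinger derivatives

    Functions are total on [C]; only their values on a given open set matter. *)

Definition partial_x (u : C -> R) (z : C) : R := Derive (fun x => u (x, Im z)) (Re z).
Definition partial_y (u : C -> R) (z : C) : R := Derive (fun y => u (Re z, y)) (Im z).

(* Meant for open [A], as are [C2_on] and the complex version below. *)
Definition C1_on (A : C -> Prop) (u : C -> R) : Prop :=
  forall z, A z ->
    ex_derive (fun x => u (x, Im z)) (Re z) /\
    ex_derive (fun y => u (Re z, y)) (Im z) /\
    continuous (partial_x u) z /\ continuous (partial_y u) z.

Definition C2_on (A : C -> Prop) (u : C -> R) : Prop :=
  C1_on A u /\ C1_on A (partial_x u) /\ C1_on A (partial_y u).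

Definition C2_map_on (A : C -> Prop) (f : C -> C) : Prop :=
  C2_on A (fun z => Re (f z)) /\ C2_on A (fun z => Im (f z)).

Definition Cpartial_x (f : C -> C) (z : C) : C :=
  (partial_x (fun w => Re (f w)) z, partial_x (fun w => Im (f w)) z).
Definition Cpartial_y (f : C -> C) (z : C) : C :=
  (partial_y (fun w => Re (f w)) z, partial_y (fun w => Im (f w)) z).

Definition d_z (f : C -> C) (z : C) : C :=
  ((Cpartial_x f z - Ci * Cpartial_y f z) / RtoC 2)%C.
Definition d_zbar (f : C -> C) (z : C) : C :=
  ((Cpartial_x f z + Ci * Cpartial_y f z) / RtoC 2)%C.

(** * Conformal metrics *)

Definition conformal_metric (D : C -> Prop) (rho : C -> R) : Prop :=
  (forall w, D w -> 0 < rho w) /\ C1_on D rho.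

(** [g] is of class [C^1] on the interval [I], with derivative [dg]; the
    derivative is one-sided at the endpoints that belong to [I]. *)
Definition C1_path_on (I : R -> Prop) (g dg : R -> C) : Prop :=
  forall t, I t ->
    filterlim (fun s => ((g s - g t) / RtoC (s - t))%C)
      (within I (locally' t)) (locally (dg t)) /\
    filterlim dg (within I (locally t)) (locally (dg t)).

(** Piecewise [C^1]; the case [n = 0] is the constant path on [[a, a]]. *)
Definition piecewise_C1 (g : R -> C) (a b : R) : Prop :=
  exists (n : nat) (t : nat -> R),
    t 0%nat = a /\ t n = b /\
    forall i, (i < n)%nat ->
      t i < t (S i) /\
      exists dg, C1_path_on (fun s => t i <= s <= t (S i)) g dg.

(** [Derive] is meaningless at the finitely many points where [g] is not
    differentiable, which does not affect the integral. *)
Definition rho_length (rho : C -> R) (g : R -> C) (a b : R) : R :=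
  RInt (fun t => rho (g t) *
          Cmod (Derive (fun s => Re (g s)) t, Derive (fun s => Im (g s)) t)) a b.

Definition joins_in (D : C -> Prop) (g : R -> C) (a b : R) (w1 w2 : C) : Prop :=
  piecewise_C1 g a b /\ (forall t, a <= t <= b -> D (g t)) /\
  g a = w1 /\ g b = w2.

(** The infimum is finite whenever [w1] and [w2] lie in the domain [D]. *)
Definition rho_dist (D : C -> Prop) (rho : C -> R) (w1 w2 : C) : R :=
  real (Glb_Rbar (fun l => exists (g : R -> C) (a b : R),
                    joins_in D g a b w1 w2 /\ l = rho_length rho g a b)).

Definition geodesic_disk (D : C -> Prop) (rho : C -> R) (omega : C) (r : R)
    (w : C) : Prop :=
  D w /\ rho_dist D rho w omega < r.

(** A smooth arc is an injective regular [C^1] path on an interval, which may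
    be open, half-open or closed, bounded or not. *)
Definition smooth_arc_param (I : R -> Prop) (g : R -> C) (gamma : C -> Prop) :
    Prop :=
  (forall s t x, I s -> I t -> s <= x <= t -> I x) /\
  (exists s t, I s /\ I t /\ s < t) /\
  (exists dg, C1_path_on I g dg /\ forall t, I t -> dg t <> RtoC 0) /\
  (forall s t, I s -> I t -> g s = g t -> s = t) /\
  (forall w, gamma w <-> exists t, I t /\ g t = w).

Definition geodesic_line (D : C -> Prop) (rho : C -> R) (gamma : C -> Prop) :
    Prop :=
  (forall w, gamma w -> D w) /\
  exists (I : R -> Prop) (g : R -> C),
    smooth_arc_param I g gamma /\
    forall s t, I s -> I t -> s <= t ->
      rho_dist D rho (g s) (g t) = rho_length rho g s t.

(** * Harmonic maps *)

Definition rho_harmonic (D : C -> Prop) (rho : C -> R) (Omega : C -> Prop)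
    (f : C -> C) : Prop :=
  C2_map_on Omega f /\
  (forall z, Omega z -> D (f z)) /\
  forall z, Omega z ->
    (d_zbar (d_z f) z +
     d_z (fun w => RtoC (ln (rho w ^ 2))) (f z) * (d_z f z * d_zbar f z))%C
    = RtoC 0.

(** * Hyperbolic distance *)

Definition unit_disk (z : C) : Prop := Cmod z < 1.

Definition conformal_bijection (k : C -> C) (A B : C -> Prop) : Prop :=
  (forall z, A z ->
     exists l : C, is_derive (K := C_AbsRing) (V := C_NormedModule) k z l /\
       l <> RtoC 0) /\
  (forall z, A z -> B (k z)) /\
  (forall z w, A z -> A w -> k z = k w -> z = w) /\
  (forall w, B w -> exists z, A z /\ k z = w).

Definition inverse_on (A : C -> Prop) (k : C -> C) (w : C) : C :=
  epsilon (inhabits (RtoC 0)) (fun z => A z /\ k z = w).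

(** The inverse hyperbolic tangent, for [-1 < x < 1]. *)
Definition artanh (x : R) : R := ln ((1 + x) / (1 - x)) / 2.

Definition hyp_dist_disk (z w : C) : R :=
  artanh (Cmod ((z - w) / (RtoC 1 - Cconj z * w))%C).

(** The hyperbolic distance of the image of the unit disk under the conformal
    bijection [k]; it does not depend on the choice of [k]. *)
Definition hyp_dist (k : C -> C) (z1 z2 : C) : R :=
  hyp_dist_disk (inverse_on unit_disk k z1) (inverse_on unit_disk k z2).

(** * The Lipschitz estimate with constant [c]

    [Omega] is hyperbolic through [k], over which the estimate quantifies. *)
Definition distance_estimate (c : R) : Prop :=
  forall (D : C -> Prop) (rho : C -> R) (omega : C) (r : R)
    (gamma Omega : C -> Prop) (k f : C -> C),
    planar_domain D -> conformal_metric D rho -> D omega -> 0 < r ->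
    geodesic_line D rho gamma ->
    (forall w, gamma w -> geodesic_disk D rho omega r w) ->
    planar_domain Omega -> conformal_bijection k unit_disk Omega ->
    rho_harmonic D rho Omega f -> (forall z, Omega z -> gamma (f z)) ->
    forall z1 z2, Omega z1 -> Omega z2 ->
      rho_dist D rho (f z1) (f z2) <= c * r * hyp_dist k z1 z2.

(* Main.v *)
Require Import Defs.
From Stdlib Require Import Reals Lra Lia Psatz Classical ClassicalEpsilon.
From Coquelicot Require Import Coquelicot.
Local Open Scope R_scope.

(* Write [f = g o tau], where [g] parametrizes the geodesic, and let [u] be the signed
   [rho]-length of [g] up to [tau].  Since [g] realizes distances, [|u z1 - u z2|] is
   the distance of [f z1] and [f z2], and [u] takes its values in an interval of
   length [2 r], because [gamma] lies in a disk of radius [r].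

   The metric is only [C^1], so the geodesic equation comes from comparing the
   length of [g] with that of a translate of an arc of [g], joined to [g] by two short
   segments: the momentum [P = rho g' / |g'|] satisfies [P' = |g'| grad rho].  With
   [u_x = <P(tau), f_x>] the equation for [f] becomes [Laplacian u = 0].

   For a harmonic [v] on the unit disk, [pi R v_x(0)] is the integral of
   [v(R e^(it)) cos t], so that values in an interval of length [2 r] give
   [|v_x(0)| <= 4 r / pi].  Applied to [v = u o k o T] for the automorphisms [T] of the
   disk, this bounds the gradient of [u] in the hyperbolic metric, and integrating along
   a hyperbolic segment gives the estimate.  As [k] is only assumed to have a complex
   derivative at each point, Goursat's theorem is needed to see that [v] is [C^2].

   The constant is attained to first order at [0] by [Re (4/pi arctan z)], mapping the
   unit disk into the diameter [(-1, 1)] of the Euclidean unit disk. *)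

(** * Calculus in the plane *)

(** The obstacle is regularity. Neither [rho] nor the parametrization [g] is assumed [C^2], so [g'']
    cannot be used; the inequality between lengths holds for every translation vector [e] and is an
    equality at [e = 0], and it is the vanishing of the derivative in [e] there that gives the
    equation for [P]. The function [tau] comes without regularity as well: [u] is continuous because
    its increments are distances, [tau] is continuous because arc length strictly increases with the
    parameter, and [tau] is differentiable because the projection of [g] on a tangent vector has a
    positive derivative. Laplace's equation is then the tangential part of the equation for [f]:
    since [f_x] and [f_y] are real multiples of [g'], the complex number [f_x^2 + f_y^2] is a real
    multiple of [g'^2].

    In [4 r / pi], the 4 is the integral of [|cos t|] over a period and [r] is half the length of
    the interval of values; [cos] has mean zero, so the centre of that interval drops out. *)

Lemma lt_Rmin_l {x y z : R} : z < Rmin x y -> z < x.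
Proof. intros H; exact (Rlt_le_trans _ _ _ H (Rmin_l x y)). Qed.

Lemma lt_Rmin_r {x y z : R} : z < Rmin x y -> z < y.
Proof. intros H; exact (Rlt_le_trans _ _ _ H (Rmin_r x y)). Qed.

(** Total differentiability with the gradient as data: the existence of partial derivatives alone
    would not give the chain rule. *)
Definition grad_at (u : C -> R) (z : C) (a b : R) : Prop :=
  differentiable_pt_lim (fun x y => u (x, y)) (Re z) (Im z) a b.

Lemma locally_box (z : C) (P : C -> Prop) :
  locally z P <->
  exists d, 0 < d /\ forall w, Rabs (Re w - Re z) < d -> Rabs (Im w - Im z) < d -> P w.
Proof.
  split.
  - intros [d Hd]; exists d; split; [apply cond_pos|].
    intros w H1 H2; apply Hd; split; assumption.
  - intros [d [Hd H]]; exists (mkposreal d Hd); intros w [H1 H2]; apply H; assumption.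
Qed.

Lemma continuous_eps (T : UniformSpace) (f : T -> R) (x : T) :
  continuous f x <->
  forall eps, 0 < eps -> exists d : posreal, forall y, ball x d y -> Rabs (f y - f x) < eps.
Proof.
  split.
  - intros H eps Heps.
    destruct (H (fun v => Rabs (v - f x) < eps)) as [d Hd].
    + exists (mkposreal eps Heps); intros y Hy; exact Hy.
    + exists d; exact Hd.
  - intros H P [e He]; destruct (H e (cond_pos e)) as [d Hd].
    exists d; intros y Hy; apply He; apply (Hd y Hy).
Qed.

Lemma continuous_box (f : C -> R) (z : C) :
  continuous f z <->
  forall eps, 0 < eps -> exists d, 0 < d /\ forall w,
    Rabs (Re w - Re z) < d -> Rabs (Im w - Im z) < d -> Rabs (f w - f z) < eps.
Proof.
  rewrite continuous_eps; split; intros H eps Heps; destruct (H eps Heps) as [d Hd].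
  - exists d; split; [apply cond_pos|]; intros w H1 H2; apply Hd; split; assumption.
  - destruct Hd as [Hd H']; exists (mkposreal d Hd); intros w [H1 H2]; apply H'; assumption.
Qed.

Lemma is_derive_eps (f : R -> R) (x m : R) :
  is_derive f x m <->
  forall eps, 0 < eps -> exists d, 0 < d /\ forall y, Rabs (y - x) < d ->
    Rabs (f y - f x - m * (y - x)) <= eps * Rabs (y - x).
Proof.
  rewrite is_derive_Reals; split.
  - intros H eps Heps; destruct (H eps Heps) as [d Hd].
    exists d; split; [apply cond_pos|]; intros y Hy.
    destruct (Req_dec y x) as [->|Hne].
    + replace (f x - f x - m * (x - x)) with 0 by ring.
      replace (x - x) with 0 by ring; rewrite Rabs_R0; lra.
    + assert (Hh : y - x <> 0) by lra.
      specialize (Hd (y - x) Hh Hy); replace (x + (y - x)) with y in Hd by ring.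
      replace (f y - f x - m * (y - x)) with (((f y - f x) / (y - x) - m) * (y - x)) by (field; lra).
      rewrite Rabs_mult; apply Rmult_le_compat_r; [apply Rabs_pos|lra].
  - intros H eps Heps; destruct (H (eps / 2)) as [d [Hd H']]; [lra|].
    exists (mkposreal d Hd); intros h Hh Hhd.
    specialize (H' (x + h)); replace (x + h - x) with h in H' by ring.
    specialize (H' Hhd).
    replace ((f (x + h) - f x) / h - m) with ((f (x + h) - f x - m * h) / h) by (field; lra).
    unfold Rdiv; rewrite Rabs_mult, Rabs_inv.
    assert (0 < Rabs h) by (apply Rabs_pos_lt; assumption).
    apply Rle_lt_trans with (eps / 2 * Rabs h * / Rabs h).
    + apply Rmult_le_compat_r; [left; apply Rinv_0_lt_compat; assumption|assumption].
    + field_simplify; lra.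
Qed.

Lemma is_derive_Rconst (c x : R) : is_derive (fun _ : R => c) x 0.
Proof. apply (is_derive_const (K := R_AbsRing) (V := R_NormedModule)). Qed.

Lemma is_derive_Rid (x : R) : is_derive (fun y : R => y) x 1.
Proof. apply (is_derive_id (K := R_AbsRing)). Qed.

(** The hypotheses are asymmetric: the mean value theorem is applied in the [x] direction only, so
    the [y] derivative has to exist just at [z]. *)
Lemma grad_C1 (u ux : C -> R) (z : C) (b : R) :
  locally z (fun w => is_derive (fun x => u (x, Im w)) (Re w) (ux w)) ->
  is_derive (fun y => u (Re z, y)) (Im z) b -> continuous ux z ->
  grad_at u z (ux z) b.
Proof.
  intros H1 H2 H3; destruct z as [x y]; simpl in *.
  apply filterdiff_differentiable_pt_lim.
  apply (is_derive_filterdiff (fun x y => u (x, y)) x y (fun a b => ux (a, b)) b).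
  - revert H1; apply filter_imp; intros [a c] H; exact H.
  - exact H2.
  - revert H3; apply continuous_ext; intros [a c]; reflexivity.
Qed.

Lemma grad_curve (u : C -> R) (p q : R -> R) (t a b p' q' : R) :
  grad_at u (p t, q t) a b -> is_derive p t p' -> is_derive q t q' ->
  is_derive (fun s => u (p s, q s)) t (a * p' + b * q').
Proof.
  intros H1 H2 H3; apply is_derive_Reals.
  apply (derivable_pt_lim_comp_2d (fun x y => u (x, y)) p q t a b p' q' H1);
    apply is_derive_Reals; assumption.
Qed.

Lemma grad_x (u : C -> R) (z : C) (a b : R) :
  grad_at u z a b -> is_derive (fun x => u (x, Im z)) (Re z) a.
Proof.
  intros H.
  replace a with (a * 1 + b * 0) by ring.
  apply (grad_curve u (fun x => x) (fun _ => Im z) (Re z) a b 1 0 H).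
  - apply is_derive_Rid.
  - apply is_derive_Rconst.
Qed.

Lemma grad_y (u : C -> R) (z : C) (a b : R) :
  grad_at u z a b -> is_derive (fun y => u (Re z, y)) (Im z) b.
Proof.
  intros H.
  replace b with (a * 0 + b * 1) by ring.
  apply (grad_curve u (fun _ => Re z) (fun x => x) (Im z) a b 0 1 H).
  - apply is_derive_Rconst.
  - apply is_derive_Rid.
Qed.

Lemma grad_comp (u p q : C -> R) (z : C) (a b p1 p2 q1 q2 : R) :
  grad_at u (p z, q z) a b -> grad_at p z p1 p2 -> grad_at q z q1 q2 ->
  grad_at (fun w => u (p w, q w)) z (a * p1 + b * q1) (a * p2 + b * q2).
Proof.
  intros H1 H2 H3; destruct z as [x y].
  exact (differentiable_pt_lim_comp (fun x y => u (x, y)) (fun x y => p (x, y))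
           (fun x y => q (x, y)) x y a b p1 p2 q1 q2 H1 H2 H3).
Qed.

Lemma grad_ext_loc (u v : C -> R) (z : C) (a b : R) :
  locally z (fun w => u w = v w) -> grad_at u z a b -> grad_at v z a b.
Proof.
  intros H H1; destruct z as [x y].
  apply (differentiable_pt_lim_ext (fun x y => u (x, y))); [|exact H1].
  destruct H as [d Hd]; exists d; intros s t Hs Ht; apply (Hd (s, t)); split; assumption.
Qed.

Lemma grad_continuous (u : C -> R) (z : C) (a b : R) : grad_at u z a b -> continuous u z.
Proof.
  intros H; destruct z as [x y].
  assert (Hc : continuity_2d_pt (fun x y => u (x, y)) x y).
  { apply differentiable_continuity_pt; exists a, b; exact H. }
  apply continuity_2d_pt_filterlim in Hc.
  revert Hc; apply (filterlim_ext (F := locally (x, y))); intros [s t]; reflexivity.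
Qed.

Lemma grad_plus (u v : C -> R) (z : C) (a b c d : R) :
  grad_at u z a b -> grad_at v z c d -> grad_at (fun w => u w + v w) z (a + c) (b + d).
Proof.
  intros H1 H2.
  replace (a + c) with (1 * a + 1 * c) by ring; replace (b + d) with (1 * b + 1 * d) by ring.
  refine (grad_comp (fun w => fst w + snd w) u v z 1 1 a b c d _ H1 H2).
  apply (grad_C1 (fun w => fst w + snd w) (fun _ => 1)).
  - apply filter_forall; intros w; simpl; auto_derive; trivial; ring.
  - simpl; auto_derive; trivial; ring.
  - apply continuous_const.
Qed.

Lemma grad_mult (u v : C -> R) (z : C) (a b c d : R) :
  grad_at u z a b -> grad_at v z c d ->
  grad_at (fun w => u w * v w) z (v z * a + u z * c) (v z * b + u z * d).
Proof.
  intros H1 H2.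
  refine (grad_comp (fun w => fst w * snd w) u v z (v z) (u z) a b c d _ H1 H2).
  apply (grad_C1 (fun w => fst w * snd w) (fun w => snd w) (u z, v z)).
  - apply filter_forall; intros w; simpl; auto_derive; trivial; unfold Re, Im; simpl; ring.
  - simpl; auto_derive; trivial; unfold Re, Im; simpl; ring.
  - apply continuous_snd.
Qed.

Lemma grad_scal (c : R) (u : C -> R) (z : C) (a b : R) :
  grad_at u z a b -> grad_at (fun w => c * u w) z (c * a) (c * b).
Proof.
  intros H.
  replace (c * a) with (u z * 0 + c * a) by ring; replace (c * b) with (u z * 0 + c * b) by ring.
  refine (grad_mult (fun _ => c) u z 0 0 a b _ H).
  apply (grad_C1 (fun _ => c) (fun _ => 0)).
  - apply filter_forall; intros w; apply is_derive_Rconst.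
  - apply is_derive_Rconst.
  - apply continuous_const.
Qed.

Lemma grad_eq (u : C -> R) (z : C) (a b a' b' : R) :
  grad_at u z a b -> a = a' -> b = b' -> grad_at u z a' b'.
Proof. intros; subst; assumption. Qed.

Lemma continuous_Rplus (T : UniformSpace) (f g : T -> R) (x : T) :
  continuous f x -> continuous g x -> continuous (fun y => f y + g y) x.
Proof. exact (fun H1 H2 => continuous_plus (V := R_NormedModule) f g x H1 H2). Qed.

Lemma continuous_Ropp (T : UniformSpace) (f : T -> R) (x : T) :
  continuous f x -> continuous (fun y => - f y) x.
Proof. exact (fun H1 => continuous_opp (V := R_NormedModule) f x H1). Qed.

Lemma continuous_Rminus (T : UniformSpace) (f g : T -> R) (x : T) :
  continuous f x -> continuous g x -> continuous (fun y => f y - g y) x.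
Proof. exact (fun H1 H2 => continuous_minus (V := R_NormedModule) f g x H1 H2). Qed.

Lemma continuous_Rmult (T : UniformSpace) (f g : T -> R) (x : T) :
  continuous f x -> continuous g x -> continuous (fun y => f y * g y) x.
Proof. exact (fun H1 H2 => continuous_mult (K := R_AbsRing) f g x H1 H2). Qed.

Lemma continuous_pair (T U V : UniformSpace) (f : T -> U) (g : T -> V) (x : T) :
  continuous f x -> continuous g x -> continuous (fun y => (f y, g y)) x.
Proof.
  intros H1 H2; apply (continuous_comp_2 f g (fun a b => (a, b)) x H1 H2).
  apply (continuous_ext (fun y => y)); [intros [a b]; reflexivity|apply continuous_id].
Qed.

Lemma continuous_of_derive (f : R -> R) (x l : R) : is_derive f x l -> continuous f x.
Proof.
  intros H; apply (ex_derive_continuous (K := R_AbsRing) (V := R_NormedModule)); exists l; exact H.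
Qed.

(** Compactness of [[a, b]]: finitely many of the product neighbourhoods cover the slice over [x],
    and their first factors have a common radius. *)
Lemma tube (T : UniformSpace) (x : T) (a b : R) (P : T -> R -> Prop) :
  (forall t, a <= t <= b -> locally (x, t) (fun p => P (fst p) (snd p))) ->
  locally x (fun y => forall t, a <= t <= b -> P y t).
Proof.
  intros H.
  assert (H' : forall t, exists d : posreal, a <= t <= b ->
            forall y s, ball x d y -> Rabs (s - t) < d -> P y s).
  { intros t; destruct (classic (a <= t <= b)) as [Ht|Ht].
    - destruct (H t Ht) as [d Hd]; exists d; intros _ y s Hy Hs.
      apply (Hd (y, s)); split; assumption.
    - exists (mkposreal 1 Rlt_0_1); tauto. }
  set (delta := fun t => proj1_sig (constructive_indefinite_description _ (H' t))).
  assert (Hd : forall t, a <= t <= b -> forall y s, ball x (delta t) y ->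
             Rabs (s - t) < delta t -> P y s).
  { intros t; exact (proj2_sig (constructive_indefinite_description _ (H' t))). }
  destruct (compactness_value_1d a b delta) as [d Hdd].
  (* The covering property holds under a double negation, which is harmless here because the goal is
     proved by contradiction. *)
  exists d; intros y Hy s Hs; apply NNPP; intros Hn.
  apply (Hdd s Hs); intros [t [Ht [Hst Hle]]]; apply Hn.
  apply (Hd t Ht); [apply ball_le with d; assumption|exact Hst].
Qed.

Lemma continuous_section (T : UniformSpace) (F : T -> R -> R) (p : T * R) :
  continuous (fun q => F (fst q) (snd q)) p -> continuous (F (fst p)) (snd p).
Proof.
  destruct p as [x t]; simpl; intros H.
  apply (continuous_comp_2 (fun _ : R => x) (fun s : R => s) F).
  - apply continuous_const.
  - apply continuous_id.
  - exact H.
Qed.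

(** Joint continuity is asked on a neighbourhood of the slice over [x], so that the integrals for
    nearby parameters exist too. *)
Definition param_continuous (T : UniformSpace) (x : T) (a b : R) (F : T -> R -> R) : Prop :=
  forall t, a <= t <= b ->
    locally (x, t) (fun p => continuous (fun q => F (fst q) (snd q)) p).

Lemma param_ex_RInt (T : UniformSpace) (x : T) (a b : R) (F : T -> R -> R) : a <= b ->
  param_continuous T x a b F -> locally x (fun y => ex_RInt (F y) a b).
Proof.
  intros Hab H.
  assert (H1 : locally x (fun y => forall t, a <= t <= b -> continuous (F y) t)).
  { apply tube; intros t Ht; generalize (H t Ht); apply filter_imp; intros p.
    apply continuous_section. }
  revert H1; apply filter_imp; intros y Hy.
  apply (ex_RInt_continuous (V := R_CompleteNormedModule)); intros s Hs.
  rewrite Rmin_left, Rmax_right in Hs by lra; apply Hy; exact Hs.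
Qed.

Lemma RInt_param_continuous (T : UniformSpace) (x : T) (a b : R) (F : T -> R -> R) : a <= b ->
  param_continuous T x a b F -> continuous (fun y => RInt (F y) a b) x.
Proof.
  intros Hab H; apply continuous_eps; intros eps Heps.
  (* The added 1 keeps the denominator positive when [a = b]. *)
  set (e := eps / (2 * (b - a + 1))).
  assert (He : 0 < e) by (apply Rdiv_lt_0_compat; lra).
  assert (Hex := param_ex_RInt T x a b F Hab H).
  assert (H1 : locally x (fun y => forall t, a <= t <= b -> Rabs (F y t - F x t) <= e)).
  { apply tube; intros t Ht.
    assert (Hc := locally_singleton _ _ (H t Ht)).
    destruct (proj1 (continuous_eps _ _ _) Hc (e / 2)) as [d Hd]; [lra|].
    exists d; intros [y s] [H1 H2]; simpl in *.
    assert (A := Hd (y, s) (conj H1 H2)); assert (B := Hd (x, s) (conj (ball_center x d) H2)).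
    simpl in A, B.
    replace (F y s - F x s) with ((F y s - F x t) - (F x s - F x t)) by ring.
    apply Rle_trans with (1 := Rabs_triang _ _); rewrite Rabs_Ropp; lra. }
  assert (Hx := locally_singleton _ _ Hex).
  destruct (filter_and _ _ Hex H1) as [d Hd]; exists d; intros y Hy.
  destruct (Hd y Hy) as [Hy1 Hy2].
  replace (RInt (F y) a b - RInt (F x) a b) with (RInt (fun t => F y t - F x t) a b)
    by exact (RInt_minus (V := R_CompleteNormedModule) (F y) (F x) a b Hy1 Hx).
  apply Rle_lt_trans with ((b - a) * e).
  - apply abs_RInt_le_const; [lra| |exact Hy2].
    apply (ex_RInt_minus (V := R_NormedModule)); assumption.
  - unfold e; apply Rle_lt_trans with (eps / 2 * ((b - a) / (b - a + 1))).
    + right; field; lra.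
    + assert ((b - a) / (b - a + 1) <= 1) by (apply Rle_div_l; lra).
      nra.
Qed.

Lemma is_derive_RInt_param_cont (F F' : R -> R -> R) (a b x : R) : a <= b ->
  (forall t, a <= t <= b -> locally (x, t) (fun p =>
     is_derive (fun u => F u (snd p)) (fst p) (F' (fst p) (snd p)))) ->
  param_continuous R_UniformSpace x a b F -> param_continuous R_UniformSpace x a b F' ->
  is_derive (fun y => RInt (F y) a b) x (RInt (F' x) a b).
Proof.
  intros Hab Hd HF HF'.
  assert (Hd' : locally x (fun y => forall t, a <= t <= b ->
             is_derive (fun u => F u t) y (F' y t))).
  { apply (tube R_UniformSpace x a b (fun y t => is_derive (fun u => F u t) y (F' y t))).
    exact Hd. }
  replace (RInt (F' x) a b) with (RInt (fun t => Derive (fun u => F u t) x) a b).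
  - apply (is_derive_RInt_param F a b x).
    + revert Hd'; apply filter_imp; intros y Hy t Ht.
      rewrite Rmin_left, Rmax_right in Ht by lra; exists (F' y t); apply Hy; exact Ht.
    + intros t Ht; rewrite Rmin_left, Rmax_right in Ht by lra.
      apply (continuity_2d_pt_ext_loc F').
      * destruct (Hd t Ht) as [d H]; exists d; intros u v Hu Hv.
        symmetry; apply is_derive_unique; apply (H (u, v)); split; assumption.
      * apply continuity_2d_pt_filterlim; exact (locally_singleton _ _ (HF' t Ht)).
    + exact (param_ex_RInt R_UniformSpace x a b F Hab HF).
  - apply RInt_ext; intros t Ht; rewrite Rmin_left, Rmax_right in Ht by lra.
    apply is_derive_unique; apply (locally_singleton _ _ Hd'); lra.
Qed.

(** * Continuity, derivatives and integrals relative to an interval *)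

Definition convex_set (I : R -> Prop) : Prop :=
  forall s t x, I s -> I t -> s <= x <= t -> I x.

Definition cwithin (I : R -> Prop) (G : R -> R) (t : R) : Prop :=
  forall eps, 0 < eps -> exists d, 0 < d /\ forall s, I s -> Rabs (s - t) < d ->
    Rabs (G s - G t) < eps.

(** At an endpoint of [I] this is a one-sided derivative. The estimate is multiplied out and not
    strict, so the case [s = t] needs no exclusion. *)
Definition dwithin (I : R -> Prop) (G : R -> R) (t l : R) : Prop :=
  forall eps, 0 < eps -> exists d, 0 < d /\ forall s, I s -> Rabs (s - t) < d ->
    Rabs (G s - G t - l * (s - t)) <= eps * Rabs (s - t).

Lemma dwithin_cwithin (I : R -> Prop) (G : R -> R) (t l : R) :
  dwithin I G t l -> cwithin I G t.
Proof.
  intros H eps Heps; destruct (H 1 Rlt_0_1) as [d [Hd H1]].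
  set (M := Rabs l + 1).
  assert (HM : 0 < M) by (unfold M; generalize (Rabs_pos l); lra).
  exists (Rmin d (eps / M)); split.
  { apply Rmin_pos; [exact Hd|apply Rdiv_lt_0_compat; assumption]. }
  intros s Hs Hst.
  assert (A := H1 s Hs (lt_Rmin_l Hst)).
  assert (B := lt_Rmin_r Hst).
  replace (G s - G t) with ((G s - G t - l * (s - t)) + l * (s - t)) by ring.
  apply Rle_lt_trans with (1 := Rabs_triang _ _); rewrite Rabs_mult.
  apply Rle_lt_trans with (M * Rabs (s - t)); [unfold M; lra|].
  replace eps with (M * (eps / M)) by (field; lra).
  apply Rmult_lt_compat_l; assumption.
Qed.

(** Even where [phi] reaches an endpoint of [I] the result is a two-sided derivative, because [phi]
    keeps its values in [I], where the expansion of [G] is valid. *)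
Lemma dwithin_comp (I : R -> Prop) (G phi : R -> R) (x L m : R) :
  dwithin I G (phi x) L -> is_derive phi x m -> locally x (fun y => I (phi y)) ->
  is_derive (fun y => G (phi y)) x (L * m).
Proof.
  intros HG Hphi [d0 HI]; apply is_derive_eps; intros eps Heps.
  set (M := Rabs m + 1 + Rabs L).
  assert (Hm := Rabs_pos m); assert (HL := Rabs_pos L).
  set (e := Rmin 1 (eps / (2 * M))).
  assert (He : 0 < e) by (apply Rmin_pos; [lra|apply Rdiv_lt_0_compat; unfold M; lra]).
  assert (He1 : e <= 1) by apply Rmin_l.
  assert (HeM : e * M <= eps / 2).
  { apply Rle_trans with (eps / (2 * M) * M).
    - apply Rmult_le_compat_r; [unfold M; lra|apply Rmin_r].
    - right; field; unfold M; lra. }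
  destruct (HG e He) as [d1 [Hd1 H1]].
  destruct (proj1 (is_derive_eps phi x m) Hphi e He) as [d2 [Hd2 H2]].
  set (N := Rabs m + 1); assert (HN : 0 < N) by (unfold N; lra).
  exists (Rmin d0 (Rmin d2 (d1 / N))); split.
  { repeat apply Rmin_pos; [apply cond_pos|assumption|apply Rdiv_lt_0_compat; assumption]. }
  intros y Hy.
  assert (Hy0 := lt_Rmin_l Hy).
  assert (Hy1 := lt_Rmin_r Hy).
  assert (Hy2 := lt_Rmin_l Hy1).
  assert (Hy3 := lt_Rmin_r Hy1).
  assert (A := H2 y Hy2).
  assert (B : Rabs (phi y - phi x) <= N * Rabs (y - x)).
  { replace (phi y - phi x) with ((phi y - phi x - m * (y - x)) + m * (y - x)) by ring.
    apply Rle_trans with (1 := Rabs_triang _ _); rewrite Rabs_mult; unfold N.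
    generalize (Rabs_pos (y - x)); nra. }
  assert (B' : Rabs (phi y - phi x) < d1).
  { apply Rle_lt_trans with (1 := B).
    replace d1 with (N * (d1 / N)) by (field; lra); apply Rmult_lt_compat_l; assumption. }
  assert (D := H1 (phi y) (HI y Hy0) B').
  replace (G (phi y) - G (phi x) - L * m * (y - x)) with
    ((G (phi y) - G (phi x) - L * (phi y - phi x)) + L * (phi y - phi x - m * (y - x))) by ring.
  apply Rle_trans with (1 := Rabs_triang _ _); rewrite Rabs_mult.
  assert (E : Rabs L * Rabs (phi y - phi x - m * (y - x)) <= Rabs L * (e * Rabs (y - x)))
    by (apply Rmult_le_compat_l; assumption).
  assert (F : e * Rabs (phi y - phi x) <= e * (N * Rabs (y - x)))
    by (apply Rmult_le_compat_l; lra).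
  assert (K : e * M * Rabs (y - x) <= eps / 2 * Rabs (y - x))
    by (apply Rmult_le_compat_r; [apply Rabs_pos|exact HeM]).
  unfold M, N in *; generalize (Rabs_pos (y - x)); nra.
Qed.

(** Expand [G] at [phi x] and [G o phi] at [x], then divide by [c]. Continuity of [phi] brings
    [phi y] into the range where the expansion of [G] applies. This is how [tau] will be shown to be
    differentiable. *)
Lemma dwithin_inverse (I : R -> Prop) (G phi : R -> R) (x c m : R) :
  dwithin I G (phi x) c -> 0 < c -> is_derive (fun y => G (phi y)) x m ->
  continuous phi x -> locally x (fun y => I (phi y)) ->
  is_derive phi x (m / c).
Proof.
  intros HG Hc Hm Hphi [d0 HI]; apply is_derive_eps; intros eps Heps.
  assert (Hm0 := Rabs_pos m).
  set (K := 2 * (Rabs m + 1) / c).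
  assert (HK : 0 < K) by (apply Rdiv_lt_0_compat; lra).
  set (e1 := Rmin (c / 2) (eps * c / (2 * K))).
  assert (He1 : 0 < e1).
  { apply Rmin_pos; [lra|apply Rdiv_lt_0_compat; [nra|lra]]. }
  set (e2 := Rmin 1 (eps * c / 2)).
  assert (He2 : 0 < e2) by (apply Rmin_pos; nra).
  destruct (HG e1 He1) as [d1 [Hd1 H1]].
  destruct (proj1 (is_derive_eps _ x m) Hm e2 He2) as [d2 [Hd2 H2]].
  destruct (proj1 (continuous_eps _ phi x) Hphi d1 Hd1) as [d3 H3].
  exists (Rmin d0 (Rmin d2 d3)); split.
  { repeat apply Rmin_pos; try apply cond_pos; assumption. }
  intros y Hy.
  assert (Hy0 := lt_Rmin_l Hy).
  assert (Hy1 := lt_Rmin_r Hy).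
  assert (Hy2 := lt_Rmin_l Hy1).
  assert (Hy3 := lt_Rmin_r Hy1).
  assert (A := H2 y Hy2).
  assert (B := H1 (phi y) (HI y Hy0) (H3 y Hy3)).
  set (X := phi y - phi x) in *; set (h := y - x) in *.
  assert (E1 : e1 <= c / 2) by apply Rmin_l.
  assert (E2 : e1 * K <= eps * c / 2).
  { apply Rle_trans with (eps * c / (2 * K) * K).
    - apply Rmult_le_compat_r; [lra|apply Rmin_r].
    - right; field; lra. }
  assert (E3 : e2 <= 1) by apply Rmin_l.
  assert (E4 : e2 <= eps * c / 2) by apply Rmin_r.
  assert (HX := Rabs_pos X); assert (Hh := Rabs_pos h).
  assert (T1 : Rabs (c * X - m * h) <= e1 * Rabs X + e2 * Rabs h).
  { replace (c * X - m * h) with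
      ((G (phi y) - G (phi x) - m * h) - (G (phi y) - G (phi x) - c * X)) by ring.
    apply Rle_trans with (1 := Rabs_triang _ _); rewrite Rabs_Ropp; lra. }
  assert (T2 : c * Rabs X <= Rabs (c * X - m * h) + Rabs m * Rabs h).
  { rewrite <- Rabs_mult, <- (Rabs_pos_eq c) at 1 by lra; rewrite <- Rabs_mult.
    replace (c * X) with ((c * X - m * h) + m * h) at 1 by ring; apply Rabs_triang. }
  (* As [e1 <= c / 2], the term [e1 |X|] is absorbed on the left: [c / 2 * |X| <= (|m| + 1) |h|],
     which is the origin of [K]. *)
  assert (T3 : Rabs X <= K * Rabs h).
  { unfold K; replace (2 * (Rabs m + 1) / c * Rabs h) with ((2 * (Rabs m + 1) * Rabs h) / c)
      by (field; lra).
    apply Rle_div_r; [lra|]; nra. }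
  replace (X - m / c * h) with ((c * X - m * h) / c) by (field; lra).
  unfold Rdiv; rewrite Rabs_mult, Rabs_inv, (Rabs_pos_eq c) by lra.
  apply Rle_div_l; [lra|].
  apply Rle_trans with (1 := T1).
  nra.
Qed.

(** Composing with [clamp a b] turns continuity within [[a, b]] into continuity on the whole line
    without changing values on [[a, b]]. *)
Definition clamp (a b x : R) : R := Rmax a (Rmin x b).

Lemma clamp_in (a b x : R) : a <= b -> a <= clamp a b x <= b.
Proof.
  intros H; unfold clamp; split; [apply Rmax_l|apply Rmax_lub; [exact H|apply Rmin_r]].
Qed.

Lemma clamp_id (a b x : R) : a <= x <= b -> clamp a b x = x.
Proof. intros H; unfold clamp; rewrite Rmin_left, Rmax_right; lra. Qed.

Lemma clamp_lip (a b x y : R) : a <= b -> Rabs (clamp a b x - clamp a b y) <= Rabs (x - y).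
Proof.
  intros H; unfold clamp, Rmax, Rmin.
  repeat destruct Rle_dec; unfold Rabs; repeat destruct Rcase_abs; lra.
Qed.

Lemma clamp_continuous (I : R -> Prop) (W : R -> R) (a b : R) : a <= b ->
  (forall t, a <= t <= b -> I t /\ cwithin I W t) ->
  forall x, continuous (fun x => W (clamp a b x)) x.
Proof.
  intros Hab H x; apply continuous_eps; intros eps Heps.
  destruct (H (clamp a b x) (clamp_in a b x Hab)) as [_ Hc].
  destruct (Hc eps Heps) as [d [Hd H1]]; exists (mkposreal d Hd); intros y Hy.
  apply H1.
  - apply H; apply clamp_in; exact Hab.
  - apply Rle_lt_trans with (1 := clamp_lip a b y x Hab); exact Hy.
Qed.

Lemma cwithin_ex_RInt (I : R -> Prop) (W : R -> R) (a b : R) :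
  convex_set I -> (forall t, I t -> cwithin I W t) -> I a -> I b -> ex_RInt W a b.
Proof.
  intros HI HW.
  assert (K : forall a b, I a -> I b -> a <= b -> ex_RInt W a b).
  { intros c d Hc Hd Hcd; apply (ex_RInt_ext (fun x => W (clamp c d x))).
    - intros x Hx; rewrite Rmin_left, Rmax_right in Hx by lra.
      rewrite clamp_id by lra; reflexivity.
    - apply (ex_RInt_continuous (V := R_CompleteNormedModule)); intros x _.
      apply (clamp_continuous I); [exact Hcd|]; intros t Ht.
      assert (I t) by (apply (HI c d); assumption); auto. }
  intros Ha Hb; destruct (Rle_dec a b) as [H|H]; [apply K; assumption|].
  apply ex_RInt_swap; apply K; [assumption|assumption|lra].
Qed.

Lemma cwithin_RInt_dwithin (I : R -> Prop) (W : R -> R) (t0 t : R) :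
  convex_set I -> (forall t, I t -> cwithin I W t) -> I t0 -> I t ->
  dwithin I (fun s => RInt W t0 s) t (W t).
Proof.
  intros HI HW H0 Ht eps Heps; destruct (HW t Ht eps Heps) as [d [Hd H1]].
  exists d; split; [exact Hd|]; intros s Hs Hst.
  assert (E : forall a b, I a -> I b -> ex_RInt W a b)
    by (intros; apply (cwithin_ex_RInt I); assumption).
  replace (RInt W t0 s - RInt W t0 t - W t * (s - t)) with (RInt (fun x => W x - W t) t s).
  2:{ rewrite (RInt_minus (V := R_CompleteNormedModule) W (fun _ => W t));
        [|apply E; assumption|apply ex_RInt_const].
      rewrite (RInt_const (V := R_CompleteNormedModule)).
      rewrite <- (RInt_Chasles (V := R_CompleteNormedModule) W t0 t s) by (apply E; assumption).
      unfold minus, plus, opp, scal; simpl; unfold mult; simpl; ring. }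
  assert (K : forall a b, I a -> I b -> a <= b -> Rabs (a - t) < d -> Rabs (b - t) < d ->
     Rabs (RInt (fun x => W x - W t) a b) <= (b - a) * eps).
  { intros a b Ha Hb Hab Hat Hbt; apply abs_RInt_le_const; [exact Hab| |].
    - apply (ex_RInt_minus (V := R_NormedModule)); [apply E; assumption|apply ex_RInt_const].
    - intros x Hx; left; apply H1; [apply (HI a b); assumption|].
      apply Rabs_def2 in Hat; apply Rabs_def2 in Hbt; apply Rabs_def1; lra. }
  assert (Htt : Rabs (t - t) < d) by (replace (t - t) with 0 by ring; rewrite Rabs_R0; exact Hd).
  destruct (Rle_dec t s) as [H|H].
  - rewrite (Rabs_pos_eq (s - t)) by lra; rewrite Rmult_comm; apply K; assumption.
  - rewrite <- (opp_RInt_swap (V := R_CompleteNormedModule)).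
    + unfold opp; simpl; rewrite Rabs_Ropp, (Rabs_left (s - t)) by lra.
      replace (eps * - (s - t)) with ((t - s) * eps) by ring; apply K; try assumption; lra.
    + apply (ex_RInt_minus (V := R_NormedModule)); [apply E; assumption|apply ex_RInt_const].
Qed.

(** * Goursat's theorem *)

Definition circulation (P Q : C -> R) (a b c d : R) : R :=
  RInt (fun x => P (x, c)) a b + RInt (fun y => Q (b, y)) c d
  - RInt (fun x => P (x, d)) a b - RInt (fun y => Q (a, y)) c d.

(** The condition [P_y = Q_x] at a single point, with mere differentiability. The partial
    derivatives may be discontinuous, so Green's formula cannot be integrated directly. *)
Definition closed_form_at (P Q : C -> R) (z : C) : Prop :=
  exists p e q, grad_at P z p e /\ grad_at Q z e q.

Lemma continuous_horizontal (u : C -> R) (x y : R) :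
  continuous u (x, y) -> continuous (fun t => u (t, y)) x.
Proof.
  intros H; apply (continuous_comp (fun t => (t, y)) u); [|exact H].
  apply continuous_pair; [apply continuous_id|apply continuous_const].
Qed.

Lemma continuous_vertical (u : C -> R) (x y : R) :
  continuous u (x, y) -> continuous (fun t => u (x, t)) y.
Proof.
  intros H; apply (continuous_comp (fun t => (x, t)) u); [|exact H].
  apply continuous_pair; [apply continuous_const|apply continuous_id].
Qed.

Lemma RInt_near_const (f : R -> R) (a b l M : R) : a <= b -> ex_RInt f a b ->
  (forall t, a <= t <= b -> Rabs (f t - l) <= M) ->
  Rabs (RInt f a b - l * (b - a)) <= (b - a) * M.
Proof.
  intros Hab Hf H.
  replace (RInt f a b - l * (b - a)) with (RInt (fun t => f t - l) a b).
  - apply abs_RInt_le_const; [exact Hab| |exact H].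
    apply (ex_RInt_minus (V := R_NormedModule)); [exact Hf|apply ex_RInt_const].
  - rewrite (RInt_minus (V := R_CompleteNormedModule) f (fun _ => l));
      [|exact Hf|apply ex_RInt_const].
    rewrite (RInt_const (V := R_CompleteNormedModule)).
    unfold minus, plus, opp, scal; simpl; unfold mult; simpl; ring.
Qed.

(** The affine parts of [P] and [Q] at [z] form a closed differential, whose circulation is zero.
    The remainder is at most [eps (w + h)] on a boundary of length [2 (w + h)]. *)
Lemma circulation_local (P Q : C -> R) (z : C) (eps : R) : 0 < eps ->
  closed_form_at P Q z ->
  exists d, 0 < d /\ forall x y w h, 0 <= w < d -> 0 <= h < d ->
    x <= Re z <= x + w -> y <= Im z <= y + h ->
    (forall t s, x <= t <= x + w -> y <= s <= y + h ->
       continuous P (t, s) /\ continuous Q (t, s)) ->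
    Rabs (circulation P Q x (x + w) y (y + h)) <= 2 * eps * (w + h) ^ 2.
Proof.
  intros Heps (p & e & q & HP & HQ).
  destruct (HP (mkposreal eps Heps)) as [d1 H1], (HQ (mkposreal eps Heps)) as [d2 H2].
  simpl in H1, H2.
  exists (Rmin d1 d2); split; [apply Rmin_pos; apply cond_pos|].
  intros x y w h Hw Hh Hx Hy Hcont.
  assert (Rmin d1 d2 <= d1) by apply Rmin_l; assert (Rmin d1 d2 <= d2) by apply Rmin_r.
  assert (Hest : forall t s, x <= t <= x + w -> y <= s <= y + h ->
    Rabs (P (t, s) - P (Re z, Im z) - (p * (t - Re z) + e * (s - Im z))) <= eps * (w + h) /\
    Rabs (Q (t, s) - Q (Re z, Im z) - (e * (t - Re z) + q * (s - Im z))) <= eps * (w + h)).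
  { intros t s Ht Hs.
    assert (Ht' : Rabs (t - Re z) <= w) by (apply Rabs_le; lra).
    assert (Hs' : Rabs (s - Im z) <= h) by (apply Rabs_le; lra).
    assert (Hm : eps * Rmax (Rabs (t - Re z)) (Rabs (s - Im z)) <= eps * (w + h)).
    { apply Rmult_le_compat_l; [lra|]; apply Rmax_lub; lra. }
    split; (eapply Rle_trans; [|exact Hm]); [apply H1|apply H2]; lra. }
  assert (X0 : x <= x <= x + w) by lra; assert (X1 : x <= x + w <= x + w) by lra.
  assert (Y0 : y <= y <= y + h) by lra; assert (Y1 : y <= y + h <= y + h) by lra.
  assert (EP : forall s, y <= s <= y + h -> ex_RInt (fun t => P (t, s)) x (x + w)).
  { intros s Hs; apply (ex_RInt_continuous (V := R_CompleteNormedModule)); intros t Ht.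
    rewrite Rmin_left, Rmax_right in Ht by lra.
    apply continuous_horizontal; apply Hcont; assumption. }
  assert (EQ : forall t, x <= t <= x + w -> ex_RInt (fun s => Q (t, s)) y (y + h)).
  { intros t Ht; apply (ex_RInt_continuous (V := R_CompleteNormedModule)); intros s Hs.
    rewrite Rmin_left, Rmax_right in Hs by lra.
    apply continuous_vertical; apply Hcont; assumption. }
  assert (IP : Rabs (RInt (fun t => P (t, y) - P (t, y + h)) x (x + w) - (- e * h) * (x + w - x))
               <= (x + w - x) * (2 * eps * (w + h))).
  { apply RInt_near_const; [lra| |].
    - apply (ex_RInt_minus (V := R_NormedModule)); apply EP; lra.
    - intros t Ht.
      assert (A := proj1 (Hest t y Ht Y0)).
      assert (B := proj1 (Hest t (y + h) Ht Y1)).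
      apply Rabs_le_between in A; apply Rabs_le_between in B; apply Rabs_le; nra. }
  assert (IQ : Rabs (RInt (fun s => Q (x + w, s) - Q (x, s)) y (y + h) - (e * w) * (y + h - y))
               <= (y + h - y) * (2 * eps * (w + h))).
  { apply RInt_near_const; [lra| |].
    - apply (ex_RInt_minus (V := R_NormedModule)); apply EQ; lra.
    - intros s Hs.
      assert (A := proj2 (Hest x s X0 Hs)).
      assert (B := proj2 (Hest (x + w) s X1 Hs)).
      apply Rabs_le_between in A; apply Rabs_le_between in B; apply Rabs_le; nra. }
  rewrite (RInt_minus (V := R_CompleteNormedModule)) in IP by (apply EP; lra).
  rewrite (RInt_minus (V := R_CompleteNormedModule)) in IQ by (apply EQ; lra).
  unfold minus, plus, opp in IP, IQ; simpl in IP, IQ.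
  unfold circulation.
  apply Rabs_le_between in IP; apply Rabs_le_between in IQ; apply Rabs_le; nra.
Qed.

Section Goursat.

Variables (P Q : C -> R) (a b c d : R).
Hypothesis Hcl : forall t s, a <= t <= b -> c <= s <= d -> closed_form_at P Q (t, s).

(** A rectangle is encoded as [((x, y), (w, h))], its lower left corner and its side lengths. *)
Let inside (s : (R * R) * (R * R)) : Prop :=
  0 <= fst (snd s) /\ 0 <= snd (snd s) /\
  a <= fst (fst s) /\ fst (fst s) + fst (snd s) <= b /\
  c <= snd (fst s) /\ snd (fst s) + snd (snd s) <= d.

Let circ (s : (R * R) * (R * R)) : R :=
  circulation P Q (fst (fst s)) (fst (fst s) + fst (snd s))
    (snd (fst s)) (snd (fst s) + snd (snd s)).

(** The premise [inside s] is part of the relation, so that every [s] is related to something and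
    choice yields a total function to iterate. *)
Let quarter (s s' : (R * R) * (R * R)) : Prop :=
  inside s ->
  inside s' /\ fst (snd s') = fst (snd s) / 2 /\ snd (snd s') = snd (snd s) / 2 /\
  fst (fst s) <= fst (fst s') /\ snd (fst s) <= snd (fst s') /\
  fst (fst s') + fst (snd s') <= fst (fst s) + fst (snd s) /\
  snd (fst s') + snd (snd s') <= snd (fst s) + snd (snd s) /\
  Rabs (circ s) <= 4 * Rabs (circ s').

Lemma closed_form_continuous (z : C) : closed_form_at P Q z -> continuous P z /\ continuous Q z.
Proof.
  intros (p & e & q & H1 & H2); split; eapply grad_continuous; eassumption.
Qed.

(** The circulations of the four quarters add up to that of the rectangle, the inner edges
    cancelling, so one of them has at least a quarter of its absolute value. *)
Lemma exists_quarter (s : (R * R) * (R * R)) : exists s', quarter s s'.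
Proof.
  destruct (classic (inside s)) as [Hs|Hs].
  2:{ exists s; intros H; contradiction. }
  destruct s as [[x y] [w h]]; destruct Hs as (Hw & Hh & H1 & H2 & H3 & H4); simpl in *.
  assert (EP : forall u v s, x <= u <= x + w -> x <= v <= x + w -> y <= s <= y + h ->
    ex_RInt (fun t => P (t, s)) u v).
  { intros u v s Hu Hv Hs; apply (ex_RInt_continuous (V := R_CompleteNormedModule)).
    intros t Ht; assert (x <= t <= x + w).
    { revert Ht; unfold Rmin, Rmax; destruct Rle_dec; lra. }
    apply continuous_horizontal; apply closed_form_continuous; apply Hcl; lra. }
  assert (EQ : forall u v t, y <= u <= y + h -> y <= v <= y + h -> x <= t <= x + w ->
    ex_RInt (fun s => Q (t, s)) u v).
  { intros u v t Hu Hv Ht; apply (ex_RInt_continuous (V := R_CompleteNormedModule)).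
    intros s Hs; assert (y <= s <= y + h).
    { revert Hs; unfold Rmin, Rmax; destruct Rle_dec; lra. }
    apply continuous_vertical; apply closed_form_continuous; apply Hcl; lra. }
  set (w2 := w / 2); set (h2 := h / 2).
  assert (Hsum : circ ((x, y), (w, h)) =
    circ ((x, y), (w2, h2)) + circ ((x + w2, y), (w2, h2)) +
    circ ((x, y + h2), (w2, h2)) + circ ((x + w2, y + h2), (w2, h2))).
  { unfold circ, circulation; simpl.
    replace (x + w2 + w2) with (x + w) by (unfold w2; field).
    replace (y + h2 + h2) with (y + h) by (unfold h2; field).
    assert (x <= x + w2 <= x + w) by (unfold w2; lra).
    assert (y <= y + h2 <= y + h) by (unfold h2; lra).
    rewrite <- (RInt_Chasles (V := R_CompleteNormedModule) (fun t => P (t, y)) x (x + w2) (x + w))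
      by (apply EP; lra).
    rewrite <- (RInt_Chasles (V := R_CompleteNormedModule) (fun t => P (t, y + h)) x (x + w2) (x + w))
      by (apply EP; lra).
    rewrite <- (RInt_Chasles (V := R_CompleteNormedModule) (fun s => Q (x, s)) y (y + h2) (y + h))
      by (apply EQ; lra).
    rewrite <- (RInt_Chasles (V := R_CompleteNormedModule) (fun s => Q (x + w, s)) y (y + h2) (y + h))
      by (apply EQ; lra).
    unfold plus; simpl; ring. }
  assert (Hch : exists s', (s' = ((x, y), (w2, h2)) \/ s' = ((x + w2, y), (w2, h2)) \/
    s' = ((x, y + h2), (w2, h2)) \/ s' = ((x + w2, y + h2), (w2, h2))) /\
    Rabs (circ ((x, y), (w, h))) <= 4 * Rabs (circ s')).
  { apply NNPP; intros Hn.
    assert (Hn' : forall s', (s' = ((x, y), (w2, h2)) \/ s' = ((x + w2, y), (w2, h2)) \/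
      s' = ((x, y + h2), (w2, h2)) \/ s' = ((x + w2, y + h2), (w2, h2))) ->
      4 * Rabs (circ s') < Rabs (circ ((x, y), (w, h)))).
    { intros s' Hs'; apply Rnot_le_lt; intros Hle; apply Hn; exists s'; auto. }
    assert (A1 := Hn' _ (or_introl eq_refl)).
    assert (A2 := Hn' _ (or_intror (or_introl eq_refl))).
    assert (A3 := Hn' _ (or_intror (or_intror (or_introl eq_refl)))).
    assert (A4 := Hn' _ (or_intror (or_intror (or_intror eq_refl)))).
    rewrite Hsum in A1, A2, A3, A4.
    unfold Rabs in *; repeat destruct Rcase_abs; lra. }
  destruct Hch as [s' [Hs' Hle]]; exists s'; intros _.
  assert (0 <= w2 /\ 0 <= h2 /\ w2 + w2 = w /\ h2 + h2 = h) by (unfold w2, h2; lra).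
  unfold inside; split; [|split; [|split; [|split; [|split; [|split; [|split]]]]]]; try exact Hle;
    destruct Hs' as [->|[->|[->| ->]]]; simpl; try reflexivity; try lra;
    repeat split; lra.
Qed.

(** Bisection: the chosen rectangles shrink to a point, where [circulation_local] bounds the [n]-th
    circulation by [eps] times a constant over [4^n]. This beats the factor [4^n] lost in [n]
    subdivisions, for every [eps]. *)
Lemma goursat : a <= b -> c <= d -> circulation P Q a b c d = 0.
Proof.
  intros Hab Hcd.
  set (next := fun s => proj1_sig (constructive_indefinite_description _ (exists_quarter s))).
  assert (Hnext : forall s, quarter s (next s))
    by (intros s; exact (proj2_sig (constructive_indefinite_description _ (exists_quarter s)))).
  set (st := fun n => Nat.iter n next ((a, c), (b - a, d - c))).
  assert (Hin : forall n, inside (st n)).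
  { induction n as [|n IH].
    - unfold inside; simpl; lra.
    - exact (proj1 (Hnext _ IH)). }
  assert (Hq : forall n, quarter (st n) (st (S n))) by (intros n; apply Hnext).
  set (X := fun n => fst (fst (st n))); set (Y := fun n => snd (fst (st n))).
  set (W := fun n => fst (snd (st n))); set (H := fun n => snd (snd (st n))).
  assert (Hstep : forall n, W (S n) = W n / 2 /\ H (S n) = H n / 2 /\ X n <= X (S n) /\
    Y n <= Y (S n) /\ X (S n) + W (S n) <= X n + W n /\ Y (S n) + H (S n) <= Y n + H n /\
    Rabs (circ (st n)) <= 4 * Rabs (circ (st (S n)))).
  { intros n; exact (proj2 (Hq n (Hin n))). }
  assert (HW : forall n, W n = (b - a) / 2 ^ n).
  { induction n as [|n IH]; [unfold W; simpl; field|].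
    rewrite (proj1 (Hstep n)), IH; simpl; field; apply pow_nonzero; lra. }
  assert (HH : forall n, H n = (d - c) / 2 ^ n).
  { induction n as [|n IH]; [unfold H; simpl; field|].
    rewrite (proj1 (proj2 (Hstep n))), IH; simpl; field; apply pow_nonzero; lra. }
  assert (HC : forall n, Rabs (circ (st 0%nat)) <= 4 ^ n * Rabs (circ (st n))).
  { induction n as [|n IH]; [simpl; lra|].
    apply Rle_trans with (1 := IH); change (4 ^ S n) with (4 * 4 ^ n).
    replace (4 * 4 ^ n * Rabs (circ (st (S n)))) with (4 ^ n * (4 * Rabs (circ (st (S n))))) by ring.
    apply Rmult_le_compat_l; [apply pow_le; lra|apply Hstep]. }
  assert (Hmon : forall (U V : nat -> R), (forall n, 0 <= V n) ->
    (forall n, U n <= U (S n) /\ U (S n) + V (S n) <= U n + V n) ->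
    exists x, forall n, U n <= x <= U n + V n).
  { intros U V HV HU.
    assert (M1 : forall n k, U n <= U (n + k)%nat /\ U (n + k)%nat + V (n + k)%nat <= U n + V n).
    { intros n; induction k as [|k IH]; [rewrite Nat.add_0_r; lra|].
      rewrite Nat.add_succ_r; generalize (HU (n + k)%nat); lra. }
    assert (M2 : forall n m, U n <= U m + V m).
    { intros n m; generalize (M1 n m) (M1 m n) (HV (n + m)%nat).
      rewrite (Nat.add_comm m n); lra. }
    destruct (completeness (fun x => exists n, x = U n)) as [x [Hx1 Hx2]].
    - exists (U 0%nat + V 0%nat); intros x [n ->]; apply M2.
    - exists (U 0%nat), 0%nat; reflexivity.
    - exists x; intros n; split; [apply Hx1; exists n; reflexivity|].
      apply Hx2; intros y [m ->]; apply M2. }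
  assert (HWp : forall n, 0 <= W n) by (intros n; apply (Hin n)).
  assert (HHp : forall n, 0 <= H n) by (intros n; apply (Hin n)).
  destruct (Hmon X W HWp) as [x Hx]; [intros n; split; apply Hstep|].
  destruct (Hmon Y H HHp) as [y Hy]; [intros n; split; apply Hstep|].
  assert (Hxy : closed_form_at P Q (x, y)).
  { apply Hcl; [generalize (Hx 0%nat)|generalize (Hy 0%nat)]; unfold X, W, Y, H; simpl; lra. }
  assert (Hz : forall eps, 0 < eps -> Rabs (circ (st 0%nat)) <= eps).
  { intros eps Heps.
    (* The local bound times [4^n] is [2 e (b - a + d - c)^2]. The added 1 covers a rectangle
       reduced to a point. *)
    set (e := eps / (2 * (b - a + (d - c)) ^ 2 + 1)).
    assert (Hpos : 0 < 2 * (b - a + (d - c)) ^ 2 + 1) by (generalize (pow2_ge_0 (b - a + (d - c))); lra).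
    assert (He : 0 < e) by (apply Rdiv_lt_0_compat; lra).
    destruct (circulation_local P Q (x, y) e He Hxy) as [dl [Hdl Hest]].
    destruct (pow_lt_1_zero (/ 2) ltac:(rewrite Rabs_pos_eq; lra) (dl / (b - a + (d - c) + 1)))
      as [n Hn]; [apply Rdiv_lt_0_compat; lra|].
    specialize (Hn n (Nat.le_refl n)).
    assert (H2n : 0 < 2 ^ n) by (apply pow_lt; lra).
    rewrite pow_inv, Rabs_pos_eq in Hn by (left; apply Rinv_0_lt_compat; exact H2n).
    assert (Hsm : (b - a + (d - c) + 1) * / 2 ^ n < dl).
    { apply (Rmult_lt_compat_l (b - a + (d - c) + 1)) in Hn; [|lra].
      replace ((b - a + (d - c) + 1) * (dl / (b - a + (d - c) + 1))) with dl in Hn by (field; lra).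
      exact Hn. }
    assert (HWn : 0 <= W n < dl) by (split; [apply HWp|rewrite HW; unfold Rdiv; nra]).
    assert (HHn : 0 <= H n < dl) by (split; [apply HHp|rewrite HH; unfold Rdiv; nra]).
    assert (B := Hest (X n) (Y n) (W n) (H n) HWn HHn (Hx n) (Hy n)).
    assert (B' : Rabs (circ (st n)) <= 2 * e * (W n + H n) ^ 2).
    { apply B; intros t s Ht Hs; apply closed_form_continuous.
      destruct (Hin n) as (_ & _ & I1 & I2 & I3 & I4).
      apply Hcl; unfold X, W, Y, H in *; lra. }
    apply Rle_trans with (1 := HC n).
    apply Rle_trans with (4 ^ n * (2 * e * (W n + H n) ^ 2)).
    { apply Rmult_le_compat_l; [apply pow_le; lra|exact B']. }
    rewrite HW, HH.
    replace (4 ^ n) with (2 ^ n * 2 ^ n) by (rewrite <- Rpow_mult_distr; f_equal; ring).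
    replace (2 ^ n * 2 ^ n * (2 * e * ((b - a) / 2 ^ n + (d - c) / 2 ^ n) ^ 2))
      with (e * (2 * (b - a + (d - c)) ^ 2)) by (field; lra).
    unfold e; apply Rle_trans with (eps / (2 * (b - a + (d - c)) ^ 2 + 1) *
      (2 * (b - a + (d - c)) ^ 2 + 1)); [|right; field; lra].
    apply Rmult_le_compat_l; [left; exact He|lra]. }
  assert (H0 : circ (st 0%nat) = 0).
  { destruct (Req_dec (circ (st 0%nat)) 0) as [E|E]; [exact E|].
    apply Rabs_pos_lt in E; generalize (Hz (Rabs (circ (st 0%nat)) / 2)); lra. }
  unfold circ in H0; simpl in H0.
  replace (a + (b - a)) with b in H0 by ring; replace (c + (d - c)) with d in H0 by ring.
  exact H0.
Qed.

End Goursat.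

Definition box (z : C) (r : R) (w : C) : Prop :=
  Rabs (Re w - Re z) < r /\ Rabs (Im w - Im z) < r.

Lemma box_locally (z : C) (r : R) (w : C) : box z r w -> locally w (box z r).
Proof.
  intros [H1 H2]; apply locally_box.
  exists (Rmin (r - Rabs (Re w - Re z)) (r - Rabs (Im w - Im z))); split.
  { apply Rmin_pos; lra. }
  intros v H3 H4; split.
  - replace (Re v - Re z) with ((Re v - Re w) + (Re w - Re z)) by ring.
    apply Rle_lt_trans with (1 := Rabs_triang _ _).
    generalize (lt_Rmin_l H3); lra.
  - replace (Im v - Im z) with ((Im v - Im w) + (Im w - Im z)) by ring.
    apply Rle_lt_trans with (1 := Rabs_triang _ _).
    generalize (lt_Rmin_r H4); lra.
Qed.

Lemma between_box (x0 x t r : R) : Rabs (x - x0) < r -> Rmin x0 x <= t <= Rmax x0 x -> Rabs (t - x0) < r.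
Proof.
  intros H Ht; apply Rabs_def2 in H; apply Rabs_def1; revert Ht;
    unfold Rmin, Rmax; destruct Rle_dec; lra.
Qed.

Lemma circulation_swap_x (P Q : C -> R) (a b c d : R) :
  ex_RInt (fun x => P (x, c)) a b -> ex_RInt (fun x => P (x, d)) a b ->
  circulation P Q a b c d = - circulation P Q b a c d.
Proof.
  intros H1 H2; unfold circulation.
  rewrite <- (opp_RInt_swap (V := R_CompleteNormedModule) (fun x => P (x, c)) a b H1).
  rewrite <- (opp_RInt_swap (V := R_CompleteNormedModule) (fun x => P (x, d)) a b H2).
  unfold opp; simpl; ring.
Qed.

Lemma circulation_swap_y (P Q : C -> R) (a b c d : R) :
  ex_RInt (fun y => Q (a, y)) c d -> ex_RInt (fun y => Q (b, y)) c d ->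
  circulation P Q a b c d = - circulation P Q a b d c.
Proof.
  intros H1 H2; unfold circulation.
  rewrite <- (opp_RInt_swap (V := R_CompleteNormedModule) (fun y => Q (a, y)) c d H1).
  rewrite <- (opp_RInt_swap (V := R_CompleteNormedModule) (fun y => Q (b, y)) c d H2).
  unfold opp; simpl; ring.
Qed.

(** [F] integrates along a horizontal and then a vertical segment, [G] in the other order. Each
    shows one partial derivative at once, [F] the one in [y] and [G] the one in [x], and Goursat's
    theorem says that they agree. *)
Lemma closed_form_primitive (P Q : C -> R) (z : C) (r : R) :
  (forall w, box z r w -> closed_form_at P Q w) ->
  exists F, forall w, box z r w -> grad_at F w (P w) (Q w).
Proof.
  intros Hcl; destruct z as [x0 y0].
  assert (HP : forall w, box (x0, y0) r w -> continuous P w /\ continuous Q w).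
  { intros w Hw; apply closed_form_continuous; apply Hcl; exact Hw. }
  assert (EP : forall x y, box (x0, y0) r (x, y) -> ex_RInt (fun t => P (t, y)) x0 x).
  { intros x y [H1 H2]; simpl in *; apply (ex_RInt_continuous (V := R_CompleteNormedModule)).
    intros t Ht; apply continuous_horizontal; apply HP; split; simpl; [|exact H2].
    apply (between_box x0 x); assumption. }
  assert (EQ : forall x y, box (x0, y0) r (x, y) -> ex_RInt (fun s => Q (x, s)) y0 y).
  { intros x y [H1 H2]; simpl in *; apply (ex_RInt_continuous (V := R_CompleteNormedModule)).
    intros t Ht; apply continuous_vertical; apply HP; split; simpl; [exact H1|].
    apply (between_box y0 y); assumption. }
  set (F := fun w : C => RInt (fun t => P (t, y0)) x0 (fst w) + RInt (fun s => Q (fst w, s)) y0 (snd w)).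
  set (G := fun w : C => RInt (fun s => Q (x0, s)) y0 (snd w) + RInt (fun t => P (t, snd w)) x0 (fst w)).
  assert (HFG : forall w, box (x0, y0) r w -> F w = G w).
  { intros [x y] [H1 H2]; simpl in *.
    assert (Hr : 0 < r) by (generalize (Rabs_pos (x - x0)); lra).
    assert (B0 : Rabs (x0 - x0) < r) by (replace (x0 - x0) with 0 by ring; rewrite Rabs_R0; lra).
    assert (B1 : Rabs (y0 - y0) < r) by (replace (y0 - y0) with 0 by ring; rewrite Rabs_R0; lra).
    assert (Z : circulation P Q x0 x y0 y = 0).
    { assert (K : forall t s, Rmin x0 x <= t <= Rmax x0 x -> Rmin y0 y <= s <= Rmax y0 y ->
         closed_form_at P Q (t, s)).
      { intros t s Ht Hs; apply Hcl; split; simpl;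
          [apply (between_box x0 x)|apply (between_box y0 y)]; assumption. }
      assert (Z0 := goursat P Q (Rmin x0 x) (Rmax x0 x) (Rmin y0 y) (Rmax y0 y) K
        (Rminmax x0 x) (Rminmax y0 y)).
      revert Z0; clear K.
      (* [goursat] needs ordered bounds; the other positions of [(x, y)] relative to the centre only
         change the sign of the circulation. *)
      assert (SX : forall c d, (c = y0 /\ d = y) \/ (c = y /\ d = y0) ->
        circulation P Q x x0 c d = 0 -> circulation P Q x0 x c d = 0).
      { intros c d Hcd Z; rewrite circulation_swap_x, Z; [ring| |];
          destruct Hcd as [[-> ->]|[-> ->]]; apply EP; split; assumption. }
      assert (SY : forall c d, (c = x0 /\ d = x) \/ (c = x /\ d = x0) ->
        circulation P Q c d y y0 = 0 -> circulation P Q c d y0 y = 0).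
      { intros c d Hcd Z; rewrite circulation_swap_y, Z; [ring| |];
          destruct Hcd as [[-> ->]|[-> ->]]; apply EQ; split; assumption. }
      unfold Rmin, Rmax; destruct (Rle_dec x0 x), (Rle_dec y0 y); intros Z0; auto. }
    unfold circulation in Z; unfold F, G; simpl; lra. }
  exists F; intros [x y] Hw.
  apply (grad_C1 F P (x, y)).
  - generalize (box_locally _ _ _ Hw); apply filter_imp; intros [u v] Hb; simpl.
    apply (is_derive_ext_loc (fun t => G (t, v))).
    { assert (Hl := box_locally _ _ _ Hb); destruct Hl as [d Hd]; exists d; intros t Ht.
      symmetry; apply HFG; apply (Hd (t, v)); split; [exact Ht|apply ball_center]. }
    unfold G; simpl.
    replace (P (u, v)) with (0 + P (u, v)) by ring.
    apply (is_derive_plus (K := R_AbsRing) (V := R_NormedModule)).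
    + apply is_derive_Rconst.
    + apply (is_derive_RInt (V := R_NormedModule) (fun t => P (t, v)) _ x0).
      * destruct (box_locally _ _ _ Hb) as [d Hd]; exists d; intros t Ht.
        apply (RInt_correct (V := R_CompleteNormedModule)); apply EP.
        apply (Hd (t, v)); split; [exact Ht|apply ball_center].
      * apply continuous_horizontal; apply HP; exact Hb.
  - simpl; unfold F; simpl.
    replace (Q (x, y)) with (0 + Q (x, y)) by ring.
    apply (is_derive_plus (K := R_AbsRing) (V := R_NormedModule)).
    + apply is_derive_Rconst.
    + apply (is_derive_RInt (V := R_NormedModule) (fun s => Q (x, s)) _ y0).
      * destruct (box_locally _ _ _ Hw) as [d Hd]; exists d; intros t Ht.
        apply (RInt_correct (V := R_CompleteNormedModule)); apply EQ.
        apply (Hd (x, t)); split; [apply ball_center|exact Ht].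
      * apply continuous_vertical; apply HP; exact Hw.
  - apply HP; exact Hw.
Qed.

(** * Integrals over circles *)

Lemma param_continuous_comp (T : UniformSpace) (x : T) (a b : R) (A : C -> Prop) (h : C -> R)
    (phi : T -> R -> C) :
  open A -> (forall w, A w -> continuous h w) ->
  (forall p, continuous (fun q => phi (fst q) (snd q)) p) ->
  (forall t, a <= t <= b -> A (phi x t)) ->
  param_continuous T x a b (fun y t => h (phi y t)).
Proof.
  intros HA Hh Hphi Hx t Ht.
  assert (H : locally (x, t) (fun q => A (phi (fst q) (snd q)))).
  { apply (Hphi (x, t)); apply HA; apply Hx; exact Ht. }
  revert H; apply filter_imp; intros p Hp.
  apply (continuous_comp (fun q => phi (fst q) (snd q)) h); [apply Hphi|apply Hh; exact Hp].
Qed.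

Lemma param_continuous_mult (T : UniformSpace) (x : T) (a b : R) (F G : T -> R -> R) :
  param_continuous T x a b F -> param_continuous T x a b G ->
  param_continuous T x a b (fun y t => F y t * G y t).
Proof.
  intros HF HG t Ht; generalize (filter_and _ _ (HF t Ht) (HG t Ht)); apply filter_imp.
  intros p [H1 H2]; exact (continuous_Rmult _ _ _ _ H1 H2).
Qed.

Lemma param_continuous_plus (T : UniformSpace) (x : T) (a b : R) (F G : T -> R -> R) :
  param_continuous T x a b F -> param_continuous T x a b G ->
  param_continuous T x a b (fun y t => F y t + G y t).
Proof.
  intros HF HG t Ht; generalize (filter_and _ _ (HF t Ht) (HG t Ht)); apply filter_imp.
  intros p [H1 H2]; exact (continuous_Rplus _ _ _ _ H1 H2).
Qed.

Lemma param_continuous_weight (T : UniformSpace) (x : T) (a b : R) (c : R -> R) :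
  (forall t, continuous c t) -> param_continuous T x a b (fun _ t => c t).
Proof.
  intros Hc t Ht; apply filter_forall; intros p.
  apply (continuous_comp (fun q : T * R => snd q) c); [apply continuous_snd|apply Hc].
Qed.

Lemma param_ex_RInt_at (T : UniformSpace) (x : T) (a b : R) (F : T -> R -> R) : a <= b ->
  param_continuous T x a b F -> ex_RInt (F x) a b.
Proof. intros Hab H; exact (locally_singleton _ _ (param_ex_RInt T x a b F Hab H)). Qed.

Definition circle_point (z : C) (r t : R) : C := (Re z + r * cos t, Im z + r * sin t).

Definition circle_in (A : C -> Prop) (z : C) (r : R) : Prop :=
  forall t, 0 <= t <= 2 * PI -> A (circle_point z r t).

Definition circle_int (h : C -> R) (c : R -> R) (z : C) (r : R) : R :=
  RInt (fun t => h (circle_point z r t) * c t) 0 (2 * PI).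

Lemma two_PI_pos : 0 <= 2 * PI.
Proof. generalize PI_RGT_0; lra. Qed.

Lemma continuous_Re_all (w : C) : continuous (fun z : C => Re z) w.
Proof. apply continuous_fst. Qed.

Lemma continuous_Im_all (w : C) : continuous (fun z : C => Im z) w.
Proof. apply continuous_snd. Qed.

Lemma continuous_cos_snd (T : UniformSpace) (p : T * R) : continuous (fun q : T * R => cos (snd q)) p.
Proof.
  apply (continuous_comp (fun q : T * R => snd q) cos); [apply continuous_snd|apply continuous_cos].
Qed.

Lemma continuous_sin_snd (T : UniformSpace) (p : T * R) : continuous (fun q : T * R => sin (snd q)) p.
Proof.
  apply (continuous_comp (fun q : T * R => snd q) sin); [apply continuous_snd|apply continuous_sin].
Qed.

Lemma circle_point_continuous_center (r : R) (p : C * R) :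
  continuous (fun q : C * R => circle_point (fst q) r (snd q)) p.
Proof.
  apply continuous_pair; apply continuous_Rplus.
  - apply (continuous_comp (fun q : C * R => fst q) (fun z : C => Re z));
      [apply continuous_fst|apply continuous_Re_all].
  - apply continuous_Rmult; [apply continuous_const|apply continuous_cos_snd].
  - apply (continuous_comp (fun q : C * R => fst q) (fun z : C => Im z));
      [apply continuous_fst|apply continuous_Im_all].
  - apply continuous_Rmult; [apply continuous_const|apply continuous_sin_snd].
Qed.

Lemma circle_point_continuous_radius (z : C) (p : R * R) :
  continuous (fun q : R * R => circle_point z (fst q) (snd q)) p.
Proof.
  apply continuous_pair; apply continuous_Rplus.
  - apply continuous_const.
  - apply continuous_Rmult; [apply continuous_fst|apply continuous_cos_snd].
  - apply continuous_const.
  - apply continuous_Rmult; [apply continuous_fst|apply continuous_sin_snd].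
Qed.

Lemma circle_in_center (A : C -> Prop) (z : C) (r : R) :
  open A -> circle_in A z r -> locally z (fun w => circle_in A w r).
Proof.
  intros HA Hz.
  apply (tube C_UniformSpace z 0 (2 * PI) (fun w t => A (circle_point w r t))).
  intros t Ht; apply (circle_point_continuous_center r (z, t)); apply HA; apply Hz; exact Ht.
Qed.

Lemma circle_param_continuous_center (A : C -> Prop) (h : C -> R) (c : R -> R) (z : C) (r : R) :
  open A -> (forall w, A w -> continuous h w) -> (forall t, continuous c t) ->
  circle_in A z r ->
  param_continuous C_UniformSpace z 0 (2 * PI) (fun w t => h (circle_point w r t) * c t).
Proof.
  intros HA Hh Hc Hz; apply param_continuous_mult.
  - apply (param_continuous_comp _ _ _ _ A h (fun w t => circle_point w r t)); try assumption.
    apply circle_point_continuous_center.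
  - apply param_continuous_weight; exact Hc.
Qed.

Lemma circle_param_continuous_radius (A : C -> Prop) (h : C -> R) (c : R -> R) (z : C) (r : R) :
  open A -> (forall w, A w -> continuous h w) -> (forall t, continuous c t) ->
  circle_in A z r ->
  param_continuous R_UniformSpace r 0 (2 * PI) (fun s t => h (circle_point z s t) * c t).
Proof.
  intros HA Hh Hc Hz; apply param_continuous_mult.
  - apply (param_continuous_comp _ _ _ _ A h (fun s t => circle_point z s t)); try assumption.
    apply circle_point_continuous_radius.
  - apply param_continuous_weight; exact Hc.
Qed.

Lemma circle_ex_RInt (A : C -> Prop) (h : C -> R) (c : R -> R) (z : C) (r : R) :
  open A -> (forall w, A w -> continuous h w) -> (forall t, continuous c t) ->
  circle_in A z r -> ex_RInt (fun t => h (circle_point z r t) * c t) 0 (2 * PI).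
Proof.
  intros HA Hh Hc Hz.
  apply (param_ex_RInt_at R_UniformSpace r 0 (2 * PI) (fun s t => h (circle_point z s t) * c t) two_PI_pos).
  apply (circle_param_continuous_radius A); assumption.
Qed.

Lemma circle_int_continuous_center (A : C -> Prop) (h : C -> R) (c : R -> R) (z : C) (r : R) :
  open A -> (forall w, A w -> continuous h w) -> (forall t, continuous c t) ->
  circle_in A z r -> continuous (fun w => circle_int h c w r) z.
Proof.
  intros HA Hh Hc Hz; unfold circle_int.
  apply (RInt_param_continuous C_UniformSpace z 0 (2 * PI) (fun w t => h (circle_point w r t) * c t) two_PI_pos).
  apply (circle_param_continuous_center A); assumption.
Qed.

Lemma circle_int_continuous_radius (A : C -> Prop) (h : C -> R) (c : R -> R) (z : C) (r : R) :
  open A -> (forall w, A w -> continuous h w) -> (forall t, continuous c t) ->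
  circle_in A z r -> continuous (fun s => circle_int h c z s) r.
Proof.
  intros HA Hh Hc Hz; unfold circle_int.
  apply (RInt_param_continuous R_UniformSpace r 0 (2 * PI) (fun s t => h (circle_point z s t) * c t) two_PI_pos).
  apply (circle_param_continuous_radius A); assumption.
Qed.

Lemma is_derive_affine (x0 k x : R) : is_derive (fun s => x0 + s * k) x k.
Proof. auto_derive; trivial; ring. Qed.

Lemma is_derive_weight (f : R -> R) (x l c : R) :
  is_derive f x l -> is_derive (fun s => f s * c) x (l * c).
Proof.
  intros H; replace (l * c) with (l * c + f x * 0) by ring.
  apply (is_derive_mult (K := R_AbsRing) f (fun _ => c)); [exact H| |intros; apply Rmult_comm].
  apply is_derive_Rconst.
Qed.

Lemma circle_int_derive_radius (A : C -> Prop) (h hx hy : C -> R) (c : R -> R) (z : C) (r : R) :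
  open A -> (forall w, A w -> grad_at h w (hx w) (hy w)) ->
  (forall w, A w -> continuous hx w) -> (forall w, A w -> continuous hy w) ->
  (forall t, continuous c t) -> circle_in A z r ->
  is_derive (fun s => circle_int h c z s) r
    (circle_int hx (fun t => cos t * c t) z r + circle_int hy (fun t => sin t * c t) z r).
Proof.
  intros HA Hh Hhx Hhy Hc Hz.
  assert (Cc : forall t, continuous (fun t => cos t * c t) t)
    by (intros; apply continuous_Rmult; [apply continuous_cos|apply Hc]).
  assert (Cs : forall t, continuous (fun t => sin t * c t) t)
    by (intros; apply continuous_Rmult; [apply continuous_sin|apply Hc]).
  replace (circle_int hx (fun t => cos t * c t) z r + circle_int hy (fun t => sin t * c t) z r)
    with (RInt (fun t => hx (circle_point z r t) * (cos t * c t) + hy (circle_point z r t) * (sin t * c t)) 0 (2 * PI)).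
  2:{ apply (RInt_plus (V := R_CompleteNormedModule));
        apply (circle_ex_RInt A); assumption. }
  apply (is_derive_RInt_param_cont (fun s t => h (circle_point z s t) * c t)
    (fun s t => hx (circle_point z s t) * (cos t * c t) + hy (circle_point z s t) * (sin t * c t))).
  - exact two_PI_pos.
  - intros t Ht.
    assert (H : locally (r, t) (fun q => A (circle_point z (fst q) (snd q)))).
    { apply (circle_point_continuous_radius z (r, t)); apply HA; apply Hz; exact Ht. }
    revert H; apply filter_imp; intros [s u] Hs; simpl in *.
    replace (hx (circle_point z s u) * (cos u * c u) + hy (circle_point z s u) * (sin u * c u)) with
      ((hx (circle_point z s u) * cos u + hy (circle_point z s u) * sin u) * c u) by ring.
    apply is_derive_weight.
    apply (grad_curve h (fun s => Re z + s * cos u) (fun s => Im z + s * sin u)).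
    + apply Hh; exact Hs.
    + apply is_derive_affine.
    + apply is_derive_affine.
  - apply (circle_param_continuous_radius A); try assumption.
    intros w Hw; eapply grad_continuous; apply Hh; exact Hw.
  - apply param_continuous_plus; apply (circle_param_continuous_radius A); assumption.
Qed.

(** The centre moves with constant velocity [(p, q)], so that the two coordinate directions are
    instances of one statement. *)
Lemma circle_int_derive_curve (A : C -> Prop) (h hx hy : C -> R) (c : R -> R) (r : R)
    (m1 m2 : R -> R) (p q s0 : R) :
  open A -> (forall w, A w -> grad_at h w (hx w) (hy w)) ->
  (forall w, A w -> continuous hx w) -> (forall w, A w -> continuous hy w) ->
  (forall t, continuous c t) ->
  (forall s, is_derive m1 s p) -> (forall s, is_derive m2 s q) -> circle_in A (m1 s0, m2 s0) r ->
  is_derive (fun s => circle_int h c (m1 s, m2 s) r) s0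
    (circle_int (fun w => hx w * p + hy w * q) c (m1 s0, m2 s0) r).
Proof.
  intros HA Hh Hhx Hhy Hc Hm1 Hm2 Hz.
  assert (Ch : forall w, A w -> continuous h w)
    by (intros w Hw; eapply grad_continuous; apply Hh; exact Hw).
  assert (Cm : forall x : R * R, continuous (fun q : R * R => circle_point (m1 (fst q), m2 (fst q)) r (snd q)) x).
  { intros x; apply (continuous_comp (fun q : R * R => ((m1 (fst q), m2 (fst q)) : C, snd q))
      (fun q : C * R => circle_point (fst q) r (snd q))); [|apply circle_point_continuous_center].
    apply continuous_pair; [apply continuous_pair|apply continuous_snd].
    - apply (continuous_comp (fun q : R * R => fst q) m1); [apply continuous_fst|].
      eapply continuous_of_derive; apply Hm1.
    - apply (continuous_comp (fun q : R * R => fst q) m2); [apply continuous_fst|].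
      eapply continuous_of_derive; apply Hm2. }
  apply (is_derive_RInt_param_cont (fun s t => h (circle_point (m1 s, m2 s) r t) * c t)
    (fun s t => (hx (circle_point (m1 s, m2 s) r t) * p + hy (circle_point (m1 s, m2 s) r t) * q) * c t)).
  - exact two_PI_pos.
  - intros t Ht.
    assert (H : locally (s0, t) (fun q : R * R => A (circle_point (m1 (fst q), m2 (fst q)) r (snd q)))).
    { apply (Cm (s0, t)); apply HA; apply Hz; exact Ht. }
    revert H; apply filter_imp; intros [s u] Hs; simpl in *.
    apply is_derive_weight.
    apply (grad_curve h (fun s => m1 s + r * cos u) (fun s => m2 s + r * sin u)).
    + apply Hh; exact Hs.
    + replace p with (p + 0) by ring; apply (is_derive_plus (K := R_AbsRing) (V := R_NormedModule));
        [apply Hm1|apply is_derive_Rconst].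
    + replace q with (q + 0) by ring; apply (is_derive_plus (K := R_AbsRing) (V := R_NormedModule));
        [apply Hm2|apply is_derive_Rconst].
  - apply param_continuous_mult; [|apply param_continuous_weight; exact Hc].
    apply (param_continuous_comp R_UniformSpace s0 0 (2 * PI) A h (fun s t => circle_point (m1 s, m2 s) r t)); assumption.
  - apply param_continuous_mult; [|apply param_continuous_weight; exact Hc].
    apply (param_continuous_comp R_UniformSpace s0 0 (2 * PI) A (fun w => hx w * p + hy w * q)
      (fun s t => circle_point (m1 s, m2 s) r t)); try assumption.
    intros w Hw; apply continuous_Rplus; apply continuous_Rmult; try apply continuous_const; auto.
Qed.

Lemma circle_int_ext (h g : C -> R) (c d : R -> R) (z : C) (r : R) :
  (forall w, h w = g w) -> (forall t, c t = d t) -> circle_int h c z r = circle_int g d z r.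
Proof.
  intros H1 H2; apply RInt_ext; intros t _; rewrite H1, H2; reflexivity.
Qed.

Lemma circle_int_grad_center (A : C -> Prop) (h hx hy : C -> R) (c : R -> R) (z : C) (r : R) :
  open A -> (forall w, A w -> grad_at h w (hx w) (hy w)) ->
  (forall w, A w -> continuous hx w) -> (forall w, A w -> continuous hy w) ->
  (forall t, continuous c t) -> circle_in A z r ->
  grad_at (fun w => circle_int h c w r) z (circle_int hx c z r) (circle_int hy c z r).
Proof.
  intros HA Hh Hhx Hhy Hc Hz.
  assert (Did : forall s, is_derive (fun s : R => s) s 1)
    by (intros s; apply is_derive_Rid).
  assert (Dcst : forall a s, is_derive (fun _ : R => a) s 0)
    by (intros a s; apply is_derive_Rconst).
  apply (grad_C1 (fun w => circle_int h c w r) (fun w => circle_int hx c w r)).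
  - generalize (circle_in_center A z r HA Hz); apply filter_imp; intros [x0 y0] Hw.
    rewrite (circle_int_ext hx (fun w => hx w * 1 + hy w * 0) c c) by (intros; ring).
    apply (circle_int_derive_curve A h hx hy c r (fun s => s) (fun _ => y0)); auto.
  - destruct z as [x0 y0].
    rewrite (circle_int_ext hy (fun w => hx w * 0 + hy w * 1) c c) by (intros; ring).
    apply (circle_int_derive_curve A h hx hy c r (fun _ => x0) (fun s => s)); auto.
  - apply (circle_int_continuous_center A); assumption.
Qed.

(** Integration by parts in the angle: the derivative of [h] along the circle is
    [r (h_y cos t - h_x sin t)], and the boundary terms cancel by the periodicity of [c]. *)
Lemma circle_int_tangential (A : C -> Prop) (h hx hy : C -> R) (c c' : R -> R) (z : C) (r : R) :
  open A -> (forall w, A w -> grad_at h w (hx w) (hy w)) ->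
  (forall w, A w -> continuous hx w) -> (forall w, A w -> continuous hy w) ->
  (forall t, is_derive c t (c' t)) -> (forall t, continuous c' t) -> c (2 * PI) = c 0 ->
  circle_in A z r ->
  circle_int h c' z r
  = r * (circle_int hx (fun t => sin t * c t) z r - circle_int hy (fun t => cos t * c t) z r).
Proof.
  intros HA Hh Hhx Hhy Hc Hc' Hper Hz.
  assert (Ch : forall w, A w -> continuous h w)
    by (intros w Hw; eapply grad_continuous; apply Hh; exact Hw).
  assert (Cc0 : forall t, continuous c t) by (intros t; eapply continuous_of_derive; apply Hc).
  assert (Cc : forall t, continuous (fun t => cos t * c t) t)
    by (intros; apply continuous_Rmult; [apply continuous_cos|apply Cc0]).
  assert (Cs : forall t, continuous (fun t => sin t * c t) t)
    by (intros; apply continuous_Rmult; [apply continuous_sin|apply Cc0]).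
  set (E := fun t => h (circle_point z r t) * c' t +
     (r * (hy (circle_point z r t) * (cos t * c t)) - r * (hx (circle_point z r t) * (sin t * c t)))).
  assert (EX := circle_ex_RInt A hx _ z r HA Hhx Cs Hz).
  assert (EY := circle_ex_RInt A hy _ z r HA Hhy Cc Hz).
  assert (EH := circle_ex_RInt A h _ z r HA Ch Hc' Hz).
  assert (Sp : forall t, 0 <= t <= 2 * PI -> forall g : C -> R, (forall w, A w -> continuous g w) ->
            continuous (fun t : R => g (circle_point z r t)) t).
  { intros t Ht g Hg; apply (continuous_comp (fun t : R => circle_point z r t) g); [|apply Hg; apply Hz; exact Ht].
    apply continuous_pair; apply continuous_Rplus; try apply continuous_const;
      apply continuous_Rmult; try apply continuous_const; [apply continuous_cos|apply continuous_sin]. }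
  assert (Z : RInt E 0 (2 * PI) = 0).
  { assert (H0 : is_RInt E 0 (2 * PI)
       (minus (h (circle_point z r (2 * PI)) * c (2 * PI)) (h (circle_point z r 0) * c 0))).
    { apply (is_RInt_derive (V := R_CompleteNormedModule) (fun t => h (circle_point z r t) * c t)).
      - intros t Ht; rewrite Rmin_left, Rmax_right in Ht by apply two_PI_pos; unfold E.
        replace (h (circle_point z r t) * c' t +
           (r * (hy (circle_point z r t) * (cos t * c t)) - r * (hx (circle_point z r t) * (sin t * c t))))
         with ((hx (circle_point z r t) * (- r * sin t) + hy (circle_point z r t) * (r * cos t)) * c t
               + h (circle_point z r t) * c' t) by ring.
        apply (is_derive_mult (K := R_AbsRing) (fun t => h (circle_point z r t)) c);
          [|apply Hc|intros; apply Rmult_comm].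
        apply (grad_curve h (fun t => Re z + r * cos t) (fun t => Im z + r * sin t)).
        + apply Hh; apply Hz; exact Ht.
        + auto_derive; trivial; ring.
        + auto_derive; trivial; ring.
      - intros t Ht; rewrite Rmin_left, Rmax_right in Ht by apply two_PI_pos; unfold E.
        apply continuous_Rplus; [|apply continuous_Rminus].
        + apply continuous_Rmult; [apply Sp; assumption|apply Hc'].
        + apply continuous_Rmult; [apply continuous_const|].
          apply continuous_Rmult; [apply Sp; assumption|apply Cc].
        + apply continuous_Rmult; [apply continuous_const|].
          apply continuous_Rmult; [apply Sp; assumption|apply Cs]. }
    rewrite (is_RInt_unique _ _ _ _ H0).
    unfold circle_point; rewrite cos_2PI, sin_2PI, cos_0, sin_0, Hper.
    unfold minus, plus, opp; simpl; ring. }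
  unfold E in Z.
  rewrite (RInt_plus (V := R_CompleteNormedModule)) in Z; [|exact EH|].
  2:{ apply (ex_RInt_minus (V := R_NormedModule));
        apply (ex_RInt_scal (V := R_NormedModule)); assumption. }
  rewrite (RInt_minus (V := R_CompleteNormedModule)
     (fun t => r * (hy (circle_point z r t) * (cos t * c t)))) in Z;
    [|apply (ex_RInt_scal (V := R_NormedModule)); assumption|
      apply (ex_RInt_scal (V := R_NormedModule)); assumption].
  replace (RInt (fun t => r * (hy (circle_point z r t) * (cos t * c t))) 0 (2 * PI)) with
    (r * circle_int hy (fun t => cos t * c t) z r) in Z
    by (symmetry; apply (RInt_scal (V := R_CompleteNormedModule)); exact EY).
  replace (RInt (fun t => r * (hx (circle_point z r t) * (sin t * c t))) 0 (2 * PI)) with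
    (r * circle_int hx (fun t => sin t * c t) z r) in Z
    by (symmetry; apply (RInt_scal (V := R_CompleteNormedModule)); exact EX).
  unfold plus, minus, plus, opp in Z; simpl in Z; unfold circle_int at 1; lra.
Qed.

(** * Regularity of holomorphic functions *)

(* [p + iq] has complex derivative [a + ib] at [z]. *)
Definition holo (p q : C -> R) (z : C) (a b : R) : Prop := grad_at p z a (- b) /\ grad_at q z b a.

Definition disc_in (A : C -> Prop) (z : C) (r : R) : Prop :=
  forall s, 0 <= s <= r -> circle_in A z s.

Lemma grad_opp (u : C -> R) (z : C) (a b : R) : grad_at u z a b -> grad_at (fun w => - u w) z (- a) (- b).
Proof.
  intros H; apply (grad_eq _ _ (-1 * a) (-1 * b)); [|ring|ring].
  apply (grad_ext_loc (fun w => -1 * u w)); [apply filter_forall; intros; ring|].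
  apply grad_scal; exact H.
Qed.

(** Identities obtained by dividing by the radius hold for [s > 0] only; continuity carries them to
    the centre. *)
Lemma limit_const_at_0 (M : R -> R) (m r : R) : 0 < r -> continuous M 0 ->
  (forall s, 0 < s <= r -> M s = m) -> M 0 = m.
Proof.
  intros Hr HM H.
  destruct (Req_dec (M 0) m) as [E|E]; [exact E|].
  assert (Hp : 0 < Rabs (m - M 0)) by (apply Rabs_pos_lt; lra).
  destruct (proj1 (continuous_eps _ M 0) HM _ Hp) as [d Hd].
  set (s := Rmin (d / 2) r).
  assert (Hs : 0 < s) by (apply Rmin_pos; [generalize (cond_pos d); lra|exact Hr]).
  assert (Hsd : s <= d / 2) by apply Rmin_l.
  assert (B : ball 0 d s).
  { change (Rabs (s - 0) < d); rewrite Rminus_0_r, Rabs_pos_eq by lra; generalize (cond_pos d); lra. }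
  generalize (Hd s B); rewrite (H s); [lra|split; [exact Hs|apply Rmin_r]].
Qed.

Lemma circle_int_plus (A : C -> Prop) (h g : C -> R) (c d : R -> R) (z : C) (r : R) :
  open A -> (forall w, A w -> continuous h w) -> (forall w, A w -> continuous g w) ->
  (forall t, continuous c t) -> (forall t, continuous d t) -> circle_in A z r ->
  circle_int h c z r + circle_int g d z r
  = RInt (fun t => h (circle_point z r t) * c t + g (circle_point z r t) * d t) 0 (2 * PI).
Proof.
  intros HA Hh Hg Hc Hd Hz; symmetry.
  apply (RInt_plus (V := R_CompleteNormedModule)); apply (circle_ex_RInt A); assumption.
Qed.

Lemma circle_int_opp_weight (h : C -> R) (c : R -> R) (A : C -> Prop) (z : C) (r : R) :
  open A -> (forall w, A w -> continuous h w) -> (forall t, continuous c t) -> circle_in A z r ->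
  circle_int h (fun t => - c t) z r = - circle_int h c z r.
Proof.
  intros HA Hh Hc Hz; unfold circle_int.
  rewrite <- (RInt_opp (V := R_CompleteNormedModule)) by (apply (circle_ex_RInt A); assumption).
  apply RInt_ext; intros t _; unfold opp; simpl; ring.
Qed.

Lemma circle_int_opp (h : C -> R) (c : R -> R) (A : C -> Prop) (z : C) (r : R) :
  open A -> (forall w, A w -> continuous h w) -> (forall t, continuous c t) -> circle_in A z r ->
  circle_int (fun w => - h w) c z r = - circle_int h c z r.
Proof.
  intros HA Hh Hc Hz; rewrite <- (circle_int_opp_weight h c A) by assumption.
  unfold circle_int; apply (RInt_ext (V := R_CompleteNormedModule)); intros t _; simpl; ring.
Qed.

Lemma circle_int_center (h : C -> R) (z : C) : circle_int h (fun _ => 1) z 0 = 2 * PI * h z.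
Proof.
  unfold circle_int.
  rewrite (RInt_ext _ (fun _ => h z)).
  - rewrite (RInt_const (V := R_CompleteNormedModule)); unfold scal; simpl; unfold mult; simpl; ring.
  - intros t _; unfold circle_point; rewrite Rmult_1_r; f_equal; destruct z; unfold Re, Im; simpl; f_equal; ring.
Qed.

Section Holomorphic.

Variables (A : C -> Prop) (K L p q : C -> R) (z : C) (r : R).
Hypothesis HA : open A.
Hypothesis HK : forall w, A w -> holo K L w (p w) (q w).
Hypothesis Hp : forall w, A w -> continuous p w.
Hypothesis Hq : forall w, A w -> continuous q w.
Hypothesis Hr : 0 < r.
Hypothesis Hz : disc_in A z r.

(** [K cos t + L sin t] is the real part of [(K + iL) e^(-it)]. By parts in the angle and the
    Cauchy-Riemann equations, [cos^2 + sin^2] appears as the weight of [p], while the terms in [q]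
    cancel. *)
Lemma holo_circle_tangential (s : R) : 0 <= s <= r ->
  circle_int K cos z s + circle_int L sin z s = s * circle_int p (fun _ => 1) z s.
Proof.
  intros Hs.
  assert (Hnq : forall w, A w -> continuous (fun w => - q w) w)
    by (intros; apply continuous_Ropp; auto).
  assert (Cs : forall t, continuous sin t) by apply continuous_sin.
  assert (Cc : forall t, continuous cos t) by apply continuous_cos.
  assert (Cnc : forall t, continuous (fun t => - cos t) t) by (intros; apply continuous_Ropp; auto).
  assert (Cnn : forall t, continuous (fun t => - (cos t * - cos t)) t)
    by (intros; apply continuous_Ropp; apply continuous_Rmult; auto).
  assert (Css : forall t, continuous (fun t => sin t * sin t) t) by (intros; apply continuous_Rmult; auto).
  assert (Ccs : forall t, continuous (fun t => cos t * sin t) t) by (intros; apply continuous_Rmult; auto).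
  assert (Ccc : forall t, continuous (fun t => cos t * - cos t) t) by (intros; apply continuous_Rmult; auto).
  rewrite (circle_int_tangential A K p (fun w => - q w) sin cos z s HA); auto.
  2:{ intros w Hw; exact (proj1 (HK w Hw)). }
  2:{ intros t; auto_derive; trivial; ring. }
  2:{ rewrite sin_2PI, sin_0; reflexivity. }
  rewrite (circle_int_tangential A L q p (fun t => - cos t) sin z s HA); auto.
  2:{ intros w Hw; exact (proj2 (HK w Hw)). }
  2:{ intros t; auto_derive; trivial; ring. }
  2:{ rewrite cos_2PI, cos_0; reflexivity. }
  rewrite <- Rmult_plus_distr_l; f_equal.
  rewrite (circle_int_opp q _ A) by auto.
  assert (E1 : circle_int q (fun t => sin t * - cos t) z s = - circle_int q (fun t => cos t * sin t) z s).
  { rewrite <- (circle_int_opp_weight q _ A) by auto; apply circle_int_ext; intros; ring. }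
  rewrite E1.
  replace (circle_int p (fun _ => 1) z s) with
    (circle_int p (fun t => sin t * sin t) z s - circle_int p (fun t => cos t * - cos t) z s); [ring|].
  unfold Rminus; rewrite <- (circle_int_opp_weight p _ A) by auto.
  rewrite (circle_int_plus A) by auto.
  unfold circle_int; apply RInt_ext; intros t _; simpl.
  generalize (sin2_cos2 t); unfold Rsqr; intros H; rewrite Rmult_1_r.
  replace (p (circle_point z s t)) with (p (circle_point z s t) * (sin t * sin t + cos t * cos t)) at 3
    by (rewrite H; ring).
  ring.
Qed.

(** The same cancellation for the radial derivative. Together with the preceding identity, the left
    side [J] satisfies [J = s J']. *)
Lemma holo_circle_derive (s : R) : 0 <= s <= r ->
  is_derive (fun s => circle_int K cos z s + circle_int L sin z s) s (circle_int p (fun _ => 1) z s).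
Proof.
  intros Hs.
  assert (Hnq : forall w, A w -> continuous (fun w => - q w) w)
    by (intros; apply continuous_Ropp; auto).
  assert (Cs : forall t, continuous sin t) by apply continuous_sin.
  assert (Cc : forall t, continuous cos t) by apply continuous_cos.
  assert (Css : forall t, continuous (fun t => sin t * sin t) t) by (intros; apply continuous_Rmult; auto).
  assert (Csc : forall t, continuous (fun t => sin t * cos t) t) by (intros; apply continuous_Rmult; auto).
  assert (Ccc : forall t, continuous (fun t => cos t * cos t) t) by (intros; apply continuous_Rmult; auto).
  replace (circle_int p (fun _ => 1) z s) with
    ((circle_int p (fun t => cos t * cos t) z s + circle_int (fun w => - q w) (fun t => sin t * cos t) z s)
    + (circle_int q (fun t => cos t * sin t) z s + circle_int p (fun t => sin t * sin t) z s)).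
  - apply (is_derive_plus (K := R_AbsRing) (V := R_NormedModule)
      (fun s => circle_int K cos z s) (fun s => circle_int L sin z s)).
    + apply (circle_int_derive_radius A); auto; intros w Hw; exact (proj1 (HK w Hw)).
    + apply (circle_int_derive_radius A); auto; intros w Hw; exact (proj2 (HK w Hw)).
  - rewrite (circle_int_opp q _ A) by auto.
    rewrite (circle_int_ext q q (fun t => sin t * cos t) (fun t => cos t * sin t)) by (intros; ring).
    transitivity (circle_int p (fun t => cos t * cos t) z s + circle_int p (fun t => sin t * sin t) z s);
      [ring|].
    rewrite (circle_int_plus A) by auto.
    unfold circle_int; apply RInt_ext; intros t _; simpl.
    generalize (sin2_cos2 t); unfold Rsqr; intros H; rewrite Rmult_1_r.
    replace (p (circle_point z s t)) with (p (circle_point z s t) * (sin t * sin t + cos t * cos t)) at 3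
      by (rewrite H; ring).
    ring.
Qed.

(** From [J = s M] and [J' = M] the quotient [J / s] has derivative zero, hence [M] is constant; at
    radius 0 it equals [2 pi p(z)]. *)
Lemma holo_circle_formula :
  p z = / (2 * PI * r) * (circle_int K cos z r + circle_int L sin z r).
Proof.
  set (J := fun s => circle_int K cos z s + circle_int L sin z s).
  set (M := fun s => circle_int p (fun _ => 1) z s).
  assert (HM : M 0 = M r).
  { apply (limit_const_at_0 M (M r) r Hr).
    - apply (circle_int_continuous_radius A); auto; [intros; apply continuous_const|].
      apply Hz; lra.
    - intros s Hs; destruct (Req_dec s r) as [->|Hne]; [reflexivity|].
      assert (E : forall x, 0 < x <= r -> M x = J x / x).
      { intros x Hx; unfold J, M; rewrite holo_circle_tangential by lra; field; lra. }
      rewrite (E s), (E r) by lra.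
      apply (eq_is_derive (V := R_NormedModule) (fun x => J x / x)); [|lra].
      intros x Hx.
      replace (zero : R_NormedModule) with (M x * / x + J x * (- 1 / x ^ 2)).
      + apply (is_derive_mult (K := R_AbsRing) J (fun x => / x));
          [apply holo_circle_derive; lra| |intros; apply Rmult_comm].
        auto_derive; [lra|]; field; lra.
      + rewrite (E x) by lra; unfold zero; simpl; field; lra. }
  unfold M in HM; rewrite circle_int_center in HM.
  rewrite holo_circle_tangential by lra; fold (M r); unfold M; rewrite <- HM.
  field; generalize PI_RGT_0; lra.
Qed.

End Holomorphic.

(* Real and imaginary part of [1/(2 pi r) int (h + ig)(w + r e^(it)) e^(-it) dt],
   Cauchy's formula for the derivative of [h + ig] at [w]. *)
Definition cauchy_re (r : R) (h g : C -> R) (w : C) : R :=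
  / (2 * PI * r) * (circle_int h cos w r + circle_int g sin w r).
Definition cauchy_im (r : R) (h g : C -> R) (w : C) : R :=
  / (2 * PI * r) * (circle_int g cos w r + - circle_int h sin w r).

Lemma holo_cauchy_formula (A : C -> Prop) (K L p q : C -> R) (z : C) (r : R) :
  open A -> (forall w, A w -> holo K L w (p w) (q w)) ->
  (forall w, A w -> continuous p w) -> (forall w, A w -> continuous q w) ->
  0 < r -> disc_in A z r -> p z = cauchy_re r K L z /\ q z = cauchy_im r K L z.
Proof.
  intros HA HK Hp Hq Hr Hz; split.
  - apply (holo_circle_formula A K L p q); assumption.
  - assert (Cs : forall t, continuous sin t) by apply continuous_sin.
    unfold cauchy_im; rewrite <- (circle_int_opp K sin A); try assumption.
    (* The imaginary part for [K + iL] is the real part for [- i (K + iL) = L - iK], whose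
       derivative is [q - ip]. *)
    + apply (holo_circle_formula A L (fun w => - K w) q (fun w => - p w)); try assumption.
      * intros w Hw; destruct (HK w Hw) as [H1 H2]; split.
        -- rewrite Ropp_involutive; exact H2.
        -- apply (grad_eq _ _ (- p w) (- - q w)); [apply grad_opp; exact H1|reflexivity|ring].
      * intros w Hw; apply continuous_Ropp; auto.
    + intros w Hw; eapply grad_continuous; exact (proj1 (HK w Hw)).
    + apply Hz; lra.
Qed.

(** The circle average commutes with the complex derivative, by differentiation with respect to the
    centre under the integral sign. *)
Lemma holo_cauchy (A : C -> Prop) (K L p q : C -> R) (z : C) (r : R) :
  open A -> (forall w, A w -> holo K L w (p w) (q w)) ->
  (forall w, A w -> continuous p w) -> (forall w, A w -> continuous q w) ->
  circle_in A z r -> holo (cauchy_re r K L) (cauchy_im r K L) z (cauchy_re r p q z) (cauchy_im r p q z).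
Proof.
  intros HA HK Hp Hq Hz.
  assert (Cs : forall t, continuous sin t) by apply continuous_sin.
  assert (Cc : forall t, continuous cos t) by apply continuous_cos.
  assert (Hnq : forall w, A w -> continuous (fun w => - q w) w)
    by (intros; apply continuous_Ropp; auto).
  assert (PK : forall c, (forall t, continuous c t) ->
    grad_at (fun w => circle_int K c w r) z (circle_int p c z r) (- circle_int q c z r)).
  { intros c Hc; rewrite <- (circle_int_opp q c A) by assumption.
    apply (circle_int_grad_center A K p (fun w => - q w)); try assumption.
    intros w Hw; exact (proj1 (HK w Hw)). }
  assert (PL : forall c, (forall t, continuous c t) ->
    grad_at (fun w => circle_int L c w r) z (circle_int q c z r) (circle_int p c z r)).
  { intros c Hc; apply (circle_int_grad_center A L q p); try assumption.
    intros w Hw; exact (proj2 (HK w Hw)). }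
  split.
  - eapply grad_eq.
    + apply (grad_scal (/ (2 * PI * r)) (fun w => circle_int K cos w r + circle_int L sin w r)).
      apply grad_plus; [apply PK; exact Cc|apply PL; exact Cs].
    + reflexivity.
    + unfold cauchy_im; ring.
  - eapply grad_eq.
    + apply (grad_scal (/ (2 * PI * r)) (fun w => circle_int L cos w r + - circle_int K sin w r)).
      apply grad_plus; [apply PL; exact Cc|apply grad_opp; apply PK; exact Cs].
    + unfold cauchy_im; ring.
    + unfold cauchy_re; ring.
Qed.

Lemma cauchy_continuous (A : C -> Prop) (h g : C -> R) (z : C) (r : R) :
  open A -> (forall w, A w -> continuous h w) -> (forall w, A w -> continuous g w) ->
  circle_in A z r -> continuous (cauchy_re r h g) z /\ continuous (cauchy_im r h g) z.
Proof.
  intros HA Hh Hg Hz.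
  assert (Cs : forall t, continuous sin t) by apply continuous_sin.
  assert (Cc : forall t, continuous cos t) by apply continuous_cos.
  split; (apply continuous_Rmult; [apply continuous_const|apply continuous_Rplus]).
  - apply (circle_int_continuous_center A); assumption.
  - apply (circle_int_continuous_center A); assumption.
  - apply (circle_int_continuous_center A); assumption.
  - apply continuous_Ropp, (circle_int_continuous_center A); assumption.
Qed.

Lemma box_open (z : C) (r : R) : open (box z r).
Proof. intros w; apply box_locally. Qed.

Lemma disc_in_box (z w : C) (d r : R) : 0 < r -> box z d w -> disc_in (box z (d + 2 * r)) w r.
Proof.
  intros Hr [H1 H2] s Hs t _.
  assert (Hc : Rabs (s * cos t) <= r).
  { rewrite Rabs_mult, (Rabs_pos_eq s) by lra.
    assert (Rabs (cos t) <= 1) by (apply Rabs_le; generalize (COS_bound t); lra).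
    generalize (Rabs_pos (cos t)); nra. }
  assert (Hsn : Rabs (s * sin t) <= r).
  { rewrite Rabs_mult, (Rabs_pos_eq s) by lra.
    assert (Rabs (sin t) <= 1) by (apply Rabs_le; generalize (SIN_bound t); lra).
    generalize (Rabs_pos (sin t)); nra. }
  split; unfold circle_point, Re, Im in *; simpl.
  - replace (fst w + s * cos t - fst z) with ((fst w - fst z) + s * cos t) by ring.
    apply Rle_lt_trans with (1 := Rabs_triang _ _); lra.
  - replace (snd w + s * sin t - snd z) with ((snd w - snd z) + s * sin t) by ring.
    apply Rle_lt_trans with (1 := Rabs_triang _ _); lra.
Qed.

Lemma grad_unique (u : C -> R) (z : C) (a b : R) : grad_at u z a b -> partial_x u z = a /\ partial_y u z = b.
Proof.
  intros H; split; apply is_derive_unique; [eapply grad_x|eapply grad_y]; exact H.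
Qed.

Definition holo_C2_at (p q : C -> R) (z : C) : Prop :=
  holo p q z (partial_x p z) (partial_x q z) /\
  holo (partial_x p) (partial_x q) z (partial_x (partial_x p) z) (partial_x (partial_x q) z) /\
  continuous (partial_x (partial_x p)) z /\ continuous (partial_x (partial_x q)) z.

(* Goursat makes [p + iq] the derivative of some [K + iL]; Cauchy's formula then
   gives [p + iq] as a circle average of [K + iL], which can be differentiated in
   its centre, twice. *)
Lemma holo_C2 (p q : C -> R) (z : C) :
  locally z (fun w => exists a b, holo p q w a b) -> holo_C2_at p q z.
Proof.
  intros H; apply locally_box in H; destruct H as [d [Hd H]].
  (* Each use of an average over circles of radius [r] loses a margin [2 r]: the form is closed on
     the box of radius [8 r = d], the first derivative is obtained on [6 r] and the second on
     [4 r]. *)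
  set (r := d / 8).
  assert (Hr : 0 < r) by (unfold r; lra).
  assert (H8 : forall w, box z (2 * r + 2 * r + 2 * r + 2 * r) w -> exists a b, holo p q w a b).
  { intros w [H1 H2]; apply H; unfold r in *; lra. }
  set (A8 := box z (2 * r + 2 * r + 2 * r + 2 * r)) in *.
  destruct (closed_form_primitive p (fun w => - q w) z (2 * r + 2 * r + 2 * r + 2 * r)) as [K HK].
  { intros w Hw; destruct (H8 w Hw) as (a & b & H1 & H2).
    exists a, (- b), (- a); split; [exact H1|apply grad_opp; exact H2]. }
  destruct (closed_form_primitive q p z (2 * r + 2 * r + 2 * r + 2 * r)) as [L HL].
  { intros w Hw; destruct (H8 w Hw) as (a & b & H1 & H2).
    exists b, a, (- b); split; [exact H2|exact H1]. }
  assert (HKL : forall w, A8 w -> holo K L w (p w) (q w)) by (intros w Hw; split; auto).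
  assert (Cp : forall w, A8 w -> continuous p w).
  { intros w Hw; destruct (H8 w Hw) as (a & b & H1 & H2); eapply grad_continuous; exact H1. }
  assert (Cq : forall w, A8 w -> continuous q w).
  { intros w Hw; destruct (H8 w Hw) as (a & b & H1 & H2); eapply grad_continuous; exact H2. }
  set (A6 := box z (2 * r + 2 * r + 2 * r)); set (A4 := box z (2 * r + 2 * r)).
  assert (HA8 : open A8) by apply box_open; assert (HA6 : open A6) by apply box_open.
  assert (HA4 : open A4) by apply box_open.
  assert (D8 : forall w, A6 w -> disc_in A8 w r) by (intros; apply disc_in_box; assumption).
  assert (D6 : forall w, A4 w -> disc_in A6 w r) by (intros; apply disc_in_box; assumption).
  assert (S64 : forall w, A4 w -> A6 w) by (intros w [I1 I2]; split; lra).
  assert (Hrr : 0 <= r <= r) by lra.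
  set (al := cauchy_re r p q); set (be := cauchy_im r p q).
  assert (E6 : forall w, A6 w -> p w = cauchy_re r K L w /\ q w = cauchy_im r K L w).
  { intros w Hw; apply (holo_cauchy_formula A8); auto. }
  assert (P6 : forall w, A6 w -> holo p q w (al w) (be w)).
  { intros w Hw; destruct (holo_cauchy A8 K L p q w r HA8 HKL Cp Cq (D8 w Hw r Hrr)) as [H1 H2].
    split.
    - apply (grad_ext_loc (cauchy_re r K L)); [|exact H1].
      generalize (HA6 w Hw); apply filter_imp; intros v Hv; symmetry; apply E6; exact Hv.
    - apply (grad_ext_loc (cauchy_im r K L)); [|exact H2].
      generalize (HA6 w Hw); apply filter_imp; intros v Hv; symmetry; apply E6; exact Hv. }
  assert (C6 : forall w, A6 w -> continuous al w /\ continuous be w).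
  { intros w Hw; apply (cauchy_continuous A8); auto; apply D8; auto. }
  set (mu := cauchy_re r al be); set (nu := cauchy_im r al be).
  assert (Ca6 : forall w, A6 w -> continuous al w) by (intros w Hw; exact (proj1 (C6 w Hw))).
  assert (Cb6 : forall w, A6 w -> continuous be w) by (intros w Hw; exact (proj2 (C6 w Hw))).
  assert (P4 : forall w, A4 w -> holo al be w (mu w) (nu w)).
  { intros w Hw; apply (holo_cauchy A6); auto; apply D6; auto. }
  assert (C4 : forall w, A4 w -> continuous mu w /\ continuous nu w).
  { intros w Hw; apply (cauchy_continuous A6); auto; apply D6; auto. }
  assert (U6 : forall w, A6 w -> partial_x p w = al w /\ partial_x q w = be w).
  { intros w Hw; destruct (P6 w Hw) as [H1 H2].
    split; [apply (grad_unique _ _ _ _ H1)|apply (grad_unique _ _ _ _ H2)]. }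
  assert (P4' : forall w, A4 w -> holo (partial_x p) (partial_x q) w (mu w) (nu w)).
  { intros w Hw; destruct (P4 w Hw) as [H1 H2]; split.
    - apply (grad_ext_loc al); [|exact H1].
      generalize (HA6 w (S64 w Hw)); apply filter_imp; intros v Hv; symmetry; exact (proj1 (U6 v Hv)).
    - apply (grad_ext_loc be); [|exact H2].
      generalize (HA6 w (S64 w Hw)); apply filter_imp; intros v Hv; symmetry; exact (proj2 (U6 v Hv)). }
  assert (U4 : forall w, A4 w -> partial_x (partial_x p) w = mu w /\ partial_x (partial_x q) w = nu w).
  { intros w Hw; destruct (P4' w Hw) as [H1 H2].
    split; [apply (grad_unique _ _ _ _ H1)|apply (grad_unique _ _ _ _ H2)]. }
  assert (Hz0 : A4 z).
  { unfold A4, box; rewrite !Rminus_diag, Rabs_R0; lra. }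
  destruct (U6 z (S64 z Hz0)) as [U1 U2]; destruct (U4 z Hz0) as [U3 U5].
  unfold holo_C2_at; rewrite U3, U5; split; [rewrite U1, U2; apply P6; auto|].
  split; [apply P4'; exact Hz0|].
  split.
  - apply (continuous_ext_loc _ mu); [|exact (proj1 (C4 z Hz0))].
    generalize (HA4 z Hz0); apply filter_imp; intros v Hv; symmetry; exact (proj1 (U4 v Hv)).
  - apply (continuous_ext_loc _ nu); [|exact (proj2 (C4 z Hz0))].
    generalize (HA4 z Hz0); apply filter_imp; intros v Hv; symmetry; exact (proj2 (U4 v Hv)).
Qed.

(** * The gradient of a harmonic function *)

(** The derivatives are existential data, and the single function [uxy] for both mixed derivatives
    builds their equality into the notion. *)
Definition harmonic_on (Om : C -> Prop) (u : C -> R) : Prop :=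
  exists ux uy uxx uxy uyy : C -> R, forall w, Om w ->
    grad_at u w (ux w) (uy w) /\ grad_at ux w (uxx w) (uxy w) /\ grad_at uy w (uxy w) (uyy w) /\
    continuous uxx w /\ continuous uxy w /\ continuous uyy w /\ uxx w + uyy w = 0.

Lemma unit_disk_sqr (z : C) : unit_disk z <-> Re z ^ 2 + Im z ^ 2 < 1.
Proof.
  unfold unit_disk; rewrite <- Cmod2_alt; generalize (Cmod_ge_0 z); intros H; split; nra.
Qed.

Lemma unit_disk_open : open unit_disk.
Proof.
  intros z Hz; apply unit_disk_sqr in Hz.
  assert (H : continuous (fun w : C => Re w ^ 2 + Im w ^ 2) z).
  { apply continuous_Rplus; apply (continuous_comp _ (fun x => x ^ 2));
      [apply continuous_Re_all| |apply continuous_Im_all|];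
      (eapply continuous_of_derive; auto_derive; trivial; reflexivity). }
  assert (L : locally z (fun w => Re w ^ 2 + Im w ^ 2 < 1)).
  { apply (H (fun x => x < 1)); apply (open_lt 1); exact Hz. }
  revert L; apply filter_imp; intros w Hw; apply unit_disk_sqr; exact Hw.
Qed.

(** The origin of the 4 in the constant [4 / pi]. *)
Lemma is_RInt_abs_cos : is_RInt (fun t => Rabs (cos t)) 0 (2 * PI) 4.
Proof.
  assert (HPI := PI_RGT_0).
  assert (H : forall a b, is_RInt cos a b (sin b - sin a)).
  { intros a b; apply (is_RInt_derive (V := R_CompleteNormedModule) sin cos).
    - intros; apply is_derive_sin.
    - intros; apply continuous_cos. }
  replace 4 with (plus (plus (sin (PI / 2) - sin 0) (opp (sin (3 * (PI / 2)) - sin (PI / 2))))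
                    (sin (2 * PI) - sin (3 * (PI / 2)))).
  2:{ unfold plus, opp; simpl; rewrite sin_PI2, sin_0, sin_2PI, sin_3PI2; ring. }
  apply (is_RInt_Chasles (V := R_NormedModule)) with (3 * (PI / 2));
    [apply (is_RInt_Chasles (V := R_NormedModule)) with (PI / 2)|].
  - apply (is_RInt_ext (V := R_NormedModule) cos); [|apply H].
    intros t Ht; rewrite Rmin_left, Rmax_right in Ht by lra.
    symmetry; apply Rabs_pos_eq; apply cos_ge_0; lra.
  - apply (is_RInt_ext (V := R_NormedModule) (fun t => opp (cos t)));
      [|apply (is_RInt_opp (V := R_NormedModule)); apply H].
    intros t Ht; rewrite Rmin_left, Rmax_right in Ht by lra.
    unfold opp; simpl; symmetry; apply Rabs_left1; apply cos_le_0; lra.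
  - apply (is_RInt_ext (V := R_NormedModule) cos); [|apply H].
    intros t Ht; rewrite Rmin_left, Rmax_right in Ht by lra.
    symmetry; apply Rabs_pos_eq.
    replace (cos t) with (cos (t - 2 * PI)); [apply cos_ge_0; lra|].
    rewrite <- (cos_period (t - 2 * PI) 1); f_equal; simpl; ring.
Qed.

(** The integral of [cos] over a period vanishes, so [v] may be replaced by [v - c0]: only the
    oscillation of [v] counts, not its size. *)
Lemma circle_int_cos_bound (A : C -> Prop) (v : C -> R) (c0 M r : R) (z : C) :
  open A -> (forall w, A w -> continuous v w) -> (forall w, A w -> Rabs (v w - c0) <= M) ->
  circle_in A z r -> Rabs (circle_int v cos z r) <= 4 * M.
Proof.
  intros HA Hv HM Hz.
  assert (Cc : forall t, continuous cos t) by apply continuous_cos.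
  assert (Ic : is_RInt (fun t => c0 * cos t) 0 (2 * PI) 0).
  { replace 0 with (c0 * (sin (2 * PI) - sin 0)) at 2 by (rewrite sin_2PI, sin_0; ring).
    apply (is_RInt_scal (V := R_NormedModule)).
    apply (is_RInt_derive (V := R_CompleteNormedModule) sin cos).
    - intros; apply is_derive_sin.
    - intros; apply continuous_cos. }
  assert (Hex := circle_ex_RInt A v cos z r HA Hv Cc Hz).
  assert (Iv : is_RInt (fun t => (v (circle_point z r t) - c0) * cos t) 0 (2 * PI) (circle_int v cos z r)).
  { replace (circle_int v cos z r) with (minus (circle_int v cos z r) 0)
      by (unfold minus, plus, opp; simpl; ring).
    apply (is_RInt_ext (V := R_NormedModule)
      (fun t => minus (v (circle_point z r t) * cos t) (c0 * cos t))).
    - intros t _; unfold minus, plus, opp; simpl; ring.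
    - apply (is_RInt_minus (V := R_NormedModule)); [|exact Ic].
      apply (RInt_correct (V := R_CompleteNormedModule)); exact Hex. }
  replace (4 * M) with (M * 4) by ring.
  apply (norm_RInt_le (V := R_NormedModule) (fun t => (v (circle_point z r t) - c0) * cos t)
    (fun t => M * Rabs (cos t)) 0 (2 * PI)); [exact two_PI_pos| |exact Iv|].
  - intros t Ht; change (Rabs ((v (circle_point z r t) - c0) * cos t) <= M * Rabs (cos t)).
    rewrite Rabs_mult; apply Rmult_le_compat_r; [apply Rabs_pos|apply HM; apply Hz; exact Ht].
  - apply (is_RInt_scal (V := R_NormedModule)); exact is_RInt_abs_cos.
Qed.

Section HarmonicCircle.

Variables (A : C -> Prop) (v a b a1 a2 : C -> R) (z : C) (r : R).
Hypothesis HA : open A.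
Hypothesis Hv : forall w, A w -> grad_at v w (a w) (b w).
Hypothesis Ha : forall w, A w -> grad_at a w (a1 w) (a2 w).
Hypothesis Hb : forall w, A w -> grad_at b w (a2 w) (- a1 w).
Hypothesis Ha1 : forall w, A w -> continuous a1 w.
Hypothesis Ha2 : forall w, A w -> continuous a2 w.
Hypothesis Hr : 0 < r.
Hypothesis Hz : disc_in A z r.

(** The radial derivative of the mean of [a] is the integral of [a1 cos t + a2 sin t]. Up to the
    factor [s] this is the integral of the tangential derivative of the conjugate function [b] over
    a closed circle, hence zero. *)
Lemma harmonic_mean_value (s : R) : 0 < s <= r -> circle_int a (fun _ => 1) z s = 2 * PI * a z.
Proof.
  assert (Cs : forall t, continuous sin t) by apply continuous_sin.
  assert (Cc : forall t, continuous cos t) by apply continuous_cos.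
  assert (C1 : forall t : R, continuous (fun _ : R => 1) t) by (intros; apply continuous_const).
  assert (C0 : forall t : R, continuous (fun _ : R => 0) t) by (intros; apply continuous_const).
  assert (Cna1 : forall w, A w -> continuous (fun w => - a1 w) w) by (intros; apply continuous_Ropp; auto).
  assert (Cc1 : forall t, continuous (fun t => cos t * 1) t) by (intros; apply continuous_Rmult; auto).
  set (M := fun s => circle_int a (fun _ => 1) z s).
  assert (D : forall s, 0 < s <= r -> is_derive M s 0).
  { clear s; intros s Hs.
    assert (Hcs : circle_in A z s) by (apply Hz; lra).
    replace 0 with (circle_int a1 (fun t => cos t * 1) z s + circle_int a2 (fun t => sin t * 1) z s).
    - apply (circle_int_derive_radius A); auto.
    - assert (T := circle_int_tangential A b a2 (fun w => - a1 w) (fun _ => 1) (fun _ => 0) z s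
        HA Hb Ha2 Cna1 (is_derive_Rconst 1)
        C0 eq_refl Hcs).
      rewrite (circle_int_opp a1 _ A) in T by auto.
      replace (circle_int b (fun _ => 0) z s) with 0 in T.
      + apply (Rmult_eq_reg_l s); [|lra]; lra.
      + unfold circle_int; rewrite (RInt_ext _ (fun _ => 0)) by (intros; simpl; ring).
        rewrite (RInt_const (V := R_CompleteNormedModule)); unfold scal; simpl; unfold mult; simpl; ring. }
  intros Hs; rewrite <- circle_int_center; symmetry.
  apply (limit_const_at_0 M (M s) s); [lra| |].
  - apply (circle_int_continuous_radius A); auto; [|apply Hz; lra].
    intros w Hw; eapply grad_continuous; apply Ha; exact Hw.
  - intros x Hx; destruct (Req_dec x s) as [->|Hne]; [reflexivity|].
    apply (eq_is_derive (V := R_NormedModule) M); [|lra].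
    intros t Ht; apply D; lra.
Qed.

(* Integration by parts turns the derivative of [s int v(z + s e^(it)) cos t dt] into
   [s int a(z + s e^(it)) dt], which the mean value property evaluates. *)
Lemma harmonic_gradient_circle : circle_int v cos z r = PI * r * a z.
Proof.
  assert (Cs : forall t, continuous sin t) by apply continuous_sin.
  assert (Cc : forall t, continuous cos t) by apply continuous_cos.
  assert (Css : forall t, continuous (fun t => sin t * sin t) t) by (intros; apply continuous_Rmult; auto).
  assert (Ccc : forall t, continuous (fun t => cos t * cos t) t) by (intros; apply continuous_Rmult; auto).
  assert (Cav : forall w, A w -> continuous a w) by (intros w Hw; eapply grad_continuous; apply Ha; exact Hw).
  assert (Cbv : forall w, A w -> continuous b w) by (intros w Hw; eapply grad_continuous; apply Hb; exact Hw).
  (* The subtracted term is the primitive of [2 pi a(z) s], the expected derivative of the first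
     term, so [B] is constant with [B 0 = 0]. *)
  set (B := fun s => s * circle_int v cos z s - PI * a z * s ^ 2).
  assert (D : forall s, 0 <= s <= r -> is_derive B s 0).
  { intros s Hs.
    assert (D1 : is_derive (fun s => circle_int v cos z s) s
      (circle_int a (fun t => cos t * cos t) z s + circle_int b (fun t => sin t * cos t) z s)).
    { apply (circle_int_derive_radius A); auto. }
    assert (T : circle_int v cos z s = s * (circle_int a (fun t => sin t * sin t) z s
                 - circle_int b (fun t => cos t * sin t) z s)).
    { apply (circle_int_tangential A v a b sin cos); auto.
      - intros t; auto_derive; trivial; ring.
      - rewrite sin_2PI, sin_0; reflexivity. }
    rewrite (circle_int_ext b b (fun t => cos t * sin t) (fun t => sin t * cos t)) in T by (intros; ring).
    assert (S : s * circle_int a (fun _ => 1) z s = s * (2 * PI * a z)).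
    { destruct (Req_dec s 0) as [->|Hne]; [ring|].
      rewrite harmonic_mean_value by lra; reflexivity. }
    assert (E : circle_int a (fun _ => 1) z s = circle_int a (fun t => sin t * sin t) z s
                 + circle_int a (fun t => cos t * cos t) z s).
    { rewrite (circle_int_plus A) by auto; unfold circle_int; apply RInt_ext; intros t _; simpl.
      generalize (sin2_cos2 t); unfold Rsqr; intros H.
      rewrite <- Rmult_plus_distr_l, H; reflexivity. }
    replace 0 with (1 * circle_int v cos z s + s * (circle_int a (fun t => cos t * cos t) z s
       + circle_int b (fun t => sin t * cos t) z s) - PI * a z * (2 * s)).
    - apply (is_derive_minus (K := R_AbsRing) (V := R_NormedModule)
        (fun s => s * circle_int v cos z s) (fun s => PI * a z * s ^ 2)).
      + apply (is_derive_mult (K := R_AbsRing) (fun s => s)); [|exact D1|intros; apply Rmult_comm].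
        apply is_derive_Rid.
      + auto_derive; trivial; ring.
    - rewrite T; rewrite E in S; lra. }
  assert (E : B 0 = B r) by (apply (eq_is_derive (V := R_NormedModule) B); [exact D|exact Hr]).
  unfold B in E.
  apply (Rmult_eq_reg_l r); [|lra]; lra.
Qed.

End HarmonicCircle.

Definition origin : C := (0, 0).

Lemma disc_in_unit_disk (r : R) : r < 1 -> disc_in unit_disk origin r.
Proof.
  intros Hr s Hs t _; apply unit_disk_sqr; unfold circle_point, origin, Re, Im; simpl.
  generalize (sin2_cos2 t); unfold Rsqr; nra.
Qed.

Lemma harmonic_gradient_bound (v a b a1 a2 : C -> R) (c0 M : R) :
  (forall w, unit_disk w -> grad_at v w (a w) (b w)) ->
  (forall w, unit_disk w -> grad_at a w (a1 w) (a2 w)) ->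
  (forall w, unit_disk w -> grad_at b w (a2 w) (- a1 w)) ->
  (forall w, unit_disk w -> continuous a1 w) -> (forall w, unit_disk w -> continuous a2 w) ->
  (forall w, unit_disk w -> Rabs (v w - c0) <= M) -> Rabs (a origin) <= 4 * M / PI.
Proof.
  intros Hv Ha Hb Ha1 Ha2 HM.
  assert (HPI := PI_RGT_0).
  assert (K : forall r, 0 < r < 1 -> r * (PI * Rabs (a origin)) <= 4 * M).
  { intros r Hr.
    assert (E := harmonic_gradient_circle unit_disk v a b a1 a2 origin r unit_disk_open
      Hv Ha Hb Ha1 Ha2 (proj1 Hr) (disc_in_unit_disk r (proj2 Hr))).
    replace (r * (PI * Rabs (a origin))) with (Rabs (circle_int v cos origin r)).
    - apply (circle_int_cos_bound unit_disk v c0).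
      + exact unit_disk_open.
      + intros w Hw; eapply grad_continuous; apply Hv; exact Hw.
      + exact HM.
      + apply (disc_in_unit_disk r); lra.
    - rewrite E, !Rabs_mult, (Rabs_pos_eq PI), (Rabs_pos_eq r) by lra; ring. }
  apply Rle_div_r; [exact HPI|]; rewrite Rmult_comm.
  apply Rnot_lt_le; intros Hlt.
  set (X := PI * Rabs (a origin)) in *.
  assert (HM0 : 0 <= M).
  { apply Rle_trans with (2 := HM origin ltac:(apply unit_disk_sqr; unfold origin; simpl; lra)).
    apply Rabs_pos. }
  (* If [4 M < X], the midpoint of [4 M / X] and 1 is an admissible radius with [r X > 4 M], a
     contradiction. This replaces the limit [r -> 1]. *)
  set (r := (4 * M / X + 1) / 2).
  assert (4 * M / X < 1) by (apply Rlt_div_l; lra).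
  assert (0 <= 4 * M / X) by (apply Rdiv_le_0_compat; lra).
  assert (B := K r ltac:(unfold r; lra)).
  assert (E : r * X = (4 * M + X) / 2) by (unfold r; field; lra).
  lra.
Qed.

(** A harmonic function composed with a holomorphic one is harmonic. The proof spells out the first
    and second derivatives of [u o k] by the chain rule, since the gradient bound at the origin
    takes them as data. *)
Lemma harmonic_comp_bound (Om : C -> Prop) (u p q : C -> R) (c0 M : R) :
  harmonic_on Om u -> (forall w, Om w -> Rabs (u w - c0) <= M) ->
  (forall w, unit_disk w -> exists a b, holo p q w a b) ->
  (forall w, unit_disk w -> Om (p w, q w)) ->
  exists l, is_derive (fun x => u (p (x, 0), q (x, 0))) 0 l /\ Rabs l <= 4 * M / PI.
Proof.
  intros (ux & uy & uxx & uxy & uyy & Hu) HM Hpq Hin.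
  assert (H2 : forall w, unit_disk w -> holo_C2_at p q w).
  { intros w Hw; apply holo_C2; generalize (unit_disk_open w Hw); apply filter_imp; exact Hpq. }
  (* With [k = p + iq], these are the real and imaginary parts of [k'] and, in the next line, of
     [k'']. *)
  set (al := partial_x p); set (be := partial_x q).
  set (mu := partial_x al); set (nu := partial_x be).
  set (k := fun w : C => (p w, q w) : C).
  set (a := fun w => ux (k w) * al w + uy (k w) * be w).
  set (b := fun w => ux (k w) * (- be w) + uy (k w) * al w).
  set (kxx := fun w => uxx (k w) * al w + uxy (k w) * be w).
  set (kyx := fun w => uxy (k w) * al w + uyy (k w) * be w).
  set (a1 := fun w => (al w * kxx w + ux (k w) * mu w) + (be w * kyx w + uy (k w) * nu w)).
  set (kxy := fun w => uxx (k w) * (- be w) + uxy (k w) * al w).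
  set (kyy := fun w => uxy (k w) * (- be w) + uyy (k w) * al w).
  set (a2 := fun w => (al w * kxy w + ux (k w) * (- nu w)) + (be w * kyy w + uy (k w) * mu w)).
  assert (Hh : forall w, unit_disk w -> holo p q w (al w) (be w) /\ holo al be w (mu w) (nu w) /\
     continuous mu w /\ continuous nu w) by exact H2.
  assert (Cu : forall f : C -> R, (forall w, Om w -> continuous f w) ->
     forall w, unit_disk w -> continuous (fun w => f (k w)) w).
  { intros f Hf w Hw; destruct (Hh w Hw) as [[Hp Hq] _].
    apply (continuous_comp k f); [|apply Hf; apply Hin; exact Hw].
    apply continuous_pair; eapply grad_continuous; eassumption. }
  assert (Pux : forall w, unit_disk w -> grad_at (fun w => ux (k w)) w (kxx w) (kxy w)).
  { intros w Hw; destruct (Hh w Hw) as [[Hp Hq] _].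
    apply (grad_comp ux p q w (uxx (k w)) (uxy (k w))); try assumption.
    exact (proj1 (proj2 (Hu _ (Hin w Hw)))). }
  assert (Puy : forall w, unit_disk w -> grad_at (fun w => uy (k w)) w (kyx w) (kyy w)).
  { intros w Hw; destruct (Hh w Hw) as [[Hp Hq] _].
    apply (grad_comp uy p q w (uxy (k w)) (uyy (k w))); try assumption.
    exact (proj1 (proj2 (proj2 (Hu _ (Hin w Hw))))). }
  assert (Pv : forall w, unit_disk w -> grad_at (fun w => u (k w)) w (a w) (b w)).
  { intros w Hw; destruct (Hh w Hw) as [[Hp Hq] _].
    apply (grad_comp u p q w (ux (k w)) (uy (k w))); try assumption.
    exact (proj1 (Hu _ (Hin w Hw))). }
  exists (a origin).
  assert (H0 : unit_disk origin) by (apply unit_disk_sqr; unfold origin; simpl; lra).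
  split; [exact (grad_x _ _ _ _ (Pv origin H0))|].
  (* Laplace's equation for [u], which with the Cauchy-Riemann equations for [k] and [k'] brings the
     gradient of [b] into the form [(a2, - a1)]. *)
  assert (Lap : forall w, unit_disk w -> uyy (k w) = - uxx (k w)).
  { intros w Hw; destruct (Hu _ (Hin w Hw)) as (_ & _ & _ & _ & _ & _ & E); unfold k; lra. }
  assert (Cal : forall w, unit_disk w -> continuous al w).
  { intros w Hw; destruct (Hh w Hw) as [_ [[H _] _]]; eapply grad_continuous; exact H. }
  assert (Cbe : forall w, unit_disk w -> continuous be w).
  { intros w Hw; destruct (Hh w Hw) as [_ [[_ H] _]]; eapply grad_continuous; exact H. }
  assert (Cux : forall w, unit_disk w -> continuous (fun w => ux (k w)) w).
  { intros w Hw; eapply grad_continuous; apply Pux; exact Hw. }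
  assert (Cuy : forall w, unit_disk w -> continuous (fun w => uy (k w)) w).
  { intros w Hw; eapply grad_continuous; apply Puy; exact Hw. }
  assert (Cuxx : forall w, unit_disk w -> continuous (fun w => uxx (k w)) w).
  { apply Cu; intros w Hw; apply (Hu w Hw). }
  assert (Cuxy : forall w, unit_disk w -> continuous (fun w => uxy (k w)) w).
  { apply Cu; intros w Hw; apply (Hu w Hw). }
  assert (Cuyy : forall w, unit_disk w -> continuous (fun w => uyy (k w)) w).
  { apply Cu; intros w Hw; apply (Hu w Hw). }
  assert (Cadd := continuous_Rplus C_UniformSpace); assert (Cmul := continuous_Rmult C_UniformSpace).
  assert (Cmu : forall w, unit_disk w -> continuous mu w) by (intros w Hw; apply (Hh w Hw)).
  assert (Cnu : forall w, unit_disk w -> continuous nu w) by (intros w Hw; apply (Hh w Hw)).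
  apply (harmonic_gradient_bound (fun w => u (k w)) a b a1 a2 c0 M).
  - exact Pv.
  - intros w Hw; destruct (Hh w Hw) as [_ [[Hal Hbe] _]].
    eapply grad_eq.
    + apply grad_plus; [apply (grad_mult (fun w => ux (k w)) al)|apply (grad_mult (fun w => uy (k w)) be)].
      * apply Pux; exact Hw.
      * exact Hal.
      * apply Puy; exact Hw.
      * exact Hbe.
    + unfold a1; reflexivity.
    + unfold a2; reflexivity.
  - intros w Hw; destruct (Hh w Hw) as [_ [[Hal Hbe] _]].
    eapply grad_eq.
    + apply grad_plus; [apply (grad_mult (fun w => ux (k w)) (fun w => - be w))|
                      apply (grad_mult (fun w => uy (k w)) al)].
      * apply Pux; exact Hw.
      * apply grad_opp; exact Hbe.
      * apply Puy; exact Hw.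
      * exact Hal.
    + unfold a2, kxx, kyx, kxy, kyy; rewrite (Lap w Hw); ring.
    + unfold a1, kxx, kyx, kxy, kyy; rewrite (Lap w Hw); ring.
  - intros w Hw.
    exact (Cadd _ _ _ (Cadd _ _ _ (Cmul _ _ _ (Cal w Hw) (Cadd _ _ _ (Cmul _ _ _ (Cuxx w Hw) (Cal w Hw))
      (Cmul _ _ _ (Cuxy w Hw) (Cbe w Hw)))) (Cmul _ _ _ (Cux w Hw) (Cmu w Hw)))
      (Cadd _ _ _ (Cmul _ _ _ (Cbe w Hw) (Cadd _ _ _ (Cmul _ _ _ (Cuxy w Hw) (Cal w Hw))
      (Cmul _ _ _ (Cuyy w Hw) (Cbe w Hw)))) (Cmul _ _ _ (Cuy w Hw) (Cnu w Hw)))).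
  - intros w Hw.
    assert (Cnbe := continuous_Ropp _ _ _ (Cbe w Hw)); assert (Cnnu := continuous_Ropp _ _ _ (Cnu w Hw)).
    exact (Cadd _ _ _ (Cadd _ _ _ (Cmul _ _ _ (Cal w Hw) (Cadd _ _ _ (Cmul _ _ _ (Cuxx w Hw) Cnbe)
      (Cmul _ _ _ (Cuxy w Hw) (Cal w Hw)))) (Cmul _ _ _ (Cux w Hw) Cnnu))
      (Cadd _ _ _ (Cmul _ _ _ (Cbe w Hw) (Cadd _ _ _ (Cmul _ _ _ (Cuxy w Hw) Cnbe)
      (Cmul _ _ _ (Cuyy w Hw) (Cal w Hw)))) (Cmul _ _ _ (Cuy w Hw) (Cmu w Hw)))).
  - intros w Hw; apply HM; apply Hin; exact Hw.
Qed.

(** * The hyperbolic Lipschitz estimate *)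

Definition complex_diff (f : C -> C) (z l : C) : Prop :=
  holo (fun w => Re (f w)) (fun w => Im (f w)) z (Re l) (Im l).

Lemma grad_comp1 (phi : R -> R) (u : C -> R) (z : C) (l a b : R) :
  is_derive phi (u z) l -> grad_at u z a b -> grad_at (fun w => phi (u w)) z (l * a) (l * b).
Proof.
  intros H1 H2.
  apply (grad_eq _ _ (l * a + 0 * 0) (l * b + 0 * 0)); [|ring|ring].
  apply (grad_comp (fun w => phi (fst w)) u (fun _ => 0) z l 0 a b 0 0); [|exact H2|].
  - apply (differentiable_pt_lim_proj1_0 phi (u z) 0 l); apply is_derive_Reals; exact H1.
  - apply (differentiable_pt_lim_proj1_0 (fun _ => 0) (Re z) (Im z) 0).
    apply is_derive_Reals, is_derive_Rconst.
Qed.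

Lemma grad_const (c : R) (z : C) : grad_at (fun _ => c) z 0 0.
Proof.
  apply (differentiable_pt_lim_proj1_0 (fun _ => c) (Re z) (Im z) 0).
  apply is_derive_Reals, is_derive_Rconst.
Qed.

Lemma grad_Re (z : C) : grad_at (fun w => Re w) z 1 0.
Proof.
  apply (differentiable_pt_lim_proj1_0 (fun x => x) (Re z) (Im z) 1).
  apply is_derive_Reals, is_derive_Rid.
Qed.

Lemma grad_Im (z : C) : grad_at (fun w => Im w) z 0 1.
Proof.
  apply (grad_C1 (fun w => Im w) (fun _ => 0)).
  - apply filter_forall; intros w; simpl; apply is_derive_Rconst.
  - apply is_derive_Rid.
  - apply continuous_const.
Qed.

Lemma complex_diff_const (c z : C) : complex_diff (fun _ => c) z 0.
Proof. split; (eapply grad_eq; [apply grad_const| |]); simpl; ring. Qed.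

Lemma complex_diff_id (z : C) : complex_diff (fun w => w) z 1.
Proof. split; (eapply grad_eq; [apply grad_Re || apply grad_Im| |]); simpl; ring. Qed.

Lemma complex_diff_plus (f g : C -> C) (z l m : C) :
  complex_diff f z l -> complex_diff g z m -> complex_diff (fun w => f w + g w)%C z (l + m)%C.
Proof.
  intros [F1 F2] [G1 G2]; split.
  - eapply grad_eq; [apply grad_plus; [exact F1|exact G1]| |]; unfold Re, Im; simpl; ring.
  - eapply grad_eq; [apply grad_plus; [exact F2|exact G2]| |]; unfold Re, Im; simpl; ring.
Qed.

Lemma grad_minus (u v : C -> R) (z : C) (a b c d : R) :
  grad_at u z a b -> grad_at v z c d -> grad_at (fun w => u w - v w) z (a - c) (b - d).
Proof. intros H1 H2; apply grad_plus; [exact H1|apply grad_opp; exact H2]. Qed.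

Lemma complex_diff_mult (f g : C -> C) (z l m : C) :
  complex_diff f z l -> complex_diff g z m -> complex_diff (fun w => f w * g w)%C z (l * g z + f z * m)%C.
Proof.
  intros [F1 F2] [G1 G2]; split.
  - eapply grad_eq; [apply grad_minus; [apply grad_mult; [exact F1|exact G1]|
      apply grad_mult; [exact F2|exact G2]]| |]; unfold Re, Im; simpl; ring.
  - eapply grad_eq; [apply grad_plus; [apply grad_mult; [exact F1|exact G2]|
      apply grad_mult; [exact F2|exact G1]]| |]; unfold Re, Im; simpl; ring.
Qed.

Lemma complex_diff_comp (f g : C -> C) (z l m : C) :
  complex_diff f (g z) l -> complex_diff g z m -> complex_diff (fun w => f (g w)) z (l * m)%C.
Proof.
  intros [F1 F2] [G1 G2].
  assert (E : forall w, g w = (Re (g w), Im (g w))) by (intros w; apply surjective_pairing).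
  rewrite (E z) in F1, F2.
  split.
  - apply (grad_ext_loc (fun w => Re (f (Re (g w), Im (g w))))).
    + apply filter_forall; intros w; rewrite <- E; reflexivity.
    + eapply grad_eq; [apply (grad_comp (fun w => Re (f w)) (fun w => Re (g w)) (fun w => Im (g w)));
        [exact F1|exact G1|exact G2]| |]; unfold Re, Im; simpl; ring.
  - apply (grad_ext_loc (fun w => Im (f (Re (g w), Im (g w))))).
    + apply filter_forall; intros w; rewrite <- E; reflexivity.
    + eapply grad_eq; [apply (grad_comp (fun w => Im (f w)) (fun w => Re (g w)) (fun w => Im (g w)));
        [exact F2|exact G1|exact G2]| |]; unfold Re, Im; simpl; ring.
Qed.

Lemma complex_diff_inv (z : C) : z <> 0%C -> complex_diff (fun w => / w)%C z (- / (z * z))%C.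
Proof.
  intros Hz.
  assert (Hn : Re z ^ 2 + Im z ^ 2 <> 0).
  { rewrite <- Cmod2_alt; apply pow_nonzero; apply Rgt_not_eq, Cmod_gt_0; exact Hz. }
  assert (Hm : (Re z * Re z - Im z * Im z) ^ 2 + (Re z * Im z + Im z * Re z) ^ 2 <> 0).
  { replace ((Re z * Re z - Im z * Im z) ^ 2 + (Re z * Im z + Im z * Re z) ^ 2)
      with ((Re z ^ 2 + Im z ^ 2) ^ 2) by ring.
    apply pow_nonzero; exact Hn. }
  assert (P2 : forall u a b, grad_at u z a b -> grad_at (fun w => u w ^ 2) z (2 * u z * a) (2 * u z * b)).
  { intros u a b Hu; apply (grad_comp1 (fun x => x ^ 2)); [|exact Hu]; auto_derive; trivial; ring. }
  assert (PN : grad_at (fun w => / (Re w ^ 2 + Im w ^ 2)) z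
     (- / (Re z ^ 2 + Im z ^ 2) ^ 2 * (2 * Re z * 1 + 2 * Im z * 0))
     (- / (Re z ^ 2 + Im z ^ 2) ^ 2 * (2 * Re z * 0 + 2 * Im z * 1))).
  { apply (grad_comp1 (fun x => / x) (fun w => Re w ^ 2 + Im w ^ 2)).
    - auto_derive; [exact Hn|field; exact Hn].
    - apply grad_plus; apply P2; [apply grad_Re|apply grad_Im]. }
  unfold complex_diff, holo; simpl in *; unfold Re, Im in *; simpl in *.
  rewrite !Rmult_1_r in Hn, Hm.
  split.
  - eapply grad_eq; [apply (grad_mult _ _ _ _ _ _ _ (grad_Re z) PN)| |]; unfold Re, Im;
      field; split; assumption.
  - eapply grad_eq; [apply (grad_mult _ _ _ _ _ _ _ (grad_opp _ _ _ _ (grad_Im z)) PN)| |]; unfold Re, Im;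
      field; split; assumption.
Qed.

(** The expansion is measured by the modulus on one side and by the larger coordinate difference on
    the other; [|w - z| <= 2 max] accounts for asking the former with [eps / 2]. *)
Lemma is_derive_complex_diff (k : C -> C) (z l : C) :
  is_derive (K := C_AbsRing) (V := C_NormedModule) k z l -> complex_diff k z l.
Proof.
  intros [_ H].
  specialize (H z (fun P HP => HP)).
  assert (K : forall eps, 0 < eps -> exists d : posreal, forall w, Rabs (Re w - Re z) < d ->
    Rabs (Im w - Im z) < d ->
    Cmod (k w - k z - (w - z) * l)%C <= eps * Rmax (Rabs (Re w - Re z)) (Rabs (Im w - Im z))).
  { intros eps Heps.
    assert (He : 0 < eps / 2) by lra.
    specialize (H (mkposreal _ He)); simpl in H.
    apply locally_C, locally_box in H; destruct H as [d [Hd H]].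
    exists (mkposreal d Hd); intros w H1 H2; specialize (H w H1 H2).
    change (Cmod (k w - k z - (w - z) * l)%C <= eps / 2 * Cmod (w - z)%C) in H.
    apply Rle_trans with (1 := H).
    assert (B := Cmod_2Rmax (w - z)%C).
    change (fst (w - z)%C) with (Re w - Re z) in B; change (snd (w - z)%C) with (Im w - Im z) in B.
    assert (S2 : sqrt 2 <= 2).
    { rewrite <- (sqrt_pow2 2) at 2 by lra; apply sqrt_le_1_alt; lra. }
    assert (0 <= Rmax (Rabs (Re w - Re z)) (Rabs (Im w - Im z)))
      by (eapply Rle_trans; [apply Rabs_pos|apply Rmax_l]).
    set (m := Rmax (Rabs (Re w - Re z)) (Rabs (Im w - Im z))) in *.
    assert (sqrt 2 * m <= 2 * m) by (apply Rmult_le_compat_r; assumption).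
    replace (eps * m) with (eps / 2 * (2 * m)) by field; apply Rmult_le_compat_l; lra. }
  split; intros eps; destruct (K eps (cond_pos eps)) as [d Hd]; exists d; intros x y Hx Hy;
    specialize (Hd (x, y) Hx Hy); (eapply Rle_trans; [|exact Hd]).
  - eapply Rle_trans; [|apply re_le_Cmod]; right; f_equal; destruct z; simpl; unfold Re, Im; simpl; ring.
  - eapply Rle_trans; [|eapply Rle_trans; [apply Rmax_r|apply Rmax_Cmod]].
    right; f_equal; destruct z; simpl; unfold Re, Im; simpl; ring.
Qed.

(** * Automorphisms of the disk *)

Definition moebius (a z : C) : C := ((z + a) / (1 + Cconj a * z))%C.

(** Positivity of the right side in the disk gives both that the denominator of [moebius a] does not
    vanish and that its values stay in the disk. *)
Lemma moebius_norms (a z : C) :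
  Cmod (1 + Cconj a * z)%C ^ 2 - Cmod (z + a)%C ^ 2 = (1 - Cmod a ^ 2) * (1 - Cmod z ^ 2).
Proof. rewrite !Cmod2_alt; destruct a, z; simpl; ring. Qed.

Lemma moebius_denominator (a z : C) : unit_disk a -> unit_disk z -> (1 + Cconj a * z)%C <> 0%C.
Proof.
  unfold unit_disk; intros Ha Hz E.
  assert (H := moebius_norms a z); rewrite E, Cmod_0 in H.
  generalize (Cmod_ge_0 a) (Cmod_ge_0 z) (pow2_ge_0 (Cmod (z + a)%C)); intros.
  assert (0 < (1 - Cmod a ^ 2) * (1 - Cmod z ^ 2)) by (apply Rmult_lt_0_compat; nra).
  simpl in *; lra.
Qed.

Lemma moebius_in (a z : C) : unit_disk a -> unit_disk z -> unit_disk (moebius a z).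
Proof.
  intros Ha Hz; assert (Hd := moebius_denominator a z Ha Hz).
  assert (H := moebius_norms a z); unfold unit_disk, moebius in *.
  rewrite Cmod_div by exact Hd; apply Cmod_gt_0 in Hd; apply Rlt_div_l; [exact Hd|].
  generalize (Cmod_ge_0 a) (Cmod_ge_0 z) (Cmod_ge_0 (z + a)%C); intros.
  assert (0 < (1 - Cmod a ^ 2) * (1 - Cmod z ^ 2)) by (apply Rmult_lt_0_compat; nra).
  nra.
Qed.

Lemma moebius_complex_diff (a z : C) : unit_disk a -> unit_disk z -> exists l, complex_diff (moebius a) z l.
Proof.
  intros Ha Hz; assert (Hd := moebius_denominator a z Ha Hz); eexists.
  apply complex_diff_mult.
  - apply complex_diff_plus; [apply complex_diff_id|apply complex_diff_const].
  - apply (complex_diff_comp (fun w => / w)%C (fun z => 1 + Cconj a * z)%C); [apply complex_diff_inv; exact Hd|].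
    apply complex_diff_plus; [apply complex_diff_const|].
    apply (complex_diff_mult (fun _ => Cconj a) (fun z => z)); [apply complex_diff_const|apply complex_diff_id].
Qed.

Lemma real_in_unit_disk (t : R) : -1 < t < 1 -> unit_disk (RtoC t).
Proof. intros H; unfold unit_disk; rewrite Cmod_R; apply Rabs_def1; lra. Qed.

Lemma is_derive_artanh (t : R) : -1 < t < 1 -> is_derive artanh t (/ (1 - t ^ 2)).
Proof.
  intros H; unfold artanh; auto_derive.
  - split; [lra|]; split; [|trivial].
    apply Rmult_lt_0_compat; [lra|apply Rinv_0_lt_compat; lra].
  - field; repeat split; nra.
Qed.

Lemma artanh_0 : artanh 0 = 0.
Proof. unfold artanh; rewrite Rplus_0_r, Rminus_0_r, Rdiv_1_r, ln_1; lra. Qed.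

(** The map [moebius z1 (e z)], with [e] a suitable rotation, carries the real interval [[0, rho]]
    to the hyperbolic segment from [z1] to [z2]. Along it the derivative of [V] is at most
    [4 M / pi] times [1 / (1 - t^2)], which is the derivative of [artanh]. *)
Lemma harmonic_hyp_lipschitz (Om : C -> Prop) (u : C -> R) (k : C -> C) (c0 M : R) (z1 z2 : C) :
  harmonic_on Om u -> (forall w, Om w -> Rabs (u w - c0) <= M) ->
  (forall z, unit_disk z -> exists l, complex_diff k z l) ->
  (forall z, unit_disk z -> Om (k z)) -> unit_disk z1 -> unit_disk z2 ->
  Rabs (u (k z2) - u (k z1)) <= 4 * M / PI * hyp_dist_disk z1 z2.
Proof.
  intros Hu HM Hk Hin H1 H2.
  set (w0 := moebius (- z1)%C z2).
  assert (Hmz1 : unit_disk (- z1)%C) by (unfold unit_disk; rewrite Cmod_opp; exact H1).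
  assert (Hw0 : unit_disk w0) by (apply moebius_in; assumption).
  set (rho := Cmod w0).
  assert (Hrho : 0 <= rho < 1) by (split; [apply Cmod_ge_0|exact Hw0]).
  (* The rotation brings [w0] to the positive real axis; for [w0 = 0] any unit number will do. *)
  assert (He : exists e, Cmod e = 1 /\ (e * rho)%C = w0).
  { destruct (Req_dec rho 0) as [E|E].
    - exists 1%C; split; [apply Cmod_1|]; rewrite (Cmod_eq_0 w0 E); rewrite E; ring.
    - assert (Hr : RtoC rho <> 0%C) by (intros Hc; apply E; injection Hc; trivial).
      exists (w0 / rho)%C; split; [|field; exact Hr].
      rewrite Cmod_div, Cmod_R, Rabs_pos_eq by (exact Hr || lra); fold rho; field; exact E. }
  destruct He as [e [He1 He2]].
  assert (Hez : forall z, unit_disk z -> unit_disk (e * z)%C)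
    by (intros z Hz; unfold unit_disk; rewrite Cmod_mult, He1, Rmult_1_l; exact Hz).
  set (g := fun z => k (moebius z1 (e * z)%C)).
  set (V := fun x : R => u (g (RtoC x))).
  assert (HV0 : V 0 = u (k z1)).
  { unfold V, g; do 2 f_equal; unfold moebius; field. }
  assert (HVr : V rho = u (k z2)).
  { unfold V, g; do 2 f_equal; rewrite He2; unfold w0, moebius.
    assert (D1 := moebius_denominator _ _ Hmz1 H2).
    assert (D2 := moebius_denominator z1 w0 H1 Hw0).
    unfold w0, moebius in D2.
    assert (Cj : Cconj (- z1)%C = (- Cconj z1)%C) by (destruct z1; unfold Cconj, Copp; simpl; f_equal; ring).
    rewrite Cj in *.
    assert (D3 : (1 - Cconj z1 * z1)%C <> 0%C).
    { intros Hc; assert (E := f_equal fst Hc); destruct z1 as [x y]; simpl in E.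
      apply unit_disk_sqr in H1; simpl in H1; nra. }
    field; split; [exact D1|].
    intros Hc; apply D3; rewrite <- Hc; ring. }
  assert (Hder : forall t, 0 <= t < 1 -> exists l, is_derive V t l /\ Rabs l <= 4 * M / PI * / (1 - t ^ 2)).
  { intros t Ht.
    assert (Htd : unit_disk (RtoC t)) by (apply real_in_unit_disk; lra).
    destruct (harmonic_comp_bound Om u (fun w => Re (g (moebius (RtoC t) w)))
      (fun w => Im (g (moebius (RtoC t) w))) c0 M Hu HM) as [l [Hl Hlb]].
    - intros w Hw; destruct (moebius_complex_diff t w Htd Hw) as [m1 Hm1].
      assert (Hmw := moebius_in t w Htd Hw).
      destruct (moebius_complex_diff z1 (e * moebius t w)%C H1 (Hez _ Hmw)) as [m2 Hm2].
      destruct (Hk _ (moebius_in _ _ H1 (Hez _ Hmw))) as [m3 Hm3].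
      assert (Hall : exists m, complex_diff (fun w => g (moebius t w)) w m).
      { eexists; unfold g.
        apply (complex_diff_comp k (fun w => moebius z1 (e * moebius t w)%C)); [exact Hm3|].
        apply (complex_diff_comp (moebius z1) (fun w => e * moebius t w)%C); [exact Hm2|].
        apply (complex_diff_mult (fun _ => e) (moebius t)); [apply complex_diff_const|exact Hm1]. }
      destruct Hall as [m Hm]; exists (Re m), (Im m); exact Hm.
    - intros w Hw; rewrite <- surjective_pairing; apply Hin.
      apply moebius_in; [exact H1|]; apply Hez, moebius_in; assumption.
    - exists (l * / (1 - t ^ 2)); split.
      2:{ assert (0 < / (1 - t ^ 2)) by (apply Rinv_0_lt_compat; nra).
          rewrite Rabs_mult, (Rabs_pos_eq (/ (1 - t ^ 2))) by lra.
          apply Rmult_le_compat_r; [lra|exact Hlb]. }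
      set (h := fun x => u (Re (g (moebius t (x, 0))), Im (g (moebius t (x, 0))))) in *.
      (* The gradient bound lives at the origin, which [moebius t] moves to [t]. Undoing it on the
         real axis by [(y - t) / (1 - t y)], whose derivative at [t] is [1 / (1 - t^2)], transports
         the bound to [V] at [t]. *)
      apply (is_derive_ext_loc (fun y => h ((y - t) / (1 - t * y)))).
      + assert (Hd : 0 < 1 - t) by lra; exists (mkposreal _ Hd); intros y Hy.
        change (Rabs (y - t) < 1 - t) in Hy; apply Rabs_def2 in Hy.
        unfold h, V; rewrite <- surjective_pairing; do 2 f_equal.
        change ((y - t) / (1 - t * y), 0) with (RtoC ((y - t) / (1 - t * y))).
        unfold moebius.
        assert (N1 : 1 - t * y <> 0) by nra.
        assert (N2 : 1 - t * t <> 0) by nra.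
        replace (Cconj (RtoC t)) with (RtoC t) by (unfold Cconj, RtoC; simpl; f_equal; ring).
        rewrite <- RtoC_mult, <- !RtoC_plus, <- RtoC_div; [f_equal; field; split; nra|].
        replace (1 + t * ((y - t) / (1 - t * y))) with ((1 - t * t) / (1 - t * y)) by (field; exact N1).
        apply Rmult_integral_contrapositive_currified; [exact N2|apply Rinv_neq_0_compat; exact N1].
      + replace (l * / (1 - t ^ 2)) with (/ (1 - t ^ 2) * l) by ring.
        apply (is_derive_comp (K := R_AbsRing) (V := R_NormedModule) h (fun y => (y - t) / (1 - t * y))).
        * replace ((t - t) / (1 - t * t)) with 0 by (field; nra); exact Hl.
        * auto_derive; [nra|field; nra]. }
  assert (HD : Cmod ((z1 - z2) / (1 - Cconj z1 * z2))%C = rho).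
  { unfold rho, w0, moebius.
    assert (D1 := moebius_denominator _ _ Hmz1 H2).
    assert (Cj : Cconj (- z1)%C = (- Cconj z1)%C) by (destruct z1; unfold Cconj, Copp; simpl; f_equal; ring).
    rewrite Cj in *; rewrite <- Cmod_opp; f_equal; field; exact D1. }
  unfold hyp_dist_disk; rewrite HD, <- HV0, <- HVr.
  destruct (Req_dec rho 0) as [E|E].
  { rewrite E, artanh_0, Rminus_diag, Rabs_R0; lra. }
  (* The mean value theorem for [4 M / pi artanh - sg V], with both signs in order to bound the
     absolute value. *)
  assert (K : forall sg, sg = 1 \/ sg = -1 -> sg * (V rho - V 0) <= 4 * M / PI * artanh rho).
  { intros sg Hsg.
    destruct (MVT_gen (fun t => 4 * M / PI * artanh t - sg * V t) 0 rho
      (fun t => 4 * M / PI * / (1 - t ^ 2) - sg * Derive V t)) as [c [Hc Hmv]].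
    - intros t Ht; rewrite Rmin_left, Rmax_right in Ht by lra.
      apply (is_derive_minus (K := R_AbsRing) (V := R_NormedModule)
        (fun t => 4 * M / PI * artanh t) (fun t => sg * V t)).
      + apply is_derive_scal, is_derive_artanh; lra.
      + apply is_derive_scal, Derive_correct; destruct (Hder t ltac:(lra)) as [l [Hl _]]; exists l; exact Hl.
    - intros t Ht; rewrite Rmin_left, Rmax_right in Ht by lra.
      destruct (Hder t ltac:(lra)) as [l [Hl _]].
      apply continuity_pt_filterlim.
      apply (continuous_of_derive (fun t => 4 * M / PI * artanh t - sg * V t) t
        (4 * M / PI * / (1 - t ^ 2) - sg * l)).
      apply (is_derive_minus (K := R_AbsRing) (V := R_NormedModule)
        (fun t => 4 * M / PI * artanh t) (fun t => sg * V t)).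
      + apply is_derive_scal, is_derive_artanh; lra.
      + apply is_derive_scal; exact Hl.
    - rewrite Rmin_left, Rmax_right in Hc by lra.
      destruct (Hder c ltac:(lra)) as [l [Hl Hlb]].
      rewrite (is_derive_unique _ _ _ Hl), artanh_0 in Hmv.
      assert (0 <= 4 * M / PI * / (1 - c ^ 2) - sg * l).
      { apply Rabs_le_between in Hlb; destruct Hsg as [-> | ->]; lra. }
      assert (0 <= (4 * M / PI * / (1 - c ^ 2) - sg * l) * (rho - 0)) by (apply Rmult_le_pos; lra).
      lra. }
  apply Rabs_le; generalize (K 1 (or_introl eq_refl)) (K (-1) (or_intror eq_refl)); lra.
Qed.

(** * Path length and distance *)

Definition seg_int (a b t : R) : Prop := a <= t <= b.

Lemma seg_int_convex (a b : R) : convex_set (seg_int a b).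
Proof. unfold convex_set, seg_int; intros; lra. Qed.

Lemma dwithin_is_derive (I : R -> Prop) (G : R -> R) (t l : R) :
  locally t I -> dwithin I G t l -> is_derive G t l.
Proof.
  intros [d0 H0] H; apply is_derive_eps; intros eps Heps.
  destruct (H eps Heps) as [d [Hd H1]]; exists (Rmin d0 d); split.
  { apply Rmin_pos; [apply cond_pos|exact Hd]. }
  intros y Hy; apply H1.
  - apply H0; exact (lt_Rmin_l Hy).
  - exact (lt_Rmin_r Hy).
Qed.

Lemma seg_int_locally (a b t : R) : a < t < b -> locally t (seg_int a b).
Proof.
  intros H; assert (Hd : 0 < Rmin (t - a) (b - t)) by (apply Rmin_pos; lra).
  exists (mkposreal _ Hd); intros y Hy; change (Rabs (y - t) < Rmin (t - a) (b - t)) in Hy.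
  assert (A := lt_Rmin_l Hy); assert (B := lt_Rmin_r Hy).
  apply Rabs_def2 in A; apply Rabs_def2 in B; unfold seg_int; lra.
Qed.

Lemma quotient_components (w : C) (h : R) : h <> 0 -> (w / RtoC h)%C = (Re w / h, Im w / h).
Proof.
  intros Hh; destruct w as [x y]; unfold Cdiv, Cmult, Cinv, RtoC; simpl.
  f_equal; field; exact Hh.
Qed.

Lemma filterlim_C_eps (F : (R -> Prop) -> Prop) (f : R -> C) (l : C) : Filter F ->
  filterlim f F (locally l) <->
  forall eps, 0 < eps -> F (fun s => Rabs (Re (f s) - Re l) < eps /\ Rabs (Im (f s) - Im l) < eps).
Proof.
  intros HF; split.
  - intros H eps Heps; apply (H (fun w => Rabs (Re w - Re l) < eps /\ Rabs (Im w - Im l) < eps)).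
    exists (mkposreal eps Heps); intros w [H1 H2]; split; assumption.
  - intros H P [e He]; unfold filtermap; generalize (H e (cond_pos e)); apply filter_imp.
    intros s [H1 H2]; apply He; split; assumption.
Qed.

Lemma C1_path_eps (I : R -> Prop) (g dg : R -> C) :
  C1_path_on I g dg <->
  forall t, I t -> dwithin I (fun s => Re (g s)) t (Re (dg t)) /\
    dwithin I (fun s => Im (g s)) t (Im (dg t)) /\
    cwithin I (fun s => Re (dg s)) t /\ cwithin I (fun s => Im (dg s)) t.
Proof.
  assert (Q : forall (x l h eps : R), h <> 0 -> Rabs (x / h - l) * Rabs h = Rabs (x - l * h)).
  { intros x l h eps Hh; rewrite <- Rabs_mult; f_equal; field; exact Hh. }
  split; intros H t Ht; destruct (H t Ht) as [H1 H2]; clear H.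
  - assert (A := proj1 (filterlim_C_eps _ _ _ _) H1); clear H1.
    assert (B := proj1 (filterlim_C_eps _ _ _ _) H2); clear H2.
    assert (A' : forall eps, 0 < eps -> exists d, 0 < d /\ forall s, I s -> Rabs (s - t) < d ->
        Rabs (Re (g s) - Re (g t) - Re (dg t) * (s - t)) <= eps * Rabs (s - t) /\
        Rabs (Im (g s) - Im (g t) - Im (dg t) * (s - t)) <= eps * Rabs (s - t)).
    { intros eps Heps; destruct (A eps Heps) as [d Hd]; exists d; split; [apply cond_pos|].
      intros s Hs Hst; destruct (Req_dec s t) as [->|Hne].
      - rewrite !Rminus_diag, !Rmult_0_r, !Rminus_0_r, Rabs_R0; lra.
      - assert (Hh : s - t <> 0) by lra.
        assert (K := Hd s Hst Hne Hs); rewrite quotient_components in K by exact Hh.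
        simpl in K; destruct K as [K1 K2].
        change (Re (g s - g t)%C) with (Re (g s) - Re (g t)) in K1.
        change (Im (g s - g t)%C) with (Im (g s) - Im (g t)) in K2.
        split; (rewrite <- Q by assumption; apply Rmult_le_compat_r; [apply Rabs_pos|left; assumption]). }
    repeat split.
    + intros eps Heps; destruct (A' eps Heps) as [d [Hd K]]; exists d; split; [exact Hd|].
      intros; apply K; assumption.
    + intros eps Heps; destruct (A' eps Heps) as [d [Hd K]]; exists d; split; [exact Hd|].
      intros; apply K; assumption.
    + intros eps Heps; destruct (B eps Heps) as [d Hd]; exists d; split; [apply cond_pos|].
      intros; apply Hd; assumption.
    + intros eps Heps; destruct (B eps Heps) as [d Hd]; exists d; split; [apply cond_pos|].
      intros; apply Hd; assumption.
  - destruct H2 as (H2 & H3 & H4); split; apply filterlim_C_eps; try typeclasses eauto; intros eps Heps.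
    + destruct (H1 (eps / 2)) as [d1 [Hd1 K1]]; [lra|].
      destruct (H2 (eps / 2)) as [d2 [Hd2 K2]]; [lra|].
      assert (Hd : 0 < Rmin d1 d2) by (apply Rmin_pos; assumption).
      exists (mkposreal _ Hd); intros s Hs Hne HI.
      change (Rabs (s - t) < Rmin d1 d2) in Hs.
      assert (Hh : s - t <> 0) by lra.
      assert (Hp : 0 < Rabs (s - t)) by (apply Rabs_pos_lt; exact Hh).
      rewrite quotient_components by exact Hh; simpl.
      change (Re (g s - g t)%C) with (Re (g s) - Re (g t)).
      change (Im (g s - g t)%C) with (Im (g s) - Im (g t)).
      assert (L1 := K1 s HI (lt_Rmin_l Hs)).
      assert (L2 := K2 s HI (lt_Rmin_r Hs)).
      simpl in L1, L2; rewrite <- Q in L1, L2 by assumption.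
      apply Rmult_le_reg_r in L1; [|exact Hp]; apply Rmult_le_reg_r in L2; [|exact Hp].
      split; [apply (Rle_lt_trans _ _ _ L1)|apply (Rle_lt_trans _ _ _ L2)]; lra.
    + destruct (H3 eps Heps) as [d1 [Hd1 K1]]; destruct (H4 eps Heps) as [d2 [Hd2 K2]].
      assert (Hd : 0 < Rmin d1 d2) by (apply Rmin_pos; assumption).
      exists (mkposreal _ Hd); intros s Hs HI.
      change (Rabs (s - t) < Rmin d1 d2) in Hs.
      split; [apply K1|apply K2]; try assumption;
        [exact (lt_Rmin_l Hs)|exact (lt_Rmin_r Hs)].
Qed.

Lemma C1_path_ext (I : R -> Prop) (g h dg : R -> C) :
  (forall t, I t -> g t = h t) -> C1_path_on I g dg -> C1_path_on I h dg.
Proof.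
  intros E H; apply C1_path_eps; intros t Ht.
  destruct (proj1 (C1_path_eps I g dg) H t Ht) as (H1 & H2 & H3 & H4).
  split; [|split; [|split; assumption]]; intros eps Heps;
    [destruct (H1 eps Heps) as [d [Hd K]]|destruct (H2 eps Heps) as [d [Hd K]]];
    exists d; (split; [exact Hd|]); intros s Hs Hst; rewrite <- !E by assumption; apply K; assumption.
Qed.

Lemma C1_path_mono (I J : R -> Prop) (g dg : R -> C) :
  (forall t, J t -> I t) -> C1_path_on I g dg -> C1_path_on J g dg.
Proof.
  intros E H; apply C1_path_eps; intros t Ht.
  destruct (proj1 (C1_path_eps I g dg) H t (E t Ht)) as (H1 & H2 & H3 & H4).
  split; [|split; [|split]]; intros eps Heps;
    [destruct (H1 eps Heps) as [d [Hd K]]|destruct (H2 eps Heps) as [d [Hd K]]|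
     destruct (H3 eps Heps) as [d [Hd K]]|destruct (H4 eps Heps) as [d [Hd K]]];
    exists d; (split; [exact Hd|]); intros s Hs Hst; apply K; auto.
Qed.

Lemma Rabs_unit (sg : R) : sg * sg = 1 -> Rabs sg = 1.
Proof.
  intros H; assert (E : (sg - 1) * (sg + 1) = 0) by (ring_simplify; lra).
  apply Rmult_integral in E; unfold Rabs; destruct Rcase_abs; destruct E; lra.
Qed.

(** The condition [sg * sg = 1] treats translation and reversal of a path at the same time. *)
Lemma dwithin_affine (I : R -> Prop) (G : R -> R) (sg c t l : R) : sg * sg = 1 ->
  dwithin I G (sg * t + c) l ->
  dwithin (fun s => I (sg * s + c)) (fun s => G (sg * s + c)) t (sg * l).
Proof.
  intros Hsg H eps Heps; destruct (H eps Heps) as [d [Hd K]]; exists d; split; [exact Hd|].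
  assert (Hab := Rabs_unit sg Hsg).
  intros s Hs Hst.
  assert (E : Rabs (sg * s + c - (sg * t + c)) = Rabs (s - t)).
  { replace (sg * s + c - (sg * t + c)) with (sg * (s - t)) by ring; rewrite Rabs_mult, Hab; ring. }
  specialize (K (sg * s + c) Hs); rewrite E in K; specialize (K Hst).
  replace (G (sg * s + c) - G (sg * t + c) - sg * l * (s - t)) with
    (G (sg * s + c) - G (sg * t + c) - l * (sg * s + c - (sg * t + c))) by ring; exact K.
Qed.

Lemma cwithin_affine (I : R -> Prop) (G : R -> R) (sg c t : R) : sg * sg = 1 ->
  cwithin I G (sg * t + c) ->
  cwithin (fun s => I (sg * s + c)) (fun s => sg * G (sg * s + c)) t.
Proof.
  intros Hsg H eps Heps; destruct (H eps Heps) as [d [Hd K]]; exists d; split; [exact Hd|].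
  assert (Hab := Rabs_unit sg Hsg).
  intros s Hs Hst.
  rewrite <- Rmult_minus_distr_l, Rabs_mult, Hab, Rmult_1_l; apply K; [exact Hs|].
  replace (sg * s + c - (sg * t + c)) with (sg * (s - t)) by ring; rewrite Rabs_mult, Hab; lra.
Qed.

Lemma C1_path_affine (I : R -> Prop) (g dg : R -> C) (sg c : R) : sg * sg = 1 ->
  C1_path_on I g dg ->
  C1_path_on (fun s => I (sg * s + c)) (fun s => g (sg * s + c))
    (fun s => (sg * Re (dg (sg * s + c)), sg * Im (dg (sg * s + c)))).
Proof.
  intros Hsg H; apply C1_path_eps; intros t Ht.
  destruct (proj1 (C1_path_eps I g dg) H _ Ht) as (H1 & H2 & H3 & H4); simpl.
  split; [|split; [|split]].
  - apply (dwithin_affine I (fun s => Re (g s))); assumption.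
  - apply (dwithin_affine I (fun s => Im (g s))); assumption.
  - apply (cwithin_affine I (fun s => Re (dg s))); assumption.
  - apply (cwithin_affine I (fun s => Im (dg s))); assumption.
Qed.

Lemma C1_on_grad (A : C -> Prop) (u : C -> R) (z : C) :
  open A -> C1_on A u -> A z -> grad_at u z (partial_x u z) (partial_y u z).
Proof.
  intros HA Hu Hz; apply (grad_C1 u (partial_x u)).
  - generalize (HA z Hz); apply filter_imp; intros w Hw.
    apply Derive_correct; apply (Hu w Hw).
  - apply Derive_correct; apply (Hu z Hz).
  - apply (Hu z Hz).
Qed.

Lemma cwithin_comp2 (I : R -> Prop) (f1 f2 : R -> R) (h : C -> R) (t : R) :
  cwithin I f1 t -> cwithin I f2 t -> continuous h (f1 t, f2 t) ->
  cwithin I (fun s => h (f1 s, f2 s)) t.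
Proof.
  intros H1 H2 H3 eps Heps.
  destruct (proj1 (continuous_box h _) H3 eps Heps) as [e [He K]].
  destruct (H1 e He) as [d1 [Hd1 K1]]; destruct (H2 e He) as [d2 [Hd2 K2]].
  exists (Rmin d1 d2); split; [apply Rmin_pos; assumption|].
  intros s Hs Hst; apply K; [apply K1|apply K2]; try assumption;
    [exact (lt_Rmin_l Hst)|exact (lt_Rmin_r Hst)].
Qed.

Lemma cwithin_mult (I : R -> Prop) (f1 f2 : R -> R) (t : R) :
  cwithin I f1 t -> cwithin I f2 t -> cwithin I (fun s => f1 s * f2 s) t.
Proof.
  intros H1 H2; apply (cwithin_comp2 I f1 f2 (fun w => fst w * snd w)); try assumption.
  apply continuous_Rmult; [apply continuous_fst|apply continuous_snd].
Qed.

Lemma continuous_Cmod (w : C) : continuous Cmod w.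
Proof.
  assert (S : forall x : R, continuous (fun x => x ^ 2) x).
  { intros x; eapply continuous_of_derive; auto_derive; trivial; reflexivity. }
  apply (continuous_comp (fun w : C => fst w ^ 2 + snd w ^ 2) sqrt).
  - apply continuous_Rplus; apply (continuous_comp _ (fun x => x ^ 2)); try apply S;
      [apply continuous_fst|apply continuous_snd].
  - apply continuous_sqrt.
Qed.

Lemma cwithin_comp_C (I : R -> Prop) (g : R -> C) (h : C -> R) (t : R) :
  cwithin I (fun s => Re (g s)) t -> cwithin I (fun s => Im (g s)) t -> continuous h (g t) ->
  cwithin I (fun s => h (g s)) t.
Proof.
  intros H1 H2 H3.
  assert (K := cwithin_comp2 I (fun s => Re (g s)) (fun s => Im (g s)) h t H1 H2).
  assert (E : forall s, (Re (g s), Im (g s)) = g s) by (intros s; symmetry; apply surjective_pairing).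
  rewrite <- (E t) in H3; specialize (K H3).
  intros eps Heps; destruct (K eps Heps) as [d [Hd L]]; exists d; split; [exact Hd|].
  intros s Hs Hst; specialize (L s Hs Hst); rewrite !E in L; exact L.
Qed.

Definition integrand (rho : C -> R) (g : R -> C) (t : R) : R :=
  rho (g t) * Cmod (Derive (fun s => Re (g s)) t, Derive (fun s => Im (g s)) t).

Lemma integrand_ext (rho : C -> R) (g h : R -> C) (a b : R) :
  (forall t, a < t < b -> g t = h t) -> forall t, a < t < b -> integrand rho g t = integrand rho h t.
Proof.
  intros H t Ht; unfold integrand; rewrite (H t Ht); do 2 f_equal.
  assert (L : locally t (fun s => g s = h s)).
  { assert (Hd : 0 < Rmin (t - a) (b - t)) by (apply Rmin_pos; lra).
    exists (mkposreal _ Hd); intros y Hy; change (Rabs (y - t) < Rmin (t - a) (b - t)) in Hy.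
    assert (A := lt_Rmin_l Hy); assert (B := lt_Rmin_r Hy).
    apply Rabs_def2 in A; apply Rabs_def2 in B; apply H; lra. }
  f_equal; apply Derive_ext_loc; revert L; apply filter_imp; intros s Hs; rewrite Hs; reflexivity.
Qed.

Lemma rho_length_ext (rho : C -> R) (g h : R -> C) (a b : R) : a <= b ->
  (forall t, a < t < b -> g t = h t) -> rho_length rho g a b = rho_length rho h a b.
Proof.
  intros Hab H; apply RInt_ext; intros t Ht; rewrite Rmin_left, Rmax_right in Ht by lra.
  exact (integrand_ext rho g h a b H t Ht).
Qed.

Section Paths.

Variables (D : C -> Prop) (rho : C -> R).
Hypothesis Hrho : forall w, D w -> continuous rho w.
Hypothesis Hpos : forall w, D w -> 0 < rho w.

Definition arc (g dg : R -> C) (a b : R) : Prop :=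
  a < b /\ C1_path_on (fun s => a <= s <= b) g dg /\ forall t, a <= t <= b -> D (g t).

(** In contrast with [integrand], it takes the derivative from [dg], which is one-sided at the ends,
    so that it is continuous up to the endpoints. On an arc the two agree in the interior and have
    the same integral. *)
Definition speed (g dg : R -> C) (t : R) : R := rho (g t) * Cmod (dg t).

Lemma speed_cwithin (I : R -> Prop) (g dg : R -> C) (t : R) :
  C1_path_on I g dg -> I t -> D (g t) -> cwithin I (speed g dg) t.
Proof.
  intros H Ht HD; destruct (proj1 (C1_path_eps _ _ _) H t Ht) as (H1 & H2 & H3 & H4).
  apply dwithin_cwithin in H1; apply dwithin_cwithin in H2.
  apply cwithin_mult.
  - apply cwithin_comp_C; auto.
  - apply cwithin_comp_C; auto; apply continuous_Cmod.
Qed.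

Lemma integrand_speed (g dg : R -> C) (a b : R) :
  C1_path_on (fun s => a <= s <= b) g dg -> forall t, a < t < b -> integrand rho g t = speed g dg t.
Proof.
  intros H t Ht.
  destruct (proj1 (C1_path_eps _ _ _) H t ltac:(lra)) as (H1 & H2 & _).
  unfold integrand, speed; do 2 f_equal.
  rewrite (surjective_pairing (dg t)); f_equal; apply is_derive_unique;
    eapply dwithin_is_derive; try eassumption; apply seg_int_locally; exact Ht.
Qed.

Lemma arc_ex_speed (g dg : R -> C) (a b : R) : arc g dg a b -> ex_RInt (speed g dg) a b.
Proof.
  intros (Hab & Hg & HD).
  apply (cwithin_ex_RInt (fun s => a <= s <= b)); [apply seg_int_convex| |lra|lra].
  intros t Ht; apply speed_cwithin; auto.
Qed.

Lemma arc_ex_integrand (g dg : R -> C) (a b : R) : arc g dg a b -> ex_RInt (integrand rho g) a b.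
Proof.
  intros H; apply (ex_RInt_ext (speed g dg)); [|apply arc_ex_speed; exact H].
  destruct H as (Hab & Hg & HD); intros t Ht; rewrite Rmin_left, Rmax_right in Ht by lra.
  symmetry; apply (integrand_speed g dg a b); assumption.
Qed.

Lemma arc_rho_length (g dg : R -> C) (a b : R) : arc g dg a b ->
  rho_length rho g a b = RInt (speed g dg) a b.
Proof.
  intros (Hab & Hg & HD); apply RInt_ext; intros t Ht; rewrite Rmin_left, Rmax_right in Ht by lra.
  exact (integrand_speed g dg a b Hg t Ht).
Qed.

Lemma arc_length_nonneg (g dg : R -> C) (a b : R) : arc g dg a b -> 0 <= rho_length rho g a b.
Proof.
  intros H; rewrite (arc_rho_length g dg) by exact H.
  apply RInt_ge_0; [destruct H; lra|apply arc_ex_speed; exact H|].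
  destruct H as (Hab & Hg & HD); intros t Ht; apply Rmult_le_pos; [left; apply Hpos, HD; lra|apply Cmod_ge_0].
Qed.

Lemma arc_shift (g dg : R -> C) (a b c : R) : arc g dg a b ->
  arc (fun s => g (1 * s + c)) (fun s => (1 * Re (dg (1 * s + c)), 1 * Im (dg (1 * s + c)))) (a - c) (b - c)
  /\ rho_length rho (fun s => g (1 * s + c)) (a - c) (b - c) = rho_length rho g a b.
Proof.
  intros H; assert (HA : arc (fun s => g (1 * s + c))
    (fun s => (1 * Re (dg (1 * s + c)), 1 * Im (dg (1 * s + c)))) (a - c) (b - c)).
  { destruct H as (Hab & Hg & HD); split; [lra|split].
    - apply (C1_path_mono (fun s => a <= 1 * s + c <= b)); [intros; lra|].
      apply (C1_path_affine (fun s => a <= s <= b)); [lra|exact Hg].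
    - intros t Ht; apply HD; lra. }
  split; [exact HA|].
  rewrite (arc_rho_length _ _ _ _ HA), (arc_rho_length _ _ _ _ H).
  replace (RInt (speed g dg) a b) with (RInt (speed g dg) (1 * (a - c) + c) (1 * (b - c) + c))
    by (f_equal; ring).
  rewrite <- (RInt_comp_lin (V := R_CompleteNormedModule)).
  - apply RInt_ext; intros t _; unfold speed, scal; simpl; unfold mult; simpl.
    rewrite !Rmult_1_l; rewrite <- surjective_pairing; reflexivity.
  - replace (1 * (a - c) + c) with a by ring; replace (1 * (b - c) + c) with b by ring.
    apply arc_ex_speed; exact H.
Qed.

Lemma arc_rev (g dg : R -> C) (a b : R) : arc g dg a b ->
  arc (fun s => g (-1 * s + 0)) (fun s => (-1 * Re (dg (-1 * s + 0)), -1 * Im (dg (-1 * s + 0)))) (- b) (- a)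
  /\ rho_length rho (fun s => g (-1 * s + 0)) (- b) (- a) = rho_length rho g a b.
Proof.
  intros H; assert (HA : arc (fun s => g (-1 * s + 0))
    (fun s => (-1 * Re (dg (-1 * s + 0)), -1 * Im (dg (-1 * s + 0)))) (- b) (- a)).
  { destruct H as (Hab & Hg & HD); split; [lra|split].
    - apply (C1_path_mono (fun s => a <= -1 * s + 0 <= b)); [intros; lra|].
      apply (C1_path_affine (fun s => a <= s <= b)); [lra|exact Hg].
    - intros t Ht; apply HD; lra. }
  split; [exact HA|].
  rewrite (arc_rho_length _ _ _ _ HA), (arc_rho_length _ _ _ _ H).
  assert (HE := arc_ex_speed _ _ _ _ H).
  rewrite <- (opp_RInt_swap (V := R_CompleteNormedModule) (speed g dg) b a) by (apply ex_RInt_swap; exact HE).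
  replace (RInt (speed g dg) b a) with (RInt (speed g dg) (-1 * (- b) + 0) (-1 * (- a) + 0))
    by (f_equal; ring).
  rewrite <- (RInt_comp_lin (V := R_CompleteNormedModule)).
  - rewrite <- (RInt_opp (V := R_CompleteNormedModule)).
    + apply RInt_ext; intros t _; unfold speed, scal, opp; simpl; unfold mult; simpl.
      replace (-1 * Re (dg (-1 * t + 0)), -1 * Im (dg (-1 * t + 0))) with (- dg (-1 * t + 0)%R)%C
        by (unfold Copp; f_equal; unfold Re, Im; ring).
      rewrite Cmod_opp; ring.
    + apply (ex_RInt_comp_lin (V := R_NormedModule)).
      replace (-1 * - b + 0) with b by ring; replace (-1 * - a + 0) with a by ring.
      apply ex_RInt_swap; exact HE.
  - replace (-1 * - b + 0) with b by ring; replace (-1 * - a + 0) with a by ring.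
    apply ex_RInt_swap; exact HE.
Qed.

Definition pathlen (w1 w2 : C) (l : R) : Prop :=
  exists (g : R -> C) (a b : R), joins_in D g a b w1 w2 /\ l = rho_length rho g a b.

Lemma partition_mono (t : nat -> R) (n : nat) : (forall i, (i < n)%nat -> t i < t (S i)) ->
  forall i j, (i <= j <= n)%nat -> t i <= t j.
Proof.
  intros H i j [Hij Hjn]; induction Hij as [|j Hij IH]; [lra|].
  apply Rle_trans with (t j); [apply IH; lia|left; apply H; lia].
Qed.

(** Induction over the [C^1] pieces of a path, with [Q] a relation between the point reached and the
    length covered. Even for a trivial [Q] it yields [a <= b] and integrability. *)
Lemma path_pieces (Q : C -> R -> Prop) (w1 : C) : Q w1 0 ->
  (forall g dg a b l, arc g dg a b -> Q (g a) l -> Q (g b) (l + rho_length rho g a b)) ->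
  forall g a b w2, joins_in D g a b w1 w2 ->
  a <= b /\ ex_RInt (integrand rho g) a b /\ Q w2 (rho_length rho g a b).
Proof.
  intros H0 Hs g a b w2 ((n & t & Ha & Hb & Ht) & HD & Hg1 & Hg2).
  assert (M := partition_mono t n (fun i Hi => proj1 (Ht i Hi))).
  assert (K : forall i, (i <= n)%nat ->
     ex_RInt (integrand rho g) (t 0%nat) (t i) /\ Q (g (t i)) (rho_length rho g (t 0%nat) (t i))).
  { induction i as [|i IH]; intros Hi.
    - split; [apply ex_RInt_point|]; rewrite Ha, Hg1.
      unfold rho_length; rewrite RInt_point; exact H0.
    - destruct (IH ltac:(lia)) as [E1 E2]; destruct (Ht i ltac:(lia)) as [Hlt [dg Hdg]].
      assert (HA : arc g dg (t i) (t (S i))).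
      { split; [exact Hlt|split; [exact Hdg|]]; intros s Hs'; apply HD.
        assert (t 0%nat <= t i) by (apply M; lia); assert (t (S i) <= t n) by (apply M; lia); lra. }
      assert (E3 := arc_ex_integrand _ _ _ _ HA).
      split; [apply ex_RInt_Chasles with (t i); assumption|].
      unfold rho_length; rewrite <- (RInt_Chasles (V := R_CompleteNormedModule) _ _ (t i)) by assumption.
      apply (Hs g dg); assumption. }
  destruct (K n (Nat.le_refl n)) as [E1 E2]; rewrite Ha, Hb in *; rewrite Hg2 in E2.
  split; [rewrite <- Ha, <- Hb; apply M; lia|split; assumption].
Qed.

Lemma pathlen_ind (Q : C -> R -> Prop) (w1 : C) : Q w1 0 ->
  (forall g dg a b l, arc g dg a b -> Q (g a) l -> Q (g b) (l + rho_length rho g a b)) ->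
  forall w2 l, pathlen w1 w2 l -> Q w2 l.
Proof.
  intros H0 Hs w2 l (g & a & b & Hj & ->).
  apply (path_pieces Q w1 H0 Hs g a b w2 Hj).
Qed.

Lemma pathlen_nonneg (w1 w2 : C) (l : R) : pathlen w1 w2 l -> 0 <= l.
Proof.
  apply (pathlen_ind (fun _ l => 0 <= l) w1); [lra|].
  intros g dg a b l' H; generalize (arc_length_nonneg _ _ _ _ H); lra.
Qed.

Lemma pathlen_refl (w : C) : D w -> pathlen w w 0.
Proof.
  intros Hw; exists (fun _ => w), 0, 0; split.
  - split; [|split; [intros; exact Hw|split; reflexivity]].
    exists 0%nat, (fun _ => 0); split; [reflexivity|split; [reflexivity|]]; intros i Hi; lia.
  - unfold rho_length; rewrite RInt_point; reflexivity.
Qed.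

(** The arc is translated in its parameter so as to start at the end [B] of the first path; length
    does not depend on this, and the two pieces are pasted at [B]. *)
Lemma pathlen_append (w1 : C) (l : R) (g dg : R -> C) (a b : R) :
  arc g dg a b -> pathlen w1 (g a) l -> pathlen w1 (g b) (l + rho_length rho g a b).
Proof.
  intros HA (p & A & B & Hp & ->).
  destruct (path_pieces (fun _ _ => True) w1 I (fun _ _ _ _ _ _ _ => I) p A B _ Hp) as (HAB & EP & _).
  destruct (arc_shift g dg a b (a - B) HA) as [HS HL].
  replace (a - (a - B)) with B in HS, HL by ring.
  set (E := b - (a - B)) in *.
  set (q := fun s => g (1 * s + (a - B))) in *.
  set (dq := fun s => (1 * Re (dg (1 * s + (a - B))), 1 * Im (dg (1 * s + (a - B))))) in *.
  assert (Hq : q B = g a) by (unfold q; f_equal; ring).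
  assert (HqE : q E = g b) by (unfold q, E; f_equal; ring).
  destruct Hp as ((n & t & Ha & Hb & Ht) & HD & Hg1 & Hg2).
  set (h := fun s => if Rle_dec s B then p s else q s).
  assert (h1 : forall s, s <= B -> h s = p s) by (intros s Hs; unfold h; destruct Rle_dec; [reflexivity|lra]).
  assert (h2 : forall s, B <= s -> h s = q s).
  { intros s Hs; unfold h; destruct Rle_dec; [|reflexivity].
    assert (s = B) as -> by lra; rewrite Hg2, Hq; reflexivity. }
  assert (HBE : B < E) by exact (proj1 HS).
  assert (M := partition_mono t n (fun i Hi => proj1 (Ht i Hi))).
  exists h, A, E; split.
  - split; [|split; [|split]].
    (* The partition of the first path gets one more point, [E], at index [n + 1]. *)
    + exists (S n), (fun i => if Nat.leb i n then t i else E).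
      split; [exact Ha|split].
      * replace (Nat.leb (S n) n) with false by (symmetry; apply Nat.leb_gt; lia); reflexivity.
      * intros i Hi.
        replace (Nat.leb i n) with true by (symmetry; apply Nat.leb_le; lia).
        destruct (Nat.eq_dec i n) as [->|Hne].
        -- replace (Nat.leb (S n) n) with false by (symmetry; apply Nat.leb_gt; lia).
           rewrite Hb; split; [exact HBE|]; exists dq.
           apply (C1_path_ext _ q); [|exact (proj1 (proj2 HS))].
           intros s Hs; symmetry; apply h2; lra.
        -- replace (Nat.leb (S i) n) with true by (symmetry; apply Nat.leb_le; lia).
           destruct (Ht i ltac:(lia)) as [Hlt [dp Hdp]]; split; [exact Hlt|]; exists dp.
           apply (C1_path_ext _ p); [|exact Hdp].
           intros s Hs; symmetry; apply h1.
           assert (t (S i) <= t n) by (apply M; lia); lra.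
    + intros s Hs; destruct (Rle_dec s B) as [Hle|Hgt].
      * rewrite h1 by exact Hle; apply HD; lra.
      * rewrite h2 by lra; apply HS; lra.
    + rewrite h1 by lra; exact Hg1.
    + rewrite h2 by lra; exact HqE.
  - assert (E1 : forall s, A < s < B -> integrand rho p s = integrand rho h s).
    { apply integrand_ext; intros s Hs; symmetry; apply h1; lra. }
    assert (E2 : forall s, B < s < E -> integrand rho q s = integrand rho h s).
    { apply integrand_ext; intros s Hs; symmetry; apply h2; lra. }
    rewrite <- HL, (rho_length_ext rho p h A B), (rho_length_ext rho q h B E);
      [|lra|intros s Hs; symmetry; apply h2; lra|lra|intros s Hs; symmetry; apply h1; lra].
    apply (RInt_Chasles (V := R_CompleteNormedModule) (integrand rho h)).
    + apply (ex_RInt_ext (integrand rho p)); [|exact EP].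
      intros s Hs; rewrite Rmin_left, Rmax_right in Hs by lra; auto.
    + apply (ex_RInt_ext (integrand rho q)); [|exact (arc_ex_integrand _ _ _ _ HS)].
      intros s Hs; rewrite Rmin_left, Rmax_right in Hs by lra; auto.
Qed.

Lemma pathlen_end (w1 w2 : C) (l : R) : pathlen w1 w2 l -> D w1 /\ D w2.
Proof.
  intros (p & A & B & Hp & _).
  destruct (path_pieces (fun _ _ => True) w1 I (fun _ _ _ _ _ _ _ => I) p A B _ Hp) as (HAB & _ & _).
  destruct Hp as (_ & HD & <- & <-); split; apply HD; lra.
Qed.

Lemma pathlen_trans (w1 w2 w3 : C) (l m : R) :
  pathlen w1 w2 l -> pathlen w2 w3 m -> pathlen w1 w3 (l + m).
Proof.
  intros H; apply (pathlen_ind (fun w m => pathlen w1 w (l + m)) w2).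
  - rewrite Rplus_0_r; exact H.
  - intros g dg a b l' HA Hl; rewrite <- Rplus_assoc; apply (pathlen_append _ _ g dg); assumption.
Qed.

Lemma pathlen_arc (g dg : R -> C) (a b : R) : arc g dg a b ->
  pathlen (g a) (g b) (rho_length rho g a b).
Proof.
  intros H; rewrite <- (Rplus_0_l (rho_length rho g a b)); apply (pathlen_append _ _ g dg); [exact H|].
  apply pathlen_refl; destruct H as (Hab & _ & HD); apply HD; lra.
Qed.

(** By induction over the pieces: each new arc is reversed and placed in front of the reversal
    obtained so far. *)
Lemma pathlen_sym (w1 w2 : C) (l : R) : pathlen w1 w2 l -> pathlen w2 w1 l.
Proof.
  intros H; generalize (pathlen_end _ _ _ H); intros [Hw1 _]; revert w2 l H.
  apply (pathlen_ind (fun w l => pathlen w w1 l) w1); [apply pathlen_refl; exact Hw1|].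
  intros g dg a b l HA Hl; destruct (arc_rev g dg a b HA) as [HR HL].
  assert (HP := pathlen_arc _ _ _ _ HR); rewrite HL in HP; simpl in HP.
  replace (-1 * - b + 0) with b in HP by ring; replace (-1 * - a + 0) with a in HP by ring.
  rewrite Rplus_comm; apply pathlen_trans with (g a); assumption.
Qed.

(** [real] sends the infinite values to 0, so [rho_dist] is an infimum only when that infimum is
    finite: lengths are nonnegative, and at least one path exists. *)
Lemma rho_dist_glb (w1 w2 : C) : (exists l, pathlen w1 w2 l) ->
  0 <= rho_dist D rho w1 w2 /\
  (forall l, pathlen w1 w2 l -> rho_dist D rho w1 w2 <= l) /\
  (forall eps, 0 < eps -> exists l, pathlen w1 w2 l /\ l < rho_dist D rho w1 w2 + eps).
Proof.
  intros [l0 Hl0].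
  destruct (Glb_Rbar_correct (pathlen w1 w2)) as [H1 H2].
  assert (B0 : Rbar_le 0 (Glb_Rbar (pathlen w1 w2))).
  { apply H2; intros l Hl; simpl; exact (pathlen_nonneg _ _ _ Hl). }
  assert (B1 := H1 l0 Hl0).
  change (rho_dist D rho w1 w2) with (real (Glb_Rbar (pathlen w1 w2))).
  destruct (Glb_Rbar (pathlen w1 w2)) as [d| |]; simpl in B0, B1 |- *; try contradiction.
  split; [exact B0|split].
  - intros l Hl; exact (H1 l Hl).
  - intros eps Heps; apply NNPP; intros Hn.
    assert (Hlb : Rbar_le (d + eps) d).
    { apply H2; intros l Hl; simpl; apply Rnot_lt_le; intros Hlt; apply Hn; exists l; split; assumption. }
    simpl in Hlb; lra.
Qed.

Definition segment (w1 w2 : C) (t : R) : C :=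
  (Re w1 + t * (Re w2 - Re w1), Im w1 + t * (Im w2 - Im w1)).

Lemma segment_arc (w1 w2 : C) : (forall t, 0 <= t <= 1 -> D (segment w1 w2 t)) ->
  arc (segment w1 w2) (fun _ => (w2 - w1)%C) 0 1.
Proof.
  intros H; split; [lra|split; [|exact H]].
  apply C1_path_eps; intros t Ht.
  assert (Cst : forall c : R, cwithin (fun s => 0 <= s <= 1) (fun _ => c) t).
  { intros c eps Heps; exists 1; split; [lra|]; intros; rewrite Rminus_diag, Rabs_R0; exact Heps. }
  split; [|split; [|split; apply Cst]]; intros eps Heps; exists 1; (split; [lra|]); intros s Hs Hst;
    destruct w1 as [x1 y1], w2 as [x2 y2]; unfold segment; simpl;
    match goal with |- Rabs ?e <= _ => replace e with 0 by (unfold Re, Im; simpl; ring) end;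
    rewrite Rabs_R0; apply Rmult_le_pos; [lra|apply Rabs_pos|lra|apply Rabs_pos].
Qed.

Lemma segment_0 (w1 w2 : C) : segment w1 w2 0 = w1.
Proof. destruct w1, w2; unfold segment, Re, Im; simpl; f_equal; ring. Qed.

Lemma segment_1 (w1 w2 : C) : segment w1 w2 1 = w2.
Proof. destruct w1, w2; unfold segment, Re, Im; simpl; f_equal; ring. Qed.

Lemma pathlen_segment (w1 w2 : C) : (forall t, 0 <= t <= 1 -> D (segment w1 w2 t)) ->
  pathlen w1 w2 (rho_length rho (segment w1 w2) 0 1).
Proof.
  intros H; assert (K := pathlen_arc _ _ _ _ (segment_arc w1 w2 H)).
  rewrite segment_0, segment_1 in K; exact K.
Qed.

Lemma convex_combination_lt (x y z d t : R) : 0 <= t <= 1 ->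
  Rabs (x - z) < d -> Rabs (y - z) < d -> Rabs (x + t * (y - x) - z) < d.
Proof.
  intros Ht H1 H2; apply Rabs_def2 in H1; apply Rabs_def2 in H2.
  assert (0 <= t * (d - (y - z)) /\ 0 <= (1 - t) * (d - (x - z))) by (split; apply Rmult_le_pos; lra).
  assert (0 <= t * (d + (y - z)) /\ 0 <= (1 - t) * (d + (x - z))) by (split; apply Rmult_le_pos; lra).
  destruct (Req_dec t 0) as [->|E]; [apply Rabs_def1; lra|].
  assert (0 < t * (d - (y - z)) /\ 0 < t * (d + (y - z))) by (split; apply Rmult_lt_0_compat; lra).
  apply Rabs_def1; lra.
Qed.

Lemma segment_box (z w1 w2 : C) (d t : R) : 0 <= t <= 1 ->
  Rabs (Re w1 - Re z) < d -> Rabs (Im w1 - Im z) < d ->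
  Rabs (Re w2 - Re z) < d -> Rabs (Im w2 - Im z) < d ->
  Rabs (Re (segment w1 w2 t) - Re z) < d /\ Rabs (Im (segment w1 w2 t) - Im z) < d.
Proof.
  intros Ht H1 H2 H3 H4; split; apply convex_combination_lt; assumption.
Qed.

Hypothesis Hdom : planar_domain D.

(** Near each point of [D] one can move along segments inside a box. Hence the points that can be
    joined to [w1] and those that cannot form two disjoint open sets, and connectedness excludes the
    second. *)
Lemma pathlen_exists (w1 w2 : C) : D w1 -> D w2 -> exists l, pathlen w1 w2 l.
Proof.
  intros H1 H2; destruct Hdom as (Hopen & _ & Hconn).
  apply NNPP; intros Hn.
  assert (Hnear : forall z, D z -> locally z (fun w => D w /\ exists l, pathlen z w l)).
  { intros z Hz; destruct (proj1 (locally_box z D) (Hopen z Hz)) as [d [Hd Hb]].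
    apply locally_box; exists d; split; [exact Hd|]; intros w Hw1 Hw2; split; [apply Hb; assumption|].
    eexists; apply pathlen_segment; intros t Ht.
    destruct (segment_box z z w d t Ht) as [A B]; try assumption;
      try (rewrite Rminus_diag, Rabs_R0; exact Hd).
    apply Hb; assumption. }
  destruct (Hconn (fun w => D w /\ exists l, pathlen w1 w l)
                  (fun w => D w /\ ~ exists l, pathlen w1 w l)) as [z (_ & [_ Hz1] & [_ Hz2])].
  - intros z [Hz [l Hl]]; generalize (Hnear z Hz); apply filter_imp.
    intros w [Hw [m Hm]]; split; [exact Hw|]; exists (l + m); apply pathlen_trans with z; assumption.
  - intros z [Hz Hz']; generalize (Hnear z Hz); apply filter_imp.
    intros w [Hw [m Hm]]; split; [exact Hw|]; intros [l Hl]; apply Hz'.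
    exists (l + m); apply pathlen_trans with w; [exact Hl|apply pathlen_sym; exact Hm].
  - intros z Hz; destruct (classic (exists l, pathlen w1 z l)); [left|right]; split; assumption.
  - exists w1; split; [exact H1|split; [exact H1|]]; exists 0; apply pathlen_refl; exact H1.
  - exists w2; split; [exact H2|split; assumption].
  - contradiction.
Qed.

Lemma rho_dist_nonneg (w1 w2 : C) : D w1 -> D w2 -> 0 <= rho_dist D rho w1 w2.
Proof. intros H1 H2; apply (rho_dist_glb w1 w2 (pathlen_exists w1 w2 H1 H2)). Qed.

Lemma rho_dist_le (w1 w2 : C) (l : R) : pathlen w1 w2 l -> rho_dist D rho w1 w2 <= l.
Proof. intros H; apply (rho_dist_glb w1 w2 (ex_intro _ l H)); exact H. Qed.

Lemma rho_dist_approx (w1 w2 : C) (eps : R) : D w1 -> D w2 -> 0 < eps ->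
  exists l, pathlen w1 w2 l /\ l < rho_dist D rho w1 w2 + eps.
Proof. intros H1 H2; apply (rho_dist_glb w1 w2 (pathlen_exists w1 w2 H1 H2)). Qed.

Lemma rho_dist_triangle (w1 w2 w3 : C) : D w1 -> D w2 -> D w3 ->
  rho_dist D rho w1 w3 <= rho_dist D rho w1 w2 + rho_dist D rho w2 w3.
Proof.
  intros H1 H2 H3; apply le_epsilon; intros eps Heps.
  destruct (rho_dist_approx w1 w2 (eps / 2) H1 H2) as [l [Hl Hl']]; [lra|].
  destruct (rho_dist_approx w2 w3 (eps / 2) H2 H3) as [m [Hm Hm']]; [lra|].
  assert (K := rho_dist_le _ _ _ (pathlen_trans _ _ _ _ _ Hl Hm)); lra.
Qed.

Lemma rho_dist_sym (w1 w2 : C) : D w1 -> D w2 -> rho_dist D rho w1 w2 = rho_dist D rho w2 w1.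
Proof.
  assert (K : forall w1 w2, D w1 -> D w2 -> rho_dist D rho w1 w2 <= rho_dist D rho w2 w1).
  { intros v1 v2 H1 H2; apply le_epsilon; intros eps Heps.
    destruct (rho_dist_approx v2 v1 eps H2 H1 Heps) as [l [Hl Hl']].
    assert (B := rho_dist_le _ _ _ (pathlen_sym _ _ _ Hl)); lra. }
  intros H1 H2; apply Rle_antisym; apply K; assumption.
Qed.

Lemma rho_dist_arc (g dg : R -> C) (a b : R) : arc g dg a b ->
  rho_dist D rho (g a) (g b) <= rho_length rho g a b.
Proof. intros H; apply rho_dist_le, (pathlen_arc g dg); exact H. Qed.

Lemma rho_dist_segment (w1 w2 : C) (M : R) :
  (forall t, 0 <= t <= 1 -> D (segment w1 w2 t) /\ rho (segment w1 w2 t) <= M) ->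
  rho_dist D rho w1 w2 <= M * Cmod (w2 - w1)%C.
Proof.
  intros H; assert (HA : arc (segment w1 w2) (fun _ => (w2 - w1)%C) 0 1)
    by (apply segment_arc; intros t Ht; apply H; exact Ht).
  assert (K := rho_dist_arc _ _ _ _ HA); rewrite segment_0, segment_1 in K.
  apply Rle_trans with (1 := K); rewrite (arc_rho_length _ _ _ _ HA).
  replace (M * Cmod (w2 - w1)%C) with ((1 - 0) * (M * Cmod (w2 - w1)%C)) by ring.
  eapply Rle_trans; [apply Rle_abs|]; apply abs_RInt_le_const; [lra|apply arc_ex_speed; exact HA|].
  intros t Ht; unfold speed; destruct (H t Ht) as [H1 H2].
  rewrite Rabs_mult, (Rabs_pos_eq (Cmod _)) by apply Cmod_ge_0.
  rewrite (Rabs_pos_eq (rho _)) by (left; apply Hpos; exact H1).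
  apply Rmult_le_compat_r; [apply Cmod_ge_0|exact H2].
Qed.

End Paths.

(** * First variation of length *)

Lemma le_of_perturbation (X A K : R) : 0 <= K ->
  (forall d, 0 < d <= 1 -> X <= A + K * d) -> X <= A.
Proof.
  intros HK H; apply Rnot_lt_le; intros Hlt.
  set (d := Rmin 1 ((X - A) / (2 * (K + 1)))).
  assert (Hd : 0 < d) by (apply Rmin_pos; [lra|apply Rdiv_lt_0_compat; lra]).
  assert (Hd1 : d <= 1) by apply Rmin_l.
  assert (Hd2 : d <= (X - A) / (2 * (K + 1))) by apply Rmin_r.
  assert (B := H d (conj Hd Hd1)).
  assert (K * d <= (X - A) / 2).
  { apply Rle_trans with ((K + 1) * d); [nra|].
    apply Rle_trans with ((K + 1) * ((X - A) / (2 * (K + 1)))); [apply Rmult_le_compat_l; lra|].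
    right; field; lra. }
  lra.
Qed.

Lemma is_derive_min (f : R -> R) (x l : R) :
  is_derive f x l -> (forall y, f x <= f y) -> l = 0.
Proof.
  intros H Hmin; destruct (Req_dec l 0) as [E|E]; [exact E|exfalso].
  assert (Hp : 0 < Rabs l) by (apply Rabs_pos_lt; exact E).
  destruct (proj1 (is_derive_eps f x l) H (Rabs l / 2)) as [d [Hd K]]; [lra|].
  set (h := - (d / 2) * sign l).
  assert (Hl : l * sign l = Rabs l).
  { destruct (Rlt_dec 0 l); [rewrite sign_eq_1, Rabs_pos_eq; lra|].
    rewrite sign_eq_m1, Rabs_left; lra. }
  assert (Hs : Rabs (sign l) = 1).
  { destruct (Rlt_dec 0 l); [rewrite sign_eq_1, Rabs_pos_eq; lra|].
    rewrite sign_eq_m1, Rabs_left; lra. }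
  assert (Hh : Rabs h = d / 2) by (unfold h; rewrite Rabs_mult, Hs, Rabs_left; lra).
  assert (K' := K (x + h)); replace (x + h - x) with h in K' by ring; rewrite Hh in K'.
  specialize (K' ltac:(lra)); apply Rabs_le_between in K'.
  assert (B := Hmin (x + h)).
  assert (Hlh : l * h = - (d / 2) * Rabs l) by (unfold h; rewrite <- Hl; ring).
  nra.
Qed.

Lemma Cmod_pair (x y : R) : Cmod (x, y) = sqrt (x ^ 2 + y ^ 2).
Proof. reflexivity. Qed.

Lemma Cmod_pair_le (x y m : R) : Rabs x <= m -> Rabs y <= m -> Cmod (x, y) <= 2 * m.
Proof.
  intros Hx Hy; assert (0 <= m) by (generalize (Rabs_pos x); lra).
  rewrite Cmod_pair; apply Rabs_le_between in Hx; apply Rabs_le_between in Hy.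
  rewrite <- (sqrt_pow2 (2 * m)) by lra; apply sqrt_le_1_alt; nra.
Qed.

Lemma C_neq_0_sqr (w : C) : w <> 0%C -> 0 < Re w ^ 2 + Im w ^ 2.
Proof. intros H; rewrite <- Cmod2_alt; apply pow_lt, Cmod_gt_0; exact H. Qed.

Lemma dwithin_plus_const (I : R -> Prop) (G : R -> R) (t l c : R) :
  dwithin I G t l -> dwithin I (fun s => G s + c) t l.
Proof.
  intros H eps Heps; destruct (H eps Heps) as [d [Hd K]]; exists d; split; [exact Hd|].
  intros s Hs Hst; replace (G s + c - (G t + c) - l * (s - t)) with (G s - G t - l * (s - t)) by ring.
  apply K; assumption.
Qed.

Section Geodesic.

Variables (D : C -> Prop) (rho : C -> R) (I : R -> Prop) (g dg : R -> C).
Hypothesis Hdom : planar_domain D.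
Hypothesis Hmetric : conformal_metric D rho.
Hypothesis HI : convex_set I.
Hypothesis Hg : C1_path_on I g dg.
Hypothesis Hreg : forall t, I t -> dg t <> 0%C.
Hypothesis HgD : forall t, I t -> D (g t).
Hypothesis Hgeo : forall s t, I s -> I t -> s <= t ->
  rho_dist D rho (g s) (g t) = rho_length rho g s t.

Let Hopen : open D := proj1 Hdom.
Let rx := partial_x rho.
Let ry := partial_y rho.

Lemma metric_grad (w : C) : D w -> grad_at rho w (rx w) (ry w).
Proof. intros Hw; apply (C1_on_grad D); [exact Hopen|exact (proj2 Hmetric)|exact Hw]. Qed.

Lemma metric_continuous (w : C) : D w -> continuous rho w.
Proof. intros Hw; eapply grad_continuous; apply metric_grad; exact Hw. Qed.

Lemma metric_pos (w : C) : D w -> 0 < rho w.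
Proof. apply (proj1 Hmetric). Qed.

Lemma metric_continuous_x (w : C) : D w -> continuous rx w.
Proof. intros Hw; exact (proj1 (proj2 (proj2 (proj2 Hmetric w Hw)))). Qed.

Lemma metric_continuous_y (w : C) : D w -> continuous ry w.
Proof. intros Hw; exact (proj2 (proj2 (proj2 (proj2 Hmetric w Hw)))). Qed.

Let speed_g := speed rho g dg.

Lemma path_components (t : R) : I t ->
  dwithin I (fun s => Re (g s)) t (Re (dg t)) /\ dwithin I (fun s => Im (g s)) t (Im (dg t)) /\
  cwithin I (fun s => Re (dg s)) t /\ cwithin I (fun s => Im (dg s)) t.
Proof. intros Ht; exact (proj1 (C1_path_eps I g dg) Hg t Ht). Qed.

Lemma speed_g_cwithin (t : R) : I t -> cwithin I speed_g t.
Proof. intros Ht; apply (speed_cwithin D); auto using metric_continuous. Qed.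

Lemma sub_arc (a b : R) : I a -> I b -> a < b -> arc D g dg a b.
Proof.
  intros Ha Hb Hab; split; [exact Hab|split].
  - apply (C1_path_mono I); [|exact Hg]; intros t Ht; apply (HI a b); assumption.
  - intros t Ht; apply HgD, (HI a b); assumption.
Qed.

Lemma speed_g_ex_RInt (a b : R) : I a -> I b -> ex_RInt speed_g a b.
Proof. intros; apply (cwithin_ex_RInt I); auto using speed_g_cwithin. Qed.

Lemma geodesic_dist (a b : R) : I a -> I b -> a <= b ->
  rho_dist D rho (g a) (g b) = RInt speed_g a b.
Proof.
  intros Ha Hb Hab; rewrite Hgeo by assumption.
  destruct (Req_dec a b) as [->|Hne].
  - unfold rho_length; rewrite !RInt_point; reflexivity.
  - apply (arc_rho_length D), sub_arc; lra || assumption.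
Qed.

Lemma near_segment_cost (z : C) (d : R) : D z -> 0 < d ->
  exists e, 0 < e /\ forall w1 w2,
    Rabs (Re w1 - Re z) < e -> Rabs (Im w1 - Im z) < e ->
    Rabs (Re w2 - Re z) < e -> Rabs (Im w2 - Im z) < e ->
    rho_dist D rho w1 w2 <= (rho z + d) * Cmod (w2 - w1)%C /\ D w1 /\ D w2.
Proof.
  intros Hz Hd.
  destruct (proj1 (locally_box z D) (Hopen z Hz)) as [e1 [He1 K1]].
  destruct (proj1 (continuous_box rho z) (metric_continuous z Hz) d Hd) as [e2 [He2 K2]].
  exists (Rmin e1 e2); split; [apply Rmin_pos; assumption|].
  intros w1 w2 A1 A2 A3 A4; split.
  - apply rho_dist_segment; auto using metric_continuous, metric_pos.
    intros t Ht; destruct (segment_box z w1 w2 _ t Ht A1 A2 A3 A4) as [B1 B2].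
    split.
    + apply K1; eapply Rlt_le_trans; [exact B1|apply Rmin_l|exact B2|apply Rmin_l].
    + assert (K := K2 (segment w1 w2 t) (lt_Rmin_r B1)
        (lt_Rmin_r B2)); apply Rabs_def2 in K; lra.
  - split; apply K1; eapply Rlt_le_trans; try eassumption; apply Rmin_l.
Qed.

(** The derivative at [h = 0] of the length element [rho(g t + h v) |g' t|], that is, the integrand
    of the first variation under translation by [v]. *)
Definition gradW (v : C) (t : R) : R :=
  (rx (g t) * Re v + ry (g t) * Im v) * Cmod (dg t).

Lemma gradW_cwithin (v : C) (t : R) : I t -> cwithin I (gradW v) t.
Proof.
  intros Ht; destruct (path_components t Ht) as (H1 & H2 & H3 & H4).
  apply dwithin_cwithin in H1; apply dwithin_cwithin in H2.
  apply (cwithin_mult I (fun t => rx (g t) * Re v + ry (g t) * Im v)).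
  - apply (cwithin_comp_C I g (fun w => rx w * Re v + ry w * Im v)); try assumption.
    apply continuous_Rplus; (apply continuous_Rmult; [|apply continuous_const]);
      [apply metric_continuous_x|apply metric_continuous_y]; auto.
  - apply cwithin_comp_C; auto; apply continuous_Cmod.
Qed.

Definition shift (e : C) (h : R) (t : R) : C := (Re (g t) + h * Re e, Im (g t) + h * Im e).

Lemma clamped_continuous (G : R -> R) (a b : R) : I a -> I b -> a <= b ->
  (forall t, I t -> cwithin I G t) ->
  forall p : R * R, continuous (fun q : R * R => G (clamp a b (snd q))) p.
Proof.
  intros Ha Hb Hab HG p.
  apply (continuous_comp (fun q : R * R => snd q) (fun t => G (clamp a b t))); [apply continuous_snd|].
  apply (clamp_continuous I); [exact Hab|]; intros t Ht.
  assert (I t) by (apply (HI a b); assumption); auto.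
Qed.

Lemma shifted_length (a b : R) (e : C) : I a -> I b -> a < b ->
  is_derive (fun h => RInt (fun t => rho (shift e h t) * Cmod (dg t)) a b) 0 (RInt (gradW e) a b) /\
  locally 0 (fun h => forall t, a <= t <= b -> D (shift e h t)).
Proof.
  intros Ha Hb Hab.
  (* The parameter integrals ask for continuity on a neighbourhood of [[a, b]], while [g] is
     controlled on [I] only; clamping settles the case where [a] or [b] is an endpoint of [I]. *)
  set (c := clamp a b).
  assert (Hc : forall t, a <= c t <= b) by (intros t; apply clamp_in; lra).
  assert (HIc : forall t, I (c t)) by (intros t; apply (HI a b); auto).
  assert (Hcid : forall t, a <= t <= b -> c t = t) by (intros t Ht; apply clamp_id; exact Ht).
  set (sh := fun h t => shift e h (c t)).
  assert (C1 : forall p : R * R, continuous (fun q : R * R => Re (g (c (snd q)))) p).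
  { apply (clamped_continuous (fun t => Re (g t))); [assumption|assumption|lra|].
    intros t Ht; eapply dwithin_cwithin; apply (path_components t Ht). }
  assert (C2 : forall p : R * R, continuous (fun q : R * R => Im (g (c (snd q)))) p).
  { apply (clamped_continuous (fun t => Im (g t))); [assumption|assumption|lra|].
    intros t Ht; eapply dwithin_cwithin; apply (path_components t Ht). }
  assert (C3 : forall p : R * R, continuous (fun q : R * R => Cmod (dg (c (snd q)))) p).
  { apply (clamped_continuous (fun t => Cmod (dg t))); [assumption|assumption|lra|].
    intros t Ht; destruct (path_components t Ht) as (_ & _ & H3 & H4).
    apply cwithin_comp_C; auto; apply continuous_Cmod. }
  assert (Csh : forall p : R * R, continuous (fun q : R * R => sh (fst q) (snd q)) p).
  { intros p; apply continuous_pair.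
    - apply continuous_Rplus; [apply C1|apply continuous_Rmult; [apply continuous_fst|apply continuous_const]].
    - apply continuous_Rplus; [apply C2|apply continuous_Rmult; [apply continuous_fst|apply continuous_const]]. }
  assert (Hsh0 : forall t, sh 0 t = g (c t)).
  { intros t; unfold sh, shift; rewrite !Rmult_0_l, !Rplus_0_r; symmetry; apply surjective_pairing. }
  assert (HD0 : forall t, a <= t <= b -> D (sh 0 t)).
  { intros t _; rewrite Hsh0; apply HgD; apply HIc. }
  assert (Hloc : forall t, a <= t <= b -> locally (0, t) (fun q : R * R => D (sh (fst q) (snd q)))).
  { intros t Ht; apply (Csh (0, t)); apply Hopen; apply HD0; exact Ht. }
  split.
  - apply (is_derive_ext (fun h => RInt (fun t => rho (sh h t) * Cmod (dg (c t))) a b)).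
    { intros h; apply RInt_ext; intros t Ht; rewrite Rmin_left, Rmax_right in Ht by lra.
      unfold sh; rewrite Hcid by lra; reflexivity. }
    replace (RInt (gradW e) a b) with
      (RInt (fun t => (rx (sh 0 t) * Re e + ry (sh 0 t) * Im e) * Cmod (dg (c t))) a b).
    2:{ apply RInt_ext; intros t Ht; rewrite Rmin_left, Rmax_right in Ht by lra.
        unfold gradW; rewrite Hsh0, Hcid by lra; reflexivity. }
    apply (is_derive_RInt_param_cont (fun h t => rho (sh h t) * Cmod (dg (c t)))
      (fun h t => (rx (sh h t) * Re e + ry (sh h t) * Im e) * Cmod (dg (c t)))); [lra| | |].
    + intros t Ht; generalize (Hloc t Ht); apply filter_imp; intros [h s] Hs; simpl in *.
      apply is_derive_weight.
      apply (grad_curve rho (fun h => Re (g (c s)) + h * Re e) (fun h => Im (g (c s)) + h * Im e)).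
      * apply metric_grad; exact Hs.
      * apply is_derive_affine.
      * apply is_derive_affine.
    + apply param_continuous_mult.
      * apply (param_continuous_comp R_UniformSpace 0 a b D rho sh); auto using metric_continuous.
      * intros t Ht; apply filter_forall; intros p; apply C3.
    + apply param_continuous_mult.
      * apply (param_continuous_comp R_UniformSpace 0 a b D (fun w => rx w * Re e + ry w * Im e) sh); auto.
        intros w Hw; apply continuous_Rplus; (apply continuous_Rmult; [|apply continuous_const]);
          [apply metric_continuous_x|apply metric_continuous_y]; exact Hw.
      * intros t Ht; apply filter_forall; intros p; apply C3.
  - assert (T := tube R_UniformSpace 0 a b (fun h t => D (sh h t)) Hloc).
    revert T; apply filter_imp; intros h Hh t Ht; specialize (Hh t Ht).
    unfold sh in Hh; rewrite Hcid in Hh by exact Ht; exact Hh.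
Qed.

Lemma shift_arc (a b : R) (e : C) (h : R) : I a -> I b -> a < b ->
  (forall t, a <= t <= b -> D (shift e h t)) -> arc D (shift e h) dg a b.
Proof.
  intros Ha Hb Hab HD; split; [exact Hab|split; [|exact HD]].
  apply (C1_path_mono I); [intros t Ht; apply (HI a b); assumption|].
  apply C1_path_eps; intros t Ht; destruct (path_components t Ht) as (H1 & H2 & H3 & H4).
  split; [|split; [|split; assumption]]; unfold shift; simpl; apply dwithin_plus_const; assumption.
Qed.

(** To first order in [h] the vector from [g (a + sg h)] to [g a + h e] is [h (e - sg g'(a))]. The
    left connector has [sg = -1], the right one [sg = 1]. *)
Lemma connector_length (a sg : R) (e : C) (d : R) : I a -> Rabs sg = 1 -> 0 < d ->
  exists h0, 0 < h0 /\ forall h, 0 < h < h0 -> I (a + sg * h) ->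
    Cmod (shift e h a - g (a + sg * h))%C <= h * (Cmod (Re e - sg * Re (dg a), Im e - sg * Im (dg a)) + d).
Proof.
  intros Ha Hsg Hd; destruct (path_components a Ha) as (H1 & H2 & _).
  destruct (H1 (d / 2)) as [d1 [Hd1 K1]]; [lra|]; destruct (H2 (d / 2)) as [d2 [Hd2 K2]]; [lra|].
  exists (Rmin d1 d2); split; [apply Rmin_pos; assumption|]; intros h Hh Hih.
  assert (Hab : Rabs (a + sg * h - a) = h).
  { replace (a + sg * h - a) with (sg * h) by ring; rewrite Rabs_mult, Hsg, Rabs_pos_eq; lra. }
  assert (L1 := K1 _ Hih); assert (L2 := K2 _ Hih); rewrite Hab in L1, L2.
  specialize (L1 (lt_Rmin_l (proj2 Hh))).
  specialize (L2 (lt_Rmin_r (proj2 Hh))).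
  replace (a + sg * h - a) with (sg * h) in L1, L2 by ring.
  set (r1 := Re (g (a + sg * h)) - Re (g a) - Re (dg a) * (sg * h)) in *.
  set (r2 := Im (g (a + sg * h)) - Im (g a) - Im (dg a) * (sg * h)) in *.
  replace (shift e h a - g (a + sg * h))%C with
    (RtoC h * (Re e - sg * Re (dg a), Im e - sg * Im (dg a))%R + (- r1, - r2)%R)%C.
  - apply Rle_trans with (1 := Cmod_triangle _ _).
    rewrite Cmod_mult, Cmod_R, Rabs_pos_eq, Rmult_plus_distr_l by lra.
    apply Rplus_le_compat_l; replace (h * d) with (2 * (d / 2 * h)) by field.
    apply Cmod_pair_le; rewrite Rabs_Ropp; assumption.
  - unfold r1, r2, shift, Cplus, Cminus, Copp, Cmult, RtoC, Re, Im.
    apply injective_projections; simpl; ring.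
Qed.

Lemma half_length (a sg d : R) : I a -> Rabs sg = 1 -> 0 < d ->
  exists h0, 0 < h0 /\ forall h, 0 < h < h0 -> I (a + sg * h) ->
    h * (speed_g a - d) <= sg * RInt speed_g a (a + sg * h).
Proof.
  intros Ha Hsg Hd.
  assert (K := cwithin_RInt_dwithin I speed_g a a HI speed_g_cwithin Ha Ha).
  destruct (K d Hd) as [h0 [Hh0 L]]; exists h0; split; [exact Hh0|]; intros h Hh Hih.
  specialize (L _ Hih); replace (a + sg * h - a) with (sg * h) in L by ring.
  rewrite Rabs_mult, Hsg, Rabs_pos_eq, Rmult_1_l in L by lra.
  specialize (L (proj2 Hh)); rewrite RInt_point in L; unfold zero in L; simpl in L.
  apply Rabs_le_between in L.
  assert (S2 : sg * sg = 1) by (rewrite <- (Rabs_pos_eq (sg * sg)) by nra; rewrite Rabs_mult, Hsg; ring).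
  assert (Hc : sg = 1 \/ sg = -1).
  { assert (E : (sg - 1) * (sg + 1) = 0) by (ring_simplify; lra).
    apply Rmult_integral in E; destruct E; [left|right]; lra. }
  destruct Hc as [-> | ->]; lra.
Qed.

(* The competing path: a short segment from [g (a - h)] to [g a + h e], the arc
   [g] over [[a, b]] translated by [h e], and a short segment to [g (b + h)]. *)
Lemma first_variation_ineq (a b h0 : R) (e : C) : 0 < h0 -> I (a - h0) -> I (b + h0) -> a < b ->
  speed_g a + speed_g b <=
  rho (g a) * Cmod (Re e + Re (dg a), Im e + Im (dg a)) + RInt (gradW e) a b
  + rho (g b) * Cmod (Re e - Re (dg b), Im e - Im (dg b)).
Proof.
  intros Hh0 Ha0 Hb0 Hab.
  assert (Hin : forall t, a - h0 <= t <= b + h0 -> I t)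
    by (intros t Ht; apply (HI (a - h0) (b + h0)); assumption).
  assert (Ha : I a) by (apply Hin; lra); assert (Hb : I b) by (apply Hin; lra).
  set (Na := Cmod (Re e + Re (dg a), Im e + Im (dg a))).
  set (Nb := Cmod (Re e - Re (dg b), Im e - Im (dg b))).
  assert (HNa : 0 <= Na) by apply Cmod_ge_0; assert (HNb : 0 <= Nb) by apply Cmod_ge_0.
  assert (Hra : 0 < rho (g a)) by (apply metric_pos, HgD; exact Ha).
  assert (Hrb : 0 < rho (g b)) by (apply metric_pos, HgD; exact Hb).
  (* One [d] serves for all errors: 2 for the two discarded ends of [g], 1 for the translated arc,
     and [rho + N + 1] for each connector, as [(rho + d) (N + d) <= rho N + (rho + N + 1) d] for
     [d <= 1]. *)
  apply (le_of_perturbation _ _ (2 + 1 + rho (g a) + Na + 1 + rho (g b) + Nb + 1)); [lra|].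
  intros d Hd.
  destruct (near_segment_cost (g a) d (HgD a Ha)) as [ea [Hea Ka]]; [lra|].
  destruct (near_segment_cost (g b) d (HgD b Hb)) as [eb [Heb Kb]]; [lra|].
  destruct (connector_length a (-1) e d Ha) as [h1 [Hh1 L1]]; [rewrite Rabs_left; lra|lra|].
  destruct (connector_length b 1 e d Hb) as [h2 [Hh2 L2]]; [rewrite Rabs_pos_eq; lra|lra|].
  destruct (half_length a (-1) d Ha) as [h3 [Hh3 L3]]; [rewrite Rabs_left; lra|lra|].
  destruct (half_length b 1 d Hb) as [h4 [Hh4 L4]]; [rewrite Rabs_pos_eq; lra|lra|].
  destruct (shifted_length a b e Ha Hb Hab) as [HB [h5 L5]].
  destruct (proj1 (is_derive_eps _ _ _) HB d) as [h6 [Hh6 L6]]; [lra|].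
  assert (Cg : forall t, I t -> forall eps, 0 < eps -> exists dl, 0 < dl /\ forall s, I s -> Rabs (s - t) < dl ->
     Rabs (Re (g s) - Re (g t)) < eps /\ Rabs (Im (g s) - Im (g t)) < eps).
  { intros t Ht eps Heps; destruct (path_components t Ht) as (P1 & P2 & _).
    destruct (dwithin_cwithin _ _ _ _ P1 eps Heps) as [x1 [Hx1 X1]].
    destruct (dwithin_cwithin _ _ _ _ P2 eps Heps) as [x2 [Hx2 X2]].
    exists (Rmin x1 x2); split; [apply Rmin_pos; assumption|]; intros s Hs Hst.
    split; [apply X1|apply X2]; try assumption;
      [exact (lt_Rmin_l Hst)|exact (lt_Rmin_r Hst)]. }
  destruct (Cg a Ha ea Hea) as [h7 [Hh7 L7]]; destruct (Cg b Hb eb Heb) as [h8 [Hh8 L8]].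
  (* A positive bound for the coordinates of [e]: when [h E < x], the translate by [h e] stays
     within [x] of [g], hence in the box where segments are cheap. *)
  set (E := Rabs (Re e) + Rabs (Im e) + 1).
  assert (HE : 0 < E) by (unfold E; generalize (Rabs_pos (Re e)) (Rabs_pos (Im e)); lra).
  set (m := Rmin (Rmin (Rmin h0 h1) (Rmin h2 h3)) (Rmin (Rmin h4 h5) (Rmin h6 h7))).
  set (m' := Rmin m (Rmin h8 (Rmin (ea / E) (eb / E)))).
  assert (Hm' : 0 < m').
  { unfold m', m; repeat apply Rmin_pos; try assumption; try apply cond_pos; apply Rdiv_lt_0_compat; assumption. }
  set (h := m' / 2).
  assert (Hle : h < h0 /\ h < h1 /\ h < h2 /\ h < h3 /\ h < h4 /\ h < h5 /\ h < h6 /\ h < h7 /\ h < h8 /\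
    h < ea / E /\ h < eb / E).
  { assert (h < m') by (unfold h; lra).
    assert (Q : forall x y z, z < Rmin x y -> z < x /\ z < y).
    { intros x y z Hz; split; [exact (lt_Rmin_l Hz)|
        exact (lt_Rmin_r Hz)]. }
    unfold m', m in *.
    repeat match goal with K : _ < Rmin _ _ |- _ => apply Q in K; destruct K end.
    repeat split; assumption. }
  destruct Hle as (G0 & G1 & G2 & G3 & G4 & G5 & G6 & G7 & G8 & G9 & G10).
  assert (Hh : 0 < h) by (unfold h; lra).
  assert (Ia : I (a + -1 * h)) by (apply Hin; lra); assert (Ib : I (b + 1 * h)) by (apply Hin; lra).
  specialize (L1 h ltac:(lra) Ia); specialize (L2 h ltac:(lra) Ib).
  specialize (L3 h ltac:(lra) Ia); specialize (L4 h ltac:(lra) Ib).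
  assert (L5' : forall t, a <= t <= b -> D (shift e h t)).
  { apply L5; change (Rabs (h - 0) < h5); rewrite Rminus_0_r, Rabs_pos_eq; lra. }
  specialize (L6 h); rewrite Rminus_0_r, Rabs_pos_eq in L6 by lra; specialize (L6 G6).
  assert (L7' := L7 _ Ia); assert (L8' := L8 _ Ib).
  specialize (L7' ltac:(replace (a + -1 * h - a) with (- h) by ring; rewrite Rabs_Ropp, Rabs_pos_eq; lra)).
  specialize (L8' ltac:(replace (b + 1 * h - b) with h by ring; rewrite Rabs_pos_eq; lra)).
  assert (Sh : forall t x, h < x / E -> 0 < x -> Rabs (Re (shift e h t) - Re (g t)) < x /\
      Rabs (Im (shift e h t) - Im (g t)) < x).
  { intros t x Hx Hx0.
    assert (h * E < x) by (apply (Rmult_lt_compat_r E) in Hx; [|exact HE];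
      replace (x / E * E) with x in Hx by (field; lra); exact Hx).
    unfold shift; simpl; unfold E in *.
    replace (Re (g t) + h * Re e - Re (g t)) with (h * Re e) by ring.
    replace (Im (g t) + h * Im e - Im (g t)) with (h * Im e) by ring.
    rewrite !Rabs_mult, (Rabs_pos_eq h) by lra.
    generalize (Rabs_pos (Re e)) (Rabs_pos (Im e)); intros; split; nra. }
  destruct (Sh a ea G9 Hea) as [Sa1 Sa2]; destruct (Sh b eb G10 Heb) as [Sb1 Sb2].
  destruct L7' as [A1 A2]; destruct L8' as [B1 B2].
  destruct (Ka _ _ A1 A2 Sa1 Sa2) as (Ca & Da1 & Da2).
  destruct (Kb _ _ Sb1 Sb2 B1 B2) as (Cb & Db1 & Db2).
  assert (HA := shift_arc a b e h Ha Hb Hab L5').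
  assert (HM := rho_dist_arc D rho metric_continuous metric_pos _ _ _ _ HA).
  rewrite (arc_rho_length D rho _ _ _ _ HA) in HM.
  change (RInt (speed rho (shift e h) dg) a b) with
    (RInt (fun t => rho (shift e h t) * Cmod (dg t)) a b) in HM.
  assert (T1 := rho_dist_triangle D rho metric_continuous metric_pos Hdom
     (g (a + -1 * h)) (shift e h a) (g (b + 1 * h)) Da1 Da2 Db2).
  assert (T2 := rho_dist_triangle D rho metric_continuous metric_pos Hdom
     (shift e h a) (shift e h b) (g (b + 1 * h)) Da2 Db1 Db2).
  rewrite (geodesic_dist _ _ Ia Ib) in T1 by lra.
  assert (Split : RInt speed_g (a + -1 * h) (b + 1 * h)
    = - RInt speed_g a (a + -1 * h) + RInt speed_g a b + RInt speed_g b (b + 1 * h)).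
  { rewrite <- (RInt_Chasles (V := R_CompleteNormedModule) speed_g (a + -1 * h) a (b + 1 * h))
      by (apply speed_g_ex_RInt; assumption).
    rewrite <- (RInt_Chasles (V := R_CompleteNormedModule) speed_g a b (b + 1 * h))
      by (apply speed_g_ex_RInt; assumption).
    rewrite <- (opp_RInt_swap (V := R_CompleteNormedModule) speed_g a (a + -1 * h))
      by (apply speed_g_ex_RInt; assumption).
    unfold plus, opp; simpl; ring. }
  assert (Z0 : RInt (fun t => rho (shift e 0 t) * Cmod (dg t)) a b = RInt speed_g a b).
  { apply RInt_ext; intros t _; unfold speed_g, speed, shift.
    rewrite !Rmult_0_l, !Rplus_0_r; do 2 f_equal; symmetry; apply surjective_pairing. }
  simpl in L6; rewrite Z0 in L6; apply Rabs_le_between in L6.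
  replace (g (b + 1 * h) - shift e h b)%C with (- (shift e h b - g (b + 1 * h)))%C in Cb by ring.
  rewrite Cmod_opp in Cb.
  replace (Re e - -1 * Re (dg a)) with (Re e + Re (dg a)) in L1 by ring.
  replace (Im e - -1 * Im (dg a)) with (Im e + Im (dg a)) in L1 by ring.
  rewrite !Rmult_1_l in L2; rewrite Rmult_1_l in L4.
  fold Na in L1; fold Nb in L2.
  rewrite Rmult_1_l in Cb, L4, Split.
  assert (M1 : (rho (g a) + d) * Cmod (shift e h a - g (a + -1 * h))%C <= (rho (g a) + d) * (h * (Na + d)))
    by (apply Rmult_le_compat_l; [lra|exact L1]).
  assert (M2 : (rho (g b) + d) * Cmod (shift e h b - g (b + h))%C <= (rho (g b) + d) * (h * (Nb + d)))
    by (apply Rmult_le_compat_l; [lra|exact L2]).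
  rewrite !Rmult_1_l in T1, T2.
  (* The length of [g] over [[a, b]] cancels, and everything left is a multiple of [h]. *)
  assert (Fin : h * (speed_g a + speed_g b) <= h * (2 * d + ((rho (g a) + d) * (Na + d)) + (RInt (gradW e) a b + d)
     + (rho (g b) + d) * (Nb + d))) by lra.
  apply Rmult_le_reg_l in Fin; [|exact Hh].
  apply Rle_trans with (1 := Fin).
  assert (d * d <= d) by nra; nra.
Qed.

Definition momentum (v : C) (t : R) : R :=
  rho (g t) * (Re (dg t) * Re v + Im (dg t) * Im v) / Cmod (dg t).

Lemma is_derive_Cmod_line (x y v1 v2 : R) : 0 < x ^ 2 + y ^ 2 ->
  is_derive (fun s => Cmod (s * v1 + x, s * v2 + y)) 0 ((x * v1 + y * v2) / Cmod (x, y)).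
Proof.
  intros H; rewrite Cmod_pair.
  apply (is_derive_ext (fun s => sqrt ((s * v1 + x) ^ 2 + (s * v2 + y) ^ 2))).
  { intros s; rewrite Cmod_pair; reflexivity. }
  assert (Hs : 0 < sqrt (x ^ 2 + y ^ 2)) by (apply sqrt_lt_R0; exact H).
  auto_derive.
  - rewrite !Rmult_0_l, !Rplus_0_l; simpl in *; lra.
  - rewrite !Rmult_0_l, !Rplus_0_l; simpl in *; field; lra.
Qed.

(** For [e = s v] the right side [N s] of the inequality equals its left side at [s = 0], so [N] has
    a minimum there and [N'(0) = 0]. The three terms of [N'(0)] are the momentum at [a], the
    integral, and minus the momentum at [b]. *)
Lemma first_variation_interior (a b h0 : R) (v : C) : 0 < h0 -> I (a - h0) -> I (b + h0) -> a < b ->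
  momentum v b - momentum v a = RInt (gradW v) a b.
Proof.
  intros Hh0 Ha0 Hb0 Hab.
  assert (Hin : forall t, a - h0 <= t <= b + h0 -> I t)
    by (intros t Ht; apply (HI (a - h0) (b + h0)); assumption).
  assert (Ha : I a) by (apply Hin; lra); assert (Hb : I b) by (apply Hin; lra).
  set (W := RInt (gradW v) a b).
  set (N := fun s => rho (g a) * Cmod (s * Re v + Re (dg a), s * Im v + Im (dg a)) + s * W
     + rho (g b) * Cmod (s * - Re v + Re (dg b), s * - Im v + Im (dg b))).
  assert (HW : forall s, RInt (gradW (s * Re v, s * Im v)) a b = s * W).
  { intros s; unfold W; transitivity (RInt (fun t => scal s (gradW v t)) a b).
    - apply RInt_ext; intros t _; unfold gradW, scal; simpl; unfold mult; simpl; unfold Re, Im; ring.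
    - apply (RInt_scal (V := R_CompleteNormedModule)); apply (cwithin_ex_RInt I); auto; intros; apply gradW_cwithin; assumption. }
  assert (HN0 : N 0 = speed_g a + speed_g b).
  { unfold N, speed_g, speed; rewrite !Rmult_0_l, !Rplus_0_l, Rplus_0_r.
    unfold Re, Im; rewrite <- !surjective_pairing; reflexivity. }
  assert (Hmin : forall s, N 0 <= N s).
  { intros s; rewrite HN0.
    assert (K := first_variation_ineq a b h0 (s * Re v, s * Im v) Hh0 Ha0 Hb0 Hab).
    rewrite HW in K; simpl in K; unfold N.
    replace (Cmod (s * - Re v + Re (dg b), s * - Im v + Im (dg b))) with
      (Cmod (s * Re v - Re (dg b), s * Im v - Im (dg b))); [exact K|].
    rewrite <- Cmod_opp; f_equal; unfold Copp; simpl; f_equal; ring. }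
  assert (HD : is_derive N 0 (rho (g a) * ((Re (dg a) * Re v + Im (dg a) * Im v) / Cmod (Re (dg a), Im (dg a)))
     + W + rho (g b) * ((Re (dg b) * - Re v + Im (dg b) * - Im v) / Cmod (Re (dg b), Im (dg b))))).
  { unfold N; apply (is_derive_plus (K := R_AbsRing) (V := R_NormedModule)
      (fun s => rho (g a) * Cmod (s * Re v + Re (dg a), s * Im v + Im (dg a)) + s * W)).
    - apply (is_derive_plus (K := R_AbsRing) (V := R_NormedModule)
        (fun s => rho (g a) * Cmod (s * Re v + Re (dg a), s * Im v + Im (dg a)))).
      + apply is_derive_scal, is_derive_Cmod_line, C_neq_0_sqr, Hreg; exact Ha.
      + auto_derive; trivial; ring.
    - apply is_derive_scal, is_derive_Cmod_line, C_neq_0_sqr, Hreg; exact Hb. }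
  assert (Z := is_derive_min N 0 _ HD Hmin).
  assert (HE : forall t, (Re (dg t), Im (dg t)) = dg t) by (intros t; symmetry; apply surjective_pairing).
  rewrite !HE in Z; unfold momentum, Rdiv in *; lra.
Qed.

Lemma momentum_cwithin (v : C) (t : R) : I t -> cwithin I (momentum v) t.
Proof.
  intros Ht; destruct (path_components t Ht) as (H1 & H2 & H3 & H4).
  apply dwithin_cwithin in H1; apply dwithin_cwithin in H2.
  assert (Hm : 0 < Cmod (dg t)) by (apply Cmod_gt_0, Hreg; exact Ht).
  apply (cwithin_mult I (fun t => rho (g t) * (Re (dg t) * Re v + Im (dg t) * Im v)) (fun t => / Cmod (dg t))).
  - apply (cwithin_mult I (fun t => rho (g t))).
    + apply cwithin_comp_C; auto; apply metric_continuous; auto.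
    + apply (cwithin_comp_C I dg (fun w => Re w * Re v + Im w * Im v)); auto.
      apply continuous_Rplus; (apply continuous_Rmult; [|apply continuous_const]);
        [apply continuous_Re_all|apply continuous_Im_all].
  - apply (cwithin_comp_C I dg (fun w => / Cmod w)); auto.
    apply (continuous_comp Cmod Rinv); [apply continuous_Cmod|].
    apply (continuous_of_derive Rinv _ (- 1 / Cmod (dg t) ^ 2)); auto_derive; [lra|field; lra].
Qed.

Lemma gradW_ex_RInt (v : C) (a b : R) : I a -> I b -> ex_RInt (gradW v) a b.
Proof. intros; apply (cwithin_ex_RInt I); auto; intros; apply gradW_cwithin; assumption. Qed.

(** The competing path uses some of [I] beyond [a] and [b]. For endpoints of [I] the identity on
    [[a + h, b - h]] passes to the limit, both sides being continuous within [I]. *)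
Lemma first_variation (a b : R) (v : C) : I a -> I b -> a < b ->
  momentum v b - momentum v a = RInt (gradW v) a b.
Proof.
  intros Ha Hb Hab.
  assert (K : forall eps, 0 < eps -> Rabs (momentum v b - momentum v a - RInt (gradW v) a b) <= 4 * eps).
  { intros eps Heps.
    assert (GW : forall t, I t -> cwithin I (gradW v) t) by (intros; apply gradW_cwithin; assumption).
    destruct (momentum_cwithin v a Ha eps Heps) as [d1 [Hd1 K1]].
    destruct (momentum_cwithin v b Hb eps Heps) as [d2 [Hd2 K2]].
    destruct (dwithin_cwithin _ _ _ _ (cwithin_RInt_dwithin I (gradW v) a a HI GW Ha Ha) eps Heps)
      as [d3 [Hd3 K3]].
    destruct (dwithin_cwithin _ _ _ _ (cwithin_RInt_dwithin I (gradW v) b b HI GW Hb Hb) eps Heps)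
      as [d4 [Hd4 K4]].
    set (m := Rmin (Rmin (Rmin d1 d2) (Rmin d3 d4)) ((b - a) / 2)).
    assert (Hm : 0 < m) by (unfold m; repeat apply Rmin_pos; try assumption; lra).
    set (h := m / 2).
    assert (Hle : h < d1 /\ h < d2 /\ h < d3 /\ h < d4 /\ h < (b - a) / 2).
    { assert (h < m) by (unfold h; lra).
      assert (Q : forall x y z, z < Rmin x y -> z < x /\ z < y).
      { intros x y z Hz; split; [exact (lt_Rmin_l Hz)|
          exact (lt_Rmin_r Hz)]. }
      unfold m in *.
      repeat match goal with K : _ < Rmin _ _ |- _ => apply Q in K; destruct K end.
      repeat split; assumption. }
    destruct Hle as (G1 & G2 & G3 & G4 & G5).
    assert (Hh : 0 < h) by (unfold h; lra).
    assert (Ia : I (a + h)) by (apply (HI a b); try assumption; lra).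
    assert (Ib : I (b - h)) by (apply (HI a b); try assumption; lra).
    assert (V := first_variation_interior (a + h) (b - h) h v Hh
      ltac:(replace (a + h - h) with a by ring; exact Ha)
      ltac:(replace (b - h + h) with b by ring; exact Hb) ltac:(lra)).
    assert (Ra : Rabs (a + h - a) = h) by (replace (a + h - a) with h by ring; apply Rabs_pos_eq; lra).
    assert (Rb : Rabs (b - h - b) = h)
      by (replace (b - h - b) with (- h) by ring; rewrite Rabs_Ropp; apply Rabs_pos_eq; lra).
    specialize (K1 _ Ia ltac:(rewrite Ra; lra)); specialize (K2 _ Ib ltac:(rewrite Rb; lra)).
    specialize (K3 _ Ia ltac:(rewrite Ra; lra)); specialize (K4 _ Ib ltac:(rewrite Rb; lra)).
    rewrite RInt_point in K3, K4; unfold zero in K3, K4; simpl in K3, K4.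
    assert (S : RInt (gradW v) a b = RInt (gradW v) a (a + h) + RInt (gradW v) (a + h) (b - h)
       - RInt (gradW v) b (b - h)).
    { rewrite <- (RInt_Chasles (V := R_CompleteNormedModule) (gradW v) a (a + h) b)
        by (apply gradW_ex_RInt; assumption).
      rewrite <- (RInt_Chasles (V := R_CompleteNormedModule) (gradW v) (a + h) (b - h) b)
        by (apply gradW_ex_RInt; assumption).
      rewrite <- (opp_RInt_swap (V := R_CompleteNormedModule) (gradW v) b (b - h))
        by (apply gradW_ex_RInt; assumption).
      unfold plus, opp; simpl; ring. }
    rewrite S, <- V.
    apply Rabs_def2 in K1; apply Rabs_def2 in K2; apply Rabs_def2 in K3; apply Rabs_def2 in K4.
    apply Rabs_le; lra. }
  destruct (Req_dec (momentum v b - momentum v a - RInt (gradW v) a b) 0) as [E|E]; [lra|].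
  apply Rabs_pos_lt in E.
  generalize (K (Rabs (momentum v b - momentum v a - RInt (gradW v) a b) / 8)); lra.
Qed.

Lemma momentum_dwithin (v : C) (t : R) : I t -> dwithin I (momentum v) t (gradW v t).
Proof.
  intros Ht.
  assert (K := cwithin_RInt_dwithin I (gradW v) t t HI (fun s => gradW_cwithin v s) Ht Ht).
  intros eps Heps; destruct (K eps Heps) as [d [Hd L]]; exists d; split; [exact Hd|].
  intros s Hs Hst; specialize (L s Hs Hst); rewrite RInt_point in L; unfold zero in L; simpl in L.
  rewrite Rminus_0_r in L.
  replace (momentum v s - momentum v t) with (RInt (gradW v) t s); [exact L|].
  destruct (Rtotal_order t s) as [H|[->|H]].
  - symmetry; apply first_variation; assumption.
  - rewrite RInt_point; unfold zero; simpl; ring.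
  - rewrite <- (opp_RInt_swap (V := R_CompleteNormedModule)) by (apply gradW_ex_RInt; assumption).
    rewrite <- (first_variation s t v) by assumption; unfold opp; simpl; ring.
Qed.

End Geodesic.

(** * Harmonic maps into a geodesic *)

Lemma C2_mixed (A : C -> Prop) (u : C -> R) (z : C) : open A -> C2_on A u -> A z ->
  partial_x (partial_y u) z = partial_y (partial_x u) z.
Proof.
  intros HA (H0 & H1 & H2) Hz; destruct z as [x y].
  apply (Schwarz (fun x y => u (x, y)) x y).
  - destruct (HA _ Hz) as [d Hd]; exists d; intros s t Hs Ht.
    assert (Hst : A (s, t)) by (apply Hd; split; assumption).
    split; [exact (proj1 (H0 _ Hst))|split; [exact (proj1 (proj2 (H0 _ Hst)))|split]].
    + exact (proj1 (H2 _ Hst)).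
    + exact (proj1 (proj2 (H1 _ Hst))).
  - apply continuity_2d_pt_filterlim.
    apply (filterlim_ext (F := locally (x, y)) (partial_x (partial_y u))); [intros [s t]; reflexivity|].
    exact (proj1 (proj2 (proj2 (H2 _ Hz)))).
  - apply continuity_2d_pt_filterlim.
    apply (filterlim_ext (F := locally (x, y)) (partial_y (partial_x u))); [intros [s t]; reflexivity|].
    exact (proj2 (proj2 (proj2 (H1 _ Hz)))).
Qed.

Lemma half_C (w : C) : (w / RtoC 2)%C = (/ 2 * Re w, / 2 * Im w).
Proof. rewrite quotient_components by lra; f_equal; field. Qed.

Lemma d_z_components (f : C -> C) (w : C) :
  d_z f w = (/ 2 * (partial_x (fun w => Re (f w)) w + partial_y (fun w => Im (f w)) w),
             / 2 * (partial_x (fun w => Im (f w)) w + -1 * partial_y (fun w => Re (f w)) w)).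
Proof.
  unfold d_z; rewrite half_C; unfold Cpartial_x, Cpartial_y; simpl; f_equal; ring.
Qed.

Lemma d_zbar_components (f : C -> C) (w : C) :
  d_zbar f w = (/ 2 * (partial_x (fun w => Re (f w)) w + -1 * partial_y (fun w => Im (f w)) w),
             / 2 * (partial_x (fun w => Im (f w)) w + partial_y (fun w => Re (f w)) w)).
Proof.
  unfold d_zbar; rewrite half_C; unfold Cpartial_x, Cpartial_y; simpl; f_equal; ring.
Qed.

Lemma partial_eq (u v : C -> R) (z : C) (a b : R) : (forall w, u w = v w) -> grad_at v z a b ->
  partial_x u z = a /\ partial_y u z = b.
Proof.
  intros E H; apply grad_unique; apply (grad_ext_loc v); [|exact H].
  apply filter_forall; intros w; symmetry; apply E.
Qed.

Lemma C2_on_grad (A : C -> Prop) (u : C -> R) (z : C) : open A -> C2_on A u -> A z ->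
  grad_at u z (partial_x u z) (partial_y u z) /\
  grad_at (partial_x u) z (partial_x (partial_x u) z) (partial_y (partial_x u) z) /\
  grad_at (partial_y u) z (partial_y (partial_x u) z) (partial_y (partial_y u) z).
Proof.
  intros HA H Hz; assert (E := C2_mixed A u z HA H Hz); destruct H as (H0 & H1 & H2).
  split; [|split]; [apply (C1_on_grad A); assumption..|].
  rewrite <- E; apply (C1_on_grad A); assumption.
Qed.

Lemma d_zbar_d_z (A : C -> Prop) (f : C -> C) (z : C) : open A -> C2_map_on A f -> A z ->
  d_zbar (d_z f) z =
   (/ 4 * (partial_x (partial_x (fun w => Re (f w))) z + partial_y (partial_y (fun w => Re (f w))) z),
    / 4 * (partial_x (partial_x (fun w => Im (f w))) z + partial_y (partial_y (fun w => Im (f w))) z)).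
Proof.
  intros HA [Hp Hq] Hz; rewrite d_zbar_components.
  destruct (C2_on_grad A _ z HA Hp Hz) as (_ & P1 & P2).
  destruct (C2_on_grad A _ z HA Hq Hz) as (_ & Q1 & Q2).
  destruct (partial_eq (fun w => Re (d_z f w)) _ z _ _
    (fun w => f_equal fst (d_z_components f w))
    (grad_scal (/ 2) _ _ _ _ (grad_plus _ _ _ _ _ _ _ P1 Q2))) as [E1 E2].
  destruct (partial_eq (fun w => Im (d_z f w)) _ z _ _
    (fun w => f_equal snd (d_z_components f w))
    (grad_scal (/ 2) _ _ _ _ (grad_plus _ _ _ _ _ _ _ Q1 (grad_scal (-1) _ _ _ _ P2)))) as [E3 E4].
  rewrite E1, E2, E3, E4; f_equal; field.
Qed.

Lemma d_z_log_metric (rho : C -> R) (w : C) (a b : R) : 0 < rho w -> grad_at rho w a b ->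
  d_z (fun w => RtoC (ln (rho w ^ 2))) w = (a / rho w, - b / rho w).
Proof.
  intros Hpos H; rewrite d_z_components.
  assert (H1 : grad_at (fun w => Re (RtoC (ln (rho w ^ 2)))) w (2 / rho w * a) (2 / rho w * b)).
  { apply (grad_comp1 (fun x => ln (x ^ 2)) rho); [|exact H].
    auto_derive; [nra|]; field; lra. }
  destruct (grad_unique _ _ _ _ H1) as [E1 E2].
  destruct (grad_unique (fun w => Im (RtoC (ln (rho w ^ 2)))) w 0 0 (grad_const 0 w)) as [E3 E4].
  rewrite E1, E2, E3, E4; f_equal; field; lra.
Qed.

(** [A + iB] is the complex number [f_x^2 + f_y^2 = 4 f_z f_zbar]. The equation times [4 rho] reads
    [rho Laplacian f + (rho_x - i rho_y) (A + iB) = 0], and these are its real and imaginary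
    parts. *)
Lemma harmonic_equations (D : C -> Prop) (rho : C -> R) (Om : C -> Prop) (f : C -> C) (z : C) (a b : R) :
  open Om -> rho_harmonic D rho Om f -> Om z -> 0 < rho (f z) -> grad_at rho (f z) a b ->
  let p := fun w => Re (f w) in let q := fun w => Im (f w) in
  let A := partial_x p z ^ 2 - partial_x q z ^ 2 + partial_y p z ^ 2 - partial_y q z ^ 2 in
  let B := 2 * (partial_x p z * partial_x q z + partial_y p z * partial_y q z) in
  rho (f z) * (partial_x (partial_x p) z + partial_y (partial_y p) z) + (a * A + b * B) = 0 /\
  rho (f z) * (partial_x (partial_x q) z + partial_y (partial_y q) z) + (a * B - b * A) = 0.
Proof.
  intros HO (H2 & HD & Heq) Hz Hpos Hrho p q A B.
  specialize (Heq z Hz); rewrite (d_zbar_d_z Om f z HO H2 Hz) in Heq.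
  rewrite (d_z_log_metric rho (f z) a b Hpos Hrho), d_z_components, d_zbar_components in Heq.
  fold p q in Heq.
  assert (E1 := f_equal fst Heq); assert (E2 := f_equal snd Heq); simpl in E1, E2.
  unfold A, B; split.
  - apply (f_equal (fun x => 4 * rho (f z) * x)) in E1; rewrite Rmult_0_r in E1; rewrite <- E1; field; lra.
  - apply (f_equal (fun x => 4 * rho (f z) * x)) in E2; rewrite Rmult_0_r in E2; rewrite <- E2; field; lra.
Qed.

Lemma continuous_within_comp (I : R -> Prop) (G : R -> R) (tau : C -> R) (Om : C -> Prop) (z : C) :
  open Om -> Om z -> (forall w, Om w -> I (tau w)) -> continuous tau z -> cwithin I G (tau z) ->
  continuous (fun w => G (tau w)) z.
Proof.
  intros HO Hz HI Ht HG; apply continuous_eps; intros eps Heps.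
  destruct (HG eps Heps) as [d [Hd K]].
  assert (L : locally z (fun w => Rabs (tau w - tau z) < d)).
  { destruct (proj1 (continuous_eps _ tau z) Ht d Hd) as [e He]; exists e; exact He. }
  destruct (filter_and _ _ (HO z Hz) L) as [e He]; exists e; intros w Hw.
  destruct (He w Hw) as [H1 H2]; apply K; auto.
Qed.

Section HarmonicMap.

Variables (D : C -> Prop) (rho : C -> R) (I : R -> Prop) (g dg : R -> C).
Hypothesis Hdom : planar_domain D.
Hypothesis Hmetric : conformal_metric D rho.
Hypothesis HI : convex_set I.
Hypothesis Hg : C1_path_on I g dg.
Hypothesis Hreg : forall t, I t -> dg t <> 0%C.
Hypothesis HgD : forall t, I t -> D (g t).
Hypothesis Hgeo : forall s t, I s -> I t -> s <= t ->
  rho_dist D rho (g s) (g t) = rho_length rho g s t.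

Variables (Om : C -> Prop) (f : C -> C).
Hypothesis HOm : open Om.
Hypothesis Hf : rho_harmonic D rho Om f.

Variables (tau : C -> R) (t0 : R).
Hypothesis Htau : forall z, Om z -> I (tau z) /\ g (tau z) = f z.
Hypothesis Ht0 : I t0.

Let speed_g := speed rho g dg.
Let p := fun w => Re (f w).
Let q := fun w => Im (f w).
Let u := fun z => RInt speed_g t0 (tau z).

Let Hpd := metric_grad D rho Hdom Hmetric.
Let Hpos := metric_pos D rho Hmetric.
Let Hcont := metric_continuous D rho Hdom Hmetric.
Let Hspd := speed_g_cwithin D rho I g dg Hdom Hmetric Hg HgD.
Let Hcomp := path_components I g dg Hg.

Lemma speed_g_pos (t : R) : I t -> 0 < speed_g t.
Proof.
  intros Ht; apply Rmult_lt_0_compat; [apply Hpos, HgD; exact Ht|apply Cmod_gt_0, Hreg; exact Ht].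
Qed.

Lemma arclength_dist (z w : C) : Om z -> Om w -> Rabs (u w - u z) = rho_dist D rho (f z) (f w).
Proof.
  assert (K : forall z w, Om z -> Om w -> tau z <= tau w -> u w - u z = rho_dist D rho (f z) (f w)).
  { intros z' w' Hz Hw Hle; destruct (Htau z' Hz) as [I1 <-]; destruct (Htau w' Hw) as [I2 <-].
    rewrite (geodesic_dist D rho I g dg) by assumption; unfold u; fold speed_g.
    assert (E : forall a b, I a -> I b -> ex_RInt speed_g a b)
      by (intros a b Ha Hb; apply (cwithin_ex_RInt I); assumption).
    rewrite <- (RInt_Chasles (V := R_CompleteNormedModule) speed_g t0 (tau z') (tau w')) by (apply E; assumption).
    unfold plus; simpl; ring. }
  assert (Hfd : forall z, Om z -> D (f z)) by exact (proj1 (proj2 Hf)).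
  assert (Hnn : forall z w, Om z -> Om w -> 0 <= rho_dist D rho (f z) (f w)).
  { intros z' w' Hz Hw; apply rho_dist_nonneg; auto. }
  intros Hz Hw; destruct (Rle_dec (tau z) (tau w)) as [Hle|Hgt].
  - rewrite (K z w) by assumption; apply Rabs_pos_eq; auto.
  - rewrite Rabs_minus_sym, (K w z) by (assumption || lra).
    rewrite Rabs_pos_eq by auto; apply rho_dist_sym; auto.
Qed.

Let H2 : C2_map_on Om f := proj1 Hf.

Lemma map_continuous (z : C) : Om z -> continuous p z /\ continuous q z.
Proof.
  intros Hz; split; eapply grad_continuous.
  - apply (proj1 (C2_on_grad Om p z HOm (proj1 H2) Hz)).
  - apply (proj1 (C2_on_grad Om q z HOm (proj2 H2) Hz)).
Qed.

(** Of [tau] only [g (tau z) = f z] is known at this point. Continuity of [u] is therefore read off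
    the distance from [f z] to [f w], which is at most the length of a short segment. *)
Lemma arclength_continuous (z : C) : Om z -> continuous u z.
Proof.
  intros Hz; apply continuous_eps; intros eps Heps.
  assert (HDz : D (f z)) by exact (proj1 (proj2 Hf) z Hz).
  destruct (near_segment_cost D rho Hdom Hmetric (f z) 1 HDz Rlt_0_1) as [e [He K]].
  assert (Hr := Hpos (f z) HDz).
  destruct (map_continuous z Hz) as [Cp Cq].
  set (m := Rmin e (eps / (4 * (rho (f z) + 1)))).
  assert (Hm : 0 < m) by (apply Rmin_pos; [exact He|apply Rdiv_lt_0_compat; lra]).
  assert (L1 : locally z (fun w => Rabs (p w - p z) < m)).
  { destruct (proj1 (continuous_eps _ p z) Cp m Hm) as [d Hd]; exists d; exact Hd. }
  assert (L2 : locally z (fun w => Rabs (q w - q z) < m)).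
  { destruct (proj1 (continuous_eps _ q z) Cq m Hm) as [d Hd]; exists d; exact Hd. }
  destruct (filter_and _ _ (HOm z Hz) (filter_and _ _ L1 L2)) as [d Hd].
  exists d; intros w Hw; destruct (Hd w Hw) as (HOw & M1 & M2).
  assert (m <= e) by apply Rmin_l; assert (Hme : m <= eps / (4 * (rho (f z) + 1))) by apply Rmin_r.
  rewrite arclength_dist by assumption.
  destruct (K (f z) (f w)) as [K1 _]; unfold p, q in *;
    try (rewrite Rminus_diag, Rabs_R0; exact He); try lra.
  apply Rle_lt_trans with (1 := K1).
  assert (B : Cmod (f w - f z)%C <= 2 * m).
  { apply (Cmod_pair_le (Re (f w) - Re (f z)) (Im (f w) - Im (f z))); lra. }
  apply Rle_lt_trans with ((rho (f z) + 1) * (2 * m)); [apply Rmult_le_compat_l; lra|].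
  apply Rle_lt_trans with ((rho (f z) + 1) * (2 * (eps / (4 * (rho (f z) + 1))))).
  - apply Rmult_le_compat_l; lra.
  - apply Rle_lt_trans with (eps / 2); [right; field; lra|lra].
Qed.

Lemma arclength_increasing (s t : R) : I s -> I t -> s < t -> RInt speed_g t0 s < RInt speed_g t0 t.
Proof.
  intros Hs Ht Hst.
  assert (E : forall a b, I a -> I b -> ex_RInt speed_g a b)
    by (intros a b Ha Hb; apply (cwithin_ex_RInt I); assumption).
  rewrite <- (RInt_Chasles (V := R_CompleteNormedModule) speed_g t0 s t) by (apply E; assumption).
  assert (0 < RInt speed_g s t); [|unfold plus; simpl; lra].
  rewrite (RInt_ext _ (fun x => speed_g (clamp s t x))).
  - apply RInt_gt_0; [exact Hst| |].
    + intros x Hx; rewrite clamp_id by lra; apply speed_g_pos, (HI s t); try assumption; lra.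
    + intros x Hx; apply (clamp_continuous I); [lra|]; intros y Hy.
      assert (I y) by (apply (HI s t); assumption); split; [assumption|apply Hspd; assumption].
  - intros x Hx; rewrite Rmin_left, Rmax_right in Hx by lra; rewrite clamp_id by lra; reflexivity.
Qed.

(** Moving the parameter by [eps] costs a fixed amount of arc length, more than [u] varies near [z].
    If [tau z + eps] or [tau z - eps] falls outside [I], no parameter lies beyond it and any amount
    will do. *)
Lemma tau_continuous (z : C) : Om z -> continuous tau z.
Proof.
  intros Hz; apply continuous_eps; intros eps Heps.
  destruct (Htau z Hz) as [Iz _].
  assert (R1 : exists e, 0 < e /\ forall t, I t -> tau z + eps <= t -> RInt speed_g t0 (tau z) + e <= RInt speed_g t0 t).
  { destruct (classic (I (tau z + eps))) as [H|H].
    - exists (RInt speed_g t0 (tau z + eps) - RInt speed_g t0 (tau z)); split.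
      + assert (K := arclength_increasing (tau z) (tau z + eps) Iz H ltac:(lra)); lra.
      + intros t Ht [Hlt| <-]; [|lra].
        assert (K := arclength_increasing _ _ H Ht Hlt); lra.
    - exists 1; split; [lra|]; intros t Ht Hle; exfalso; apply H.
      apply (HI (tau z) t); try assumption; lra. }
  assert (R2 : exists e, 0 < e /\ forall t, I t -> t <= tau z - eps -> RInt speed_g t0 t + e <= RInt speed_g t0 (tau z)).
  { destruct (classic (I (tau z - eps))) as [H|H].
    - exists (RInt speed_g t0 (tau z) - RInt speed_g t0 (tau z - eps)); split.
      + assert (K := arclength_increasing (tau z - eps) (tau z) H Iz ltac:(lra)); lra.
      + intros t Ht [Hlt| ->]; [|lra].
        assert (K := arclength_increasing _ _ Ht H Hlt); lra.
    - exists 1; split; [lra|]; intros t Ht Hle; exfalso; apply H.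
      apply (HI t (tau z)); try assumption; lra. }
  destruct R1 as [e1 [He1 K1]]; destruct R2 as [e2 [He2 K2]].
  assert (He : 0 < Rmin e1 e2) by (apply Rmin_pos; assumption).
  assert (L : locally z (fun w => Rabs (u w - u z) < Rmin e1 e2)).
  { destruct (proj1 (continuous_eps _ u z) (arclength_continuous z Hz) _ He) as [d Hd]; exists d; exact Hd. }
  destruct (filter_and _ _ (HOm z Hz) L) as [d Hd]; exists d; intros w Hw.
  destruct (Hd w Hw) as [Ow M]; destruct (Htau w Ow) as [Iw _].
  assert (M1 := lt_Rmin_l M); assert (M2 := lt_Rmin_r M).
  apply Rabs_def2 in M1; apply Rabs_def2 in M2; unfold u in M1, M2.
  apply Rabs_def1; apply Rnot_le_lt; intros Hle.
  - assert (K := K1 _ Iw ltac:(lra)); lra.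
  - assert (K := K2 _ Iw ltac:(lra)); lra.
Qed.

Let n2 := fun t => Re (dg t) ^ 2 + Im (dg t) ^ 2.
(** The relation [f_x = tau_x g'(tau)] solved for [tau_x], by the inner product with [g']. *)
Let tx := fun z => (Re (dg (tau z)) * partial_x p z + Im (dg (tau z)) * partial_x q z) / n2 (tau z).
Let ty := fun z => (Re (dg (tau z)) * partial_y p z + Im (dg (tau z)) * partial_y q z) / n2 (tau z).

Lemma n2_pos (t : R) : I t -> 0 < n2 t.
Proof. intros Ht; apply C_neq_0_sqr, Hreg; exact Ht. Qed.

(** Project on the fixed vector [g'(tau z)]: the real function [<g'(tau z), g t>] has derivative
    [|g'|^2 > 0] at [tau z], and composed with [tau] it is [<g'(tau z), f>], which is
    differentiable. So [tau] is a local inverse to which [dwithin_inverse] applies. *)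
Lemma tau_derive_curve (m1 m2 : R -> R) (x d1 d2 lp lq : R) :
  Om (m1 x, m2 x) -> is_derive m1 x d1 -> is_derive m2 x d2 ->
  is_derive (fun s => p (m1 s, m2 s)) x lp -> is_derive (fun s => q (m1 s, m2 s)) x lq ->
  is_derive (fun s => tau (m1 s, m2 s)) x
    ((Re (dg (tau (m1 x, m2 x))) * lp + Im (dg (tau (m1 x, m2 x))) * lq) / n2 (tau (m1 x, m2 x))).
Proof.
  intros HO Hm1 Hm2 Hp Hq.
  set (z := (m1 x, m2 x) : C) in *.
  destruct (Htau z HO) as [Iz _].
  set (a := Re (dg (tau z))) in *; set (b := Im (dg (tau z))) in *.
  assert (Cm : continuous (fun s => (m1 s, m2 s) : C) x).
  { apply continuous_pair; eapply continuous_of_derive; eassumption. }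
  assert (LO : locally x (fun s => Om (m1 s, m2 s))) by (apply (Cm Om), HOm; exact HO).
  apply (dwithin_inverse I (fun t => a * Re (g t) + b * Im (g t))).
  - destruct (Hcomp (tau z) Iz) as (K1 & K2 & _ & _).
    fold z; intros eps Heps.
    set (M := Rabs a + Rabs b + 1).
    assert (HM : 0 < M) by (unfold M; generalize (Rabs_pos a) (Rabs_pos b); lra).
    destruct (K1 (eps / M)) as [e1 [He1 L1]]; [apply Rdiv_lt_0_compat; assumption|].
    destruct (K2 (eps / M)) as [e2 [He2 L2]]; [apply Rdiv_lt_0_compat; assumption|].
    exists (Rmin e1 e2); split; [apply Rmin_pos; assumption|]; intros s Hs Hst.
    assert (A1 := L1 s Hs (lt_Rmin_l Hst)).
    assert (A2 := L2 s Hs (lt_Rmin_r Hst)).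
    replace (a * Re (g s) + b * Im (g s) - (a * Re (g (tau z)) + b * Im (g (tau z))) - n2 (tau z) * (s - tau z))
      with (a * (Re (g s) - Re (g (tau z)) - Re (dg (tau z)) * (s - tau z))
          + b * (Im (g s) - Im (g (tau z)) - Im (dg (tau z)) * (s - tau z)))
      by (unfold n2; fold a b; ring).
    apply Rle_trans with (1 := Rabs_triang _ _); rewrite !Rabs_mult.
    apply Rle_trans with ((Rabs a + Rabs b) * (eps / M * Rabs (s - tau z))).
    + rewrite Rmult_plus_distr_r; apply Rplus_le_compat; (apply Rmult_le_compat_l; [apply Rabs_pos|assumption]).
    + replace (eps * Rabs (s - tau z)) with (M * (eps / M * Rabs (s - tau z))) by (field; lra).
      apply Rmult_le_compat_r; [|unfold M; lra].
      apply Rmult_le_pos; [left; apply Rdiv_lt_0_compat; assumption|apply Rabs_pos].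
  - apply n2_pos; exact Iz.
  - apply (is_derive_ext_loc (fun s => a * p (m1 s, m2 s) + b * q (m1 s, m2 s))).
    + revert LO; apply filter_imp; intros s Hs; unfold p, q.
      rewrite <- (proj2 (Htau _ Hs)); reflexivity.
    + apply (is_derive_plus (K := R_AbsRing) (V := R_NormedModule)); apply is_derive_scal; assumption.
  - apply (continuous_comp (fun s => (m1 s, m2 s) : C) tau); [exact Cm|apply tau_continuous; exact HO].
  - revert LO; apply filter_imp; intros s Hs; exact (proj1 (Htau _ Hs)).
Qed.

Lemma dg_tau_continuous (z : C) : Om z ->
  continuous (fun w => Re (dg (tau w))) z /\ continuous (fun w => Im (dg (tau w))) z.
Proof.
  intros Hz; destruct (Hcomp (tau z) (proj1 (Htau z Hz))) as (_ & _ & K3 & K4).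
  split.
  - apply (continuous_within_comp I (fun t => Re (dg t)) tau Om); auto using tau_continuous.
    intros w Hw; apply Htau; exact Hw.
  - apply (continuous_within_comp I (fun t => Im (dg t)) tau Om); auto using tau_continuous.
    intros w Hw; apply Htau; exact Hw.
Qed.

Lemma quotient_n2_continuous (a b : C -> R) (z : C) : Om z -> continuous a z -> continuous b z ->
  continuous (fun z => (Re (dg (tau z)) * a z + Im (dg (tau z)) * b z) / n2 (tau z)) z.
Proof.
  intros Hz Ha Hb; destruct (dg_tau_continuous z Hz) as [C1 C2].
  assert (Hn := n2_pos (tau z) (proj1 (Htau z Hz))).
  assert (Cs : forall h : C -> R, continuous h z -> continuous (fun w => h w ^ 2) z).
  { intros h Hh; apply (continuous_comp h (fun x => x ^ 2)); [exact Hh|].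
    eapply continuous_of_derive; auto_derive; trivial; reflexivity. }
  apply (continuous_Rmult _ (fun z => Re (dg (tau z)) * a z + Im (dg (tau z)) * b z) (fun z => / n2 (tau z))).
  - apply continuous_Rplus; apply continuous_Rmult; assumption.
  - apply (continuous_comp (fun z => n2 (tau z)) Rinv).
    + apply (continuous_Rplus _ (fun z => Re (dg (tau z)) ^ 2) (fun z => Im (dg (tau z)) ^ 2)); apply Cs; assumption.
    + apply (continuous_of_derive Rinv _ (- 1 / n2 (tau z) ^ 2)); auto_derive; [lra|field; lra].
Qed.

Lemma first_partials_continuous (z : C) : Om z ->
  continuous (partial_x p) z /\ continuous (partial_x q) z /\
  continuous (partial_y p) z /\ continuous (partial_y q) z.
Proof.
  intros Hz; destruct H2 as [[Hp _] [Hq _]].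
  destruct (Hp z Hz) as (_ & _ & P1 & P2); destruct (Hq z Hz) as (_ & _ & Q1 & Q2); auto.
Qed.

Lemma tau_partials_continuous (z : C) : Om z -> continuous tx z /\ continuous ty z.
Proof.
  intros Hz; destruct (first_partials_continuous z Hz) as (P1 & Q1 & P2 & Q2).
  split; apply quotient_n2_continuous; assumption.
Qed.

Lemma map_grad (z : C) : Om z ->
  grad_at p z (partial_x p z) (partial_y p z) /\ grad_at q z (partial_x q z) (partial_y q z).
Proof.
  intros Hz; split;
    [exact (proj1 (C2_on_grad Om p z HOm (proj1 H2) Hz))|exact (proj1 (C2_on_grad Om q z HOm (proj2 H2) Hz))].
Qed.

Lemma tau_is_derive_x (z : C) : Om z -> is_derive (fun x => tau (x, Im z)) (Re z) (tx z).
Proof.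
  intros Hz; destruct (map_grad z Hz) as [Pp Pq].
  assert (E : (Re z, Im z) = z) by (symmetry; apply surjective_pairing).
  assert (K := tau_derive_curve (fun x => x) (fun _ => Im z) (Re z) 1 0 (partial_x p z) (partial_x q z)).
  simpl in K; rewrite E in K.
  apply K; auto using is_derive_Rid, is_derive_Rconst; eapply grad_x; eassumption.
Qed.

Lemma tau_is_derive_y (z : C) : Om z -> is_derive (fun y => tau (Re z, y)) (Im z) (ty z).
Proof.
  intros Hz; destruct (map_grad z Hz) as [Pp Pq].
  assert (E : (Re z, Im z) = z) by (symmetry; apply surjective_pairing).
  assert (K := tau_derive_curve (fun _ => Re z) (fun y => y) (Im z) 0 1 (partial_y p z) (partial_y q z)).
  simpl in K; rewrite E in K.
  apply K; auto using is_derive_Rid, is_derive_Rconst; eapply grad_y; eassumption.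
Qed.

Lemma grad_within (G G' : R -> R) (z : C) :
  (forall t, I t -> dwithin I G t (G' t)) -> (forall t, I t -> cwithin I G' t) -> Om z ->
  grad_at (fun w => G (tau w)) z (G' (tau z) * tx z) (G' (tau z) * ty z).
Proof.
  intros HG HG' Hz; apply (grad_C1 (fun w => G (tau w)) (fun w => G' (tau w) * tx w)).
  - generalize (HOm z Hz); apply filter_imp; intros [x y] Hw; simpl.
    apply (dwithin_comp I G (fun x => tau (x, y))).
    + apply HG; exact (proj1 (Htau _ Hw)).
    + apply (tau_is_derive_x (x, y) Hw).
    + destruct (HOm _ Hw) as [d Hd]; exists d; intros s Hs; apply Htau, Hd; split;
        [exact Hs|apply ball_center].
  - destruct z as [x y]; apply (dwithin_comp I G (fun y => tau (x, y))).
    + apply HG; exact (proj1 (Htau _ Hz)).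
    + apply (tau_is_derive_y (x, y) Hz).
    + destruct (HOm _ Hz) as [d Hd]; exists d; intros s Hs; apply Htau, Hd; split;
        [apply ball_center|exact Hs].
  - apply continuous_Rmult; [|exact (proj1 (tau_partials_continuous z Hz))].
    apply (continuous_within_comp I G' tau Om); auto using tau_continuous.
    + intros w Hw; apply Htau; exact Hw.
    + apply HG'; apply Htau; exact Hz.
Qed.

Lemma map_partials_tangent (z : C) : Om z ->
  partial_x p z = Re (dg (tau z)) * tx z /\ partial_x q z = Im (dg (tau z)) * tx z /\
  partial_y p z = Re (dg (tau z)) * ty z /\ partial_y q z = Im (dg (tau z)) * ty z.
Proof.
  intros Hz.
  assert (E : forall (h : C -> R), locally z (fun w => h (g (tau w)) = h (f w))).
  { intros h; generalize (HOm z Hz); apply filter_imp; intros w Hw; rewrite (proj2 (Htau w Hw)); reflexivity. }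
  assert (K1 : grad_at p z (Re (dg (tau z)) * tx z) (Re (dg (tau z)) * ty z)).
  { apply (grad_ext_loc (fun w => Re (g (tau w)))); [apply (E (fun v : C => Re v))|].
    apply (grad_within (fun t => Re (g t)) (fun t => Re (dg t))); try assumption; intros t Ht; apply (Hcomp t Ht). }
  assert (K2 : grad_at q z (Im (dg (tau z)) * tx z) (Im (dg (tau z)) * ty z)).
  { apply (grad_ext_loc (fun w => Im (g (tau w)))); [apply (E (fun v : C => Im v))|].
    apply (grad_within (fun t => Im (g t)) (fun t => Im (dg t))); try assumption; intros t Ht; apply (Hcomp t Ht). }
  destruct (grad_unique _ _ _ _ K1) as [E1 E2]; destruct (grad_unique _ _ _ _ K2) as [E3 E4]; auto.
Qed.

Let P1 := momentum rho g dg (1, 0).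
Let P2 := momentum rho g dg (0, 1).
Let W1 := gradW rho g dg (1, 0).
Let W2 := gradW rho g dg (0, 1).

Lemma momentum_grad (v : C) (z : C) : Om z ->
  grad_at (fun w => momentum rho g dg v (tau w)) z (gradW rho g dg v (tau z) * tx z) (gradW rho g dg v (tau z) * ty z).
Proof.
  apply grad_within.
  - intros t Ht; apply (momentum_dwithin D rho I g dg); assumption.
  - intros t Ht; apply (gradW_cwithin D rho I g dg); assumption.
Qed.

(* The path [g] itself need not be [C^2], but its momentum is [C^1] along it: this
   is enough to differentiate [u_x = P1(tau) Re f_x + P2(tau) Im f_x] once more. *)
Lemma arclength_harmonic : harmonic_on Om u.
Proof.
  exists (fun z => P1 (tau z) * partial_x p z + P2 (tau z) * partial_x q z),
    (fun z => P1 (tau z) * partial_y p z + P2 (tau z) * partial_y q z),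
    (fun z => (partial_x p z * (W1 (tau z) * tx z) + P1 (tau z) * partial_x (partial_x p) z)
            + (partial_x q z * (W2 (tau z) * tx z) + P2 (tau z) * partial_x (partial_x q) z)),
    (fun z => (partial_x p z * (W1 (tau z) * ty z) + P1 (tau z) * partial_y (partial_x p) z)
            + (partial_x q z * (W2 (tau z) * ty z) + P2 (tau z) * partial_y (partial_x q) z)),
    (fun z => (partial_y p z * (W1 (tau z) * ty z) + P1 (tau z) * partial_y (partial_y p) z)
            + (partial_y q z * (W2 (tau z) * ty z) + P2 (tau z) * partial_y (partial_y q) z)).
  intros z Hz.
  destruct (Htau z Hz) as [Iz Gz].
  destruct (C2_on_grad Om p z HOm (proj1 H2) Hz) as (_ & Dpx & Dpy).
  destruct (C2_on_grad Om q z HOm (proj2 H2) Hz) as (_ & Dqx & Dqy).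
  assert (DP1 := momentum_grad (1, 0) z Hz); assert (DP2 := momentum_grad (0, 1) z Hz).
  fold P1 W1 in DP1; fold P2 W2 in DP2.
  destruct (map_partials_tangent z Hz) as (Epx & Eqx & Epy & Eqy).
  assert (HDz : D (f z)) by exact (proj1 (proj2 Hf) z Hz).
  set (c := Cmod (dg (tau z))).
  assert (Hc : 0 < c) by (apply Cmod_gt_0, Hreg; exact Iz).
  assert (Hcc : c * c = n2 (tau z)) by (unfold c, n2; rewrite <- Cmod2_alt; ring).
  set (a := Re (dg (tau z))) in *; set (b := Im (dg (tau z))) in *.
  assert (EP1 : P1 (tau z) = rho (f z) * a / c).
  { unfold P1, momentum; fold c a b; rewrite Gz; simpl; f_equal; ring. }
  assert (EP2 : P2 (tau z) = rho (f z) * b / c).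
  { unfold P2, momentum; fold c a b; rewrite Gz; simpl; f_equal; ring. }
  assert (EW1 : W1 (tau z) = partial_x rho (f z) * c).
  { unfold W1, gradW; fold c; rewrite Gz; simpl; ring. }
  assert (EW2 : W2 (tau z) = partial_y rho (f z) * c).
  { unfold W2, gradW; fold c; rewrite Gz; simpl; ring. }
  destruct (first_partials_continuous z Hz) as (Cpx & Cqx & Cpy & Cqy).
  destruct (tau_partials_continuous z Hz) as [Ctx Cty].
  assert (CP1 := grad_continuous _ _ _ _ DP1); assert (CP2 := grad_continuous _ _ _ _ DP2).
  assert (CW : forall v, continuous (fun w => gradW rho g dg v (tau w)) z).
  { intros v; apply (continuous_within_comp I (gradW rho g dg v) tau Om); auto using tau_continuous.
    - intros w Hw; apply Htau; exact Hw.
    - apply (gradW_cwithin D rho I g dg); assumption. }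
  assert (CW1 := CW (1, 0)); assert (CW2 := CW (0, 1)).
  destruct (proj1 (proj2 (proj1 H2)) z Hz) as (_ & _ & Cpxx & Cpxy).
  destruct (proj2 (proj2 (proj1 H2)) z Hz) as (_ & _ & _ & Cpyy).
  destruct (proj1 (proj2 (proj2 H2)) z Hz) as (_ & _ & Cqxx & Cqxy).
  destruct (proj2 (proj2 (proj2 H2)) z Hz) as (_ & _ & _ & Cqyy).
  assert (Cadd := continuous_Rplus C_UniformSpace); assert (Cmul := continuous_Rmult C_UniformSpace).
  split; [|split; [|split; [|split; [|split; [|split]]]]].
  - eapply grad_eq.
    + apply (grad_within (fun t => RInt speed_g t0 t) speed_g z); [|exact Hspd|exact Hz].
      intros t Ht; apply cwithin_RInt_dwithin; assumption.
    + rewrite EP1, EP2, Epx, Eqx; unfold speed_g, speed; fold c; rewrite Gz.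
      transitivity (rho (f z) * (c * c) / c * tx z); [field; lra|].
      rewrite Hcc; unfold n2; fold a b; field; lra.
    + rewrite EP1, EP2, Epy, Eqy; unfold speed_g, speed; fold c; rewrite Gz.
      transitivity (rho (f z) * (c * c) / c * ty z); [field; lra|].
      rewrite Hcc; unfold n2; fold a b; field; lra.
  - apply grad_plus; [exact (grad_mult _ _ _ _ _ _ _ DP1 Dpx)|exact (grad_mult _ _ _ _ _ _ _ DP2 Dqx)].
  (* The mixed derivatives agree because [f_x] and [f_y] are [tx] and [ty] times the same tangent
     vector. *)
  - eapply grad_eq; [apply grad_plus; [exact (grad_mult _ _ _ _ _ _ _ DP1 Dpy)|exact (grad_mult _ _ _ _ _ _ _ DP2 Dqy)]| |].
    + rewrite Epx, Eqx, Epy, Eqy; ring.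
    + reflexivity.
  - exact (Cadd _ _ _ (Cadd _ _ _ (Cmul _ _ _ Cpx (Cmul _ _ _ CW1 Ctx)) (Cmul _ _ _ CP1 Cpxx))
      (Cadd _ _ _ (Cmul _ _ _ Cqx (Cmul _ _ _ CW2 Ctx)) (Cmul _ _ _ CP2 Cqxx))).
  - exact (Cadd _ _ _ (Cadd _ _ _ (Cmul _ _ _ Cpx (Cmul _ _ _ CW1 Cty)) (Cmul _ _ _ CP1 Cpxy))
      (Cadd _ _ _ (Cmul _ _ _ Cqx (Cmul _ _ _ CW2 Cty)) (Cmul _ _ _ CP2 Cqxy))).
  - exact (Cadd _ _ _ (Cadd _ _ _ (Cmul _ _ _ Cpy (Cmul _ _ _ CW1 Cty)) (Cmul _ _ _ CP1 Cpyy))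
      (Cadd _ _ _ (Cmul _ _ _ Cqy (Cmul _ _ _ CW2 Cty)) (Cmul _ _ _ CP2 Cqyy))).
  (* Write [T = tx^2 + ty^2]. Differentiating the momentum contributes [T |g'| <g', grad rho>].
     Since [f_x^2 + f_y^2 = T g'^2] as complex numbers, the component of [rho Laplacian f] along
     [g'] is [- T |g'|^2 <g', grad rho>]; divided by [|g'|] it cancels the first term. *)
  - destruct (harmonic_equations D rho Om f z _ _ HOm Hf Hz (Hpos _ HDz) (Hpd _ HDz)) as [E1 E2].
    fold p q in E1, E2; rewrite Epx, Eqx, Epy, Eqy in E1, E2.
    set (r1 := partial_x rho (f z)) in *; set (r2 := partial_y rho (f z)) in *.
    set (T := tx z * tx z + ty z * ty z).
    set (Lp := partial_x (partial_x p) z + partial_y (partial_y p) z) in *.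
    set (Lq := partial_x (partial_x q) z + partial_y (partial_y q) z) in *.
    transitivity (T * (a * W1 (tau z) + b * W2 (tau z)) + (P1 (tau z) * Lp + P2 (tau z) * Lq)).
    { rewrite Epx, Eqx, Epy, Eqy; unfold T, Lp, Lq; ring. }
    rewrite EP1, EP2, EW1, EW2.
    transitivity ((T * (a * r1 + b * r2) * (c * c) + (a * (rho (f z) * Lp) + b * (rho (f z) * Lq))) / c);
      [field; lra|].
    replace (rho (f z) * Lp) with (- (r1 * ((a * tx z) ^ 2 - (b * tx z) ^ 2 + (a * ty z) ^ 2 - (b * ty z) ^ 2)
      + r2 * (2 * (a * tx z * (b * tx z) + a * ty z * (b * ty z))))) by lra.
    replace (rho (f z) * Lq) with (- (r1 * (2 * (a * tx z * (b * tx z) + a * ty z * (b * ty z)))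
      - r2 * ((a * tx z) ^ 2 - (b * tx z) ^ 2 + (a * ty z) ^ 2 - (b * ty z) ^ 2))) by lra.
    rewrite Hcc; unfold n2, T; fold a b; field; lra.
Qed.

End HarmonicMap.

(** * Sharpness and the main theorem *)

(** [G] minus the integral of [G'] has derivative zero inside and is continuous up to the ends, so
    the mean value theorem applies to its clamped extension. *)
Lemma RInt_dwithin (a b : R) (G G' : R -> R) : a < b ->
  (forall t, a <= t <= b -> dwithin (fun s => a <= s <= b) G t (G' t)) ->
  (forall t, a <= t <= b -> cwithin (fun s => a <= s <= b) G' t) ->
  G b - G a = RInt G' a b.
Proof.
  intros Hab HG HG'.
  assert (HI := seg_int_convex a b : convex_set (fun s => a <= s <= b)).
  set (F := fun t => G t - RInt G' a t).
  assert (HF : forall t, a <= t <= b -> dwithin (fun s => a <= s <= b) F t 0).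
  { intros t Ht eps Heps.
    destruct (HG t Ht (eps / 2)) as [d1 [Hd1 K1]]; [lra|].
    destruct (cwithin_RInt_dwithin _ G' a t HI HG' ltac:(lra) Ht (eps / 2)) as [d2 [Hd2 K2]]; [lra|].
    exists (Rmin d1 d2); split; [apply Rmin_pos; assumption|]; intros s Hs Hst.
    assert (A1 := K1 s Hs (lt_Rmin_l Hst)).
    assert (A2 := K2 s Hs (lt_Rmin_r Hst)).
    unfold F; simpl in A2; apply Rabs_le_between in A1; apply Rabs_le_between in A2; apply Rabs_le; lra. }
  assert (Hcont : forall x, continuous (fun x => F (clamp a b x)) x).
  { apply (clamp_continuous (fun s => a <= s <= b)); [lra|]; intros t Ht; split; [exact Ht|].
    eapply dwithin_cwithin, HF; exact Ht. }
  destruct (MVT_gen (fun x => F (clamp a b x)) a b (fun _ => 0)) as [c [_ Hc]].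
  - intros x Hx; rewrite Rmin_left, Rmax_right in Hx by lra.
    apply (is_derive_ext_loc F).
    + generalize (seg_int_locally a b x Hx); apply filter_imp; intros y Hy; rewrite clamp_id by exact Hy; reflexivity.
    + apply (dwithin_is_derive (fun s => a <= s <= b)); [apply seg_int_locally; exact Hx|apply HF; lra].
  - intros x _; apply continuity_pt_filterlim; apply Hcont.
  - rewrite !clamp_id in Hc by lra; unfold F in Hc; rewrite RInt_point in Hc; unfold zero in Hc; simpl in Hc; lra.
Qed.

(** On a segment from a point of [U] to a point of [V], consider the supremum of the times up to
    which the segment stays in [U]: neither open set can contain the point reached there unless they
    meet. *)
Lemma convex_connected (A : C -> Prop) :
  (forall z w t, A z -> A w -> 0 <= t <= 1 -> A (segment z w t)) -> connected A.
Proof.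
  intros Hconv U V HU HV Hcov [z [Az Uz]] [w [Aw Vw]].
  apply NNPP; intros Hn.
  set (phi := segment z w).
  assert (Hphi : forall t, 0 <= t <= 1 -> A (phi t)) by (intros; apply Hconv; assumption).
  assert (Cphi : forall t, continuous phi t).
  { intros t; apply continuous_pair; apply continuous_Rplus; try apply continuous_const;
      apply continuous_Rmult; [apply continuous_id|apply continuous_const|apply continuous_id|apply continuous_const]. }
  assert (Hdis : forall t, 0 <= t <= 1 -> U (phi t) -> V (phi t) -> False).
  { intros t Ht H1 H2; apply Hn; exists (phi t); auto. }
  assert (P0 : phi 0 = z) by apply segment_0; assert (P1 : phi 1 = w) by apply segment_1.
  destruct (completeness (fun t => 0 <= t <= 1 /\ forall s, 0 <= s <= t -> U (phi s))) as [t [Ht1 Ht2]].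
  { exists 1; intros t [Ht _]; lra. }
  { exists 0; split; [lra|]; intros s Hs; assert (s = 0) as -> by lra; rewrite P0; exact Uz. }
  assert (T0 : 0 <= t).
  { apply Ht1; split; [lra|]; intros s Hs; assert (s = 0) as -> by lra; rewrite P0; exact Uz. }
  assert (T1 : t <= 1) by (apply Ht2; intros s [Hs _]; lra).
  assert (Hbelow : forall s, 0 <= s < t -> U (phi s)).
  { intros s Hs; apply NNPP; intros HUs.
    assert (t <= s); [|lra].
    apply Ht2; intros x [Hx1 Hx2]; apply Rnot_lt_le; intros Hlt; apply HUs, Hx2; lra. }
  destruct (Hcov (phi t) (Hphi t (conj T0 T1))) as [Ut|Vt].
  - destruct (Cphi t U (HU _ Ut)) as [d Hd].
    destruct (Req_dec t 1) as [->|Hne].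
    { apply (Hdis 1); [lra|exact Ut|rewrite P1; exact Vw]. }
    set (t' := Rmin 1 (t + d / 2)).
    assert (Htt : t < t') by (apply Rmin_glb_lt; [lra|generalize (cond_pos d); lra]).
    assert (Hle : t' <= t); [|lra].
    apply Ht1; split; [split; [lra|apply Rmin_l]|]; intros s Hs.
    destruct (Rlt_dec s t) as [Hlt|Hge]; [apply Hbelow; lra|].
    apply Hd; change (Rabs (s - t) < d); rewrite Rabs_pos_eq by lra.
    assert (t' <= t + d / 2) by apply Rmin_r; generalize (cond_pos d); lra.
  - destruct (Req_dec t 0) as [E|Hne].
    { apply (Hdis t); [lra|rewrite E, P0; exact Uz|exact Vt]. }
    destruct (Cphi t V (HV _ Vt)) as [d Hd].
    set (s := Rmax 0 (t - d / 2)).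
    assert (Hs : 0 <= s < t) by (split; [apply Rmax_l|apply Rmax_lub_lt; generalize (cond_pos d); lra]).
    apply (Hdis s); [lra|apply Hbelow; exact Hs|].
    apply Hd; change (Rabs (s - t) < d); rewrite Rabs_left by lra.
    assert (t - d / 2 <= s) by apply Rmax_r; generalize (cond_pos d); lra.
Qed.

Lemma unit_disk_convex (z w : C) (t : R) : unit_disk z -> unit_disk w -> 0 <= t <= 1 ->
  unit_disk (segment z w t).
Proof.
  intros Hz Hw Ht.
  apply unit_disk_sqr in Hz; apply unit_disk_sqr in Hw; apply unit_disk_sqr.
  destruct z as [x1 y1], w as [x2 y2]; unfold segment; simpl in *.
  set (X := x1 * x1 + y1 * y1); set (Y := x2 * x2 + y2 * y2).
  assert (HX : X < 1) by (unfold X; lra); assert (HY : Y < 1) by (unfold Y; lra).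
  apply Rle_lt_trans with ((1 - t) * X + t * Y).
  + unfold X, Y.
    assert (0 <= t * (1 - t) * ((x1 - x2) * (x1 - x2) + (y1 - y2) * (y1 - y2))).
    { apply Rmult_le_pos; [apply Rmult_le_pos; lra|]; generalize (Rle_0_sqr (x1 - x2)) (Rle_0_sqr (y1 - y2)).
      unfold Rsqr; lra. }
    lra.
  + destruct (Req_dec t 0) as [->|E]; [lra|].
    assert (t * Y < t * 1) by (apply Rmult_lt_compat_l; lra).
    assert ((1 - t) * X <= (1 - t) * 1) by (apply Rmult_le_compat_l; lra).
    lra.
Qed.

Lemma unit_disk_domain : planar_domain unit_disk.
Proof.
  split; [exact unit_disk_open|split].
  - exists 0%C; unfold unit_disk; rewrite Cmod_0; lra.
  - apply convex_connected; exact unit_disk_convex.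
Qed.

(** * The Euclidean disk and its diameter *)

Definition flat (w : C) : R := 1.

Lemma flat_continuous (D : C -> Prop) (w : C) : D w -> continuous flat w.
Proof. intros _; apply continuous_const. Qed.

Lemma flat_pos (D : C -> Prop) (w : C) : D w -> 0 < flat w.
Proof. intros _; unfold flat; lra. Qed.

Lemma C1_on_of_grad (A : C -> Prop) (u a b : C -> R) : open A ->
  (forall z, A z -> grad_at u z (a z) (b z) /\ continuous a z /\ continuous b z) -> C1_on A u.
Proof.
  intros HA H z Hz; destruct (H z Hz) as (H1 & H2 & H3).
  assert (E : forall w, A w -> partial_x u w = a w /\ partial_y u w = b w)
    by (intros w Hw; apply grad_unique, H; exact Hw).
  split; [|split; [|split]].
  - exists (a z); eapply grad_x; exact H1.
  - exists (b z); eapply grad_y; exact H1.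
  - apply (continuous_ext_loc _ a); [|exact H2].
    generalize (HA z Hz); apply filter_imp; intros w Hw; symmetry; exact (proj1 (E w Hw)).
  - apply (continuous_ext_loc _ b); [|exact H3].
    generalize (HA z Hz); apply filter_imp; intros w Hw; symmetry; exact (proj2 (E w Hw)).
Qed.

Lemma C2_on_of_grad (A : C -> Prop) (u a b axx axy byx byy : C -> R) : open A ->
  (forall z, A z -> grad_at u z (a z) (b z) /\ grad_at a z (axx z) (axy z) /\ grad_at b z (byx z) (byy z) /\
     continuous axx z /\ continuous axy z /\ continuous byx z /\ continuous byy z) ->
  C2_on A u /\ forall z, A z -> partial_x (partial_x u) z = axx z /\ partial_y (partial_y u) z = byy z.
Proof.
  intros HA H.
  assert (E : forall w, A w -> partial_x u w = a w /\ partial_y u w = b w)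
    by (intros w Hw; apply grad_unique, H; exact Hw).
  assert (Ex : forall z, A z -> grad_at (partial_x u) z (axx z) (axy z)).
  { intros z Hz; apply (grad_ext_loc a); [|apply H; exact Hz].
    generalize (HA z Hz); apply filter_imp; intros w Hw; symmetry; exact (proj1 (E w Hw)). }
  assert (Ey : forall z, A z -> grad_at (partial_y u) z (byx z) (byy z)).
  { intros z Hz; apply (grad_ext_loc b); [|apply H; exact Hz].
    generalize (HA z Hz); apply filter_imp; intros w Hw; symmetry; exact (proj2 (E w Hw)). }
  split; [split; [|split]|].
  - apply (C1_on_of_grad A u a b HA); intros z Hz; destruct (H z Hz) as (H1 & H2 & H3 & _).
    split; [exact H1|split; eapply grad_continuous; eassumption].
  - apply (C1_on_of_grad A _ axx axy HA); intros z Hz; destruct (H z Hz) as (_ & _ & _ & C1 & C2 & _); auto.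
  - apply (C1_on_of_grad A _ byx byy HA); intros z Hz; destruct (H z Hz) as (_ & _ & _ & _ & _ & C1 & C2); auto.
  - intros z Hz; split; [apply (grad_unique _ _ _ _ (Ex z Hz))|apply (grad_unique _ _ _ _ (Ey z Hz))].
Qed.

Lemma C2_on_const (A : C -> Prop) (c : R) : open A ->
  C2_on A (fun _ => c) /\ forall z, A z ->
    partial_x (partial_x (fun _ => c)) z = 0 /\ partial_y (partial_y (fun _ => c)) z = 0.
Proof.
  intros HA; apply (C2_on_of_grad A (fun _ => c) (fun _ => 0) (fun _ => 0) (fun _ => 0) (fun _ => 0)
    (fun _ => 0) (fun _ => 0) HA); intros z Hz.
  assert (K := continuous_const (U := C_UniformSpace) (V := R_UniformSpace) 0 z).
  split; [apply grad_const|split; [apply grad_const|split; [apply grad_const|auto]]].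
Qed.

Lemma flat_metric : conformal_metric unit_disk flat.
Proof.
  split; [intros w _; unfold flat; lra|].
  apply (C2_on_const unit_disk 1 unit_disk_open).
Qed.

(** Projection to the real axis does not increase length: along each arc the increment of [Re] is
    the integral of [Re g'], at most that of [|g'|]. *)
Lemma flat_dist_lower (w1 w2 : C) : unit_disk w1 -> unit_disk w2 ->
  Re w2 - Re w1 <= rho_dist unit_disk flat w1 w2.
Proof.
  intros H1 H2; apply le_epsilon; intros eps Heps.
  assert (Hc := flat_continuous unit_disk); assert (Hp := flat_pos unit_disk).
  destruct (rho_dist_approx unit_disk flat Hc Hp unit_disk_domain w1 w2 eps H1 H2 Heps) as [l [Hl Hlt]].
  assert (K : Re w2 - Re w1 <= l); [|lra].
  revert Hl; apply (pathlen_ind unit_disk flat Hc (fun w l => Re w - Re w1 <= l)).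
  - lra.
  - intros g dg a b l' HA Hle.
    rewrite (arc_rho_length unit_disk flat g dg a b HA).
    assert (Hex := arc_ex_speed unit_disk flat Hc g dg a b HA).
    destruct HA as (Hab & Hg & HD).
    assert (Hco := proj1 (C1_path_eps _ _ _) Hg).
    assert (E : Re (g b) - Re (g a) = RInt (fun t => Re (dg t)) a b).
    { apply (RInt_dwithin a b (fun t => Re (g t))); [exact Hab| |]; intros t Ht; apply (Hco t Ht). }
    assert (B : RInt (fun t => Re (dg t)) a b <= RInt (speed flat g dg) a b).
    { apply RInt_le; [lra| |exact Hex|].
      - apply (cwithin_ex_RInt (fun s => a <= s <= b)); [apply seg_int_convex| |lra|lra].
        intros t Ht; apply (Hco t Ht).
      - intros t Ht; unfold speed, flat; rewrite Rmult_1_l.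
        eapply Rle_trans; [apply Rle_abs|apply re_le_Cmod]. }
    lra.
Qed.

Lemma flat_dist_upper (w1 w2 : C) : unit_disk w1 -> unit_disk w2 ->
  rho_dist unit_disk flat w1 w2 <= Cmod (w2 - w1)%C.
Proof.
  intros H1 H2; rewrite <- (Rmult_1_l (Cmod _)).
  apply rho_dist_segment; [apply flat_continuous|apply flat_pos|]; intros t Ht.
  split; [apply unit_disk_convex; assumption|unfold flat; lra].
Qed.

Definition diameter (w : C) : Prop := Im w = 0 /\ -1 < Re w < 1.

Lemma diameter_disk (w : C) : diameter w -> unit_disk w.
Proof. intros [H1 H2]; apply unit_disk_sqr; rewrite H1; nra. Qed.

Lemma real_line_C1 (I : R -> Prop) : C1_path_on I RtoC (fun _ => RtoC 1).
Proof.
  apply C1_path_eps; intros t Ht; unfold RtoC; simpl.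
  assert (Cst : forall c : R, cwithin I (fun _ => c) t).
  { intros c eps Heps; exists 1; split; [lra|]; intros; rewrite Rminus_diag, Rabs_R0; exact Heps. }
  split; [|split; [|split; apply Cst]]; intros eps Heps; exists 1; (split; [lra|]); intros s Hs Hst;
    match goal with |- Rabs ?e <= _ => replace e with 0 by (simpl; ring) end;
    rewrite Rabs_R0; (apply Rmult_le_pos; [lra|apply Rabs_pos]).
Qed.

Lemma diameter_geodesic : geodesic_line unit_disk flat diameter.
Proof.
  split; [exact diameter_disk|].
  exists (fun t => -1 < t < 1), RtoC; split.
  - split; [intros; lra|split; [exists 0, (1 / 2); lra|split; [|split]]].
    + exists (fun _ => RtoC 1); split; [apply real_line_C1|].
      intros t _ H; injection H; lra.
    + intros s t _ _ H; injection H; trivial.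
    + intros w; split.
      * intros [H1 H2]; exists (Re w); split; [exact H2|]; rewrite (surjective_pairing w).
        unfold RtoC; simpl; f_equal; symmetry; exact H1.
      * intros [t [Ht <-]]; split; [reflexivity|exact Ht].
  - intros s t Hs Ht Hst.
    assert (Us : unit_disk (RtoC s)) by (apply real_in_unit_disk; lra).
    assert (Ut : unit_disk (RtoC t)) by (apply real_in_unit_disk; lra).
    assert (L : rho_length flat RtoC s t = t - s).
    { destruct (Req_dec s t) as [->|Hne].
      - unfold rho_length; rewrite RInt_point; unfold zero; simpl; ring.
      - rewrite (arc_rho_length unit_disk flat RtoC (fun _ => RtoC 1) s t).
        + rewrite (RInt_ext _ (fun _ => 1)).
          * rewrite (RInt_const (V := R_CompleteNormedModule)); unfold scal; simpl; unfold mult; simpl; ring.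
          * intros x _; unfold speed, flat; rewrite Cmod_1; simpl; ring.
        + split; [lra|split; [apply real_line_C1|]]; intros x Hx; apply real_in_unit_disk; lra. }
    rewrite L; apply Rle_antisym.
    + apply Rle_trans with (1 := flat_dist_upper _ _ Us Ut).
      rewrite <- RtoC_minus, Cmod_R, Rabs_pos_eq; lra.
    + exact (flat_dist_lower (RtoC s) (RtoC t) Us Ut).
Qed.

(* The real part of [4/pi * arctan z], a conformal map of the disk onto a strip
   of width 2; its complex derivative is [4/pi / (1 + z^2)]. *)
Definition strip_map (z : C) : R := 2 / PI * atan (2 * Re z * / (1 - (Re z ^ 2 + Im z ^ 2))).

Definition strip_deriv (z : C) : C := (RtoC (4 / PI) * / (1 + z * z))%C.

Lemma one_plus_sqr_neq_0 (z : C) : unit_disk z -> (1 + z * z)%C <> 0%C.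
Proof.
  intros Hz E; apply unit_disk_sqr in Hz; destruct z as [x y].
  assert (E1 := f_equal fst E); assert (E2 := f_equal snd E); simpl in *; nra.
Qed.

Lemma strip_deriv_complex_diff (z : C) : unit_disk z -> exists l, complex_diff strip_deriv z l.
Proof.
  intros Hz; eexists; apply (complex_diff_mult (fun _ => RtoC (4 / PI))); [apply complex_diff_const|].
  apply (complex_diff_comp (fun w => / w)%C (fun z => 1 + z * z)%C).
  - apply complex_diff_inv, one_plus_sqr_neq_0; exact Hz.
  - apply (complex_diff_plus (fun _ => RtoC 1)); [apply complex_diff_const|].
    apply (complex_diff_mult (fun z => z) (fun z => z)); apply complex_diff_id.
Qed.

(** The gradient of the real part of a holomorphic function with derivative [F'] is
    [(Re F', - Im F')]. Here it is checked on the real formula, without a complex arctangent. *)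
Lemma strip_map_grad (z : C) : unit_disk z ->
  grad_at strip_map z (Re (strip_deriv z)) (- Im (strip_deriv z)).
Proof.
  intros Hz; assert (HPI := PI_RGT_0).
  assert (Hd := proj1 (unit_disk_sqr z) Hz).
  set (M := 1 - (Re z ^ 2 + Im z ^ 2)).
  assert (HM : 0 < M) by (unfold M; lra).
  assert (P2 : forall u a b, grad_at u z a b -> grad_at (fun w => u w ^ 2) z (2 * u z * a) (2 * u z * b)).
  { intros u a b Hu; apply (grad_comp1 (fun x => x ^ 2)); [|exact Hu]; auto_derive; trivial; ring. }
  assert (PM : grad_at (fun w => 1 - (Re w ^ 2 + Im w ^ 2)) z
    (0 - (2 * Re z * 1 + 2 * Im z * 0)) (0 - (2 * Re z * 0 + 2 * Im z * 1))).
  { apply (grad_minus (fun _ => 1)); [apply grad_const|]; apply grad_plus; apply P2; [apply grad_Re|apply grad_Im]. }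
  assert (DI : is_derive (fun x => / x) M (- / M ^ 2)) by (auto_derive; [lra|field; lra]).
  assert (PI' := grad_comp1 (fun x => / x) (fun w => 1 - (Re w ^ 2 + Im w ^ 2)) z _ _ _ DI PM).
  assert (PQ := grad_mult _ _ _ _ _ _ _ (grad_scal 2 _ _ _ _ (grad_Re z)) PI').
  simpl in PQ.
  assert (PA := grad_scal (2 / PI) _ _ _ _ (grad_comp1 atan _ z _ _ _ (is_derive_atan _) PQ)).
  eapply grad_eq; [exact PA| |]; cbv beta; fold M.
  (* The quantity is [|1 + z^2|^2], and it equals [(1 - |z|^2)^2 + 4 (Re z)^2], the denominator that
     comes from the derivative of [atan]. *)
  all: assert (HQ : 0 < (1 + (Re z * Re z - Im z * Im z)) ^ 2 + (Re z * Im z + Im z * Re z) ^ 2)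
    by (replace ((1 + (Re z * Re z - Im z * Im z)) ^ 2 + (Re z * Im z + Im z * Re z) ^ 2)
        with (M ^ 2 + 4 * Re z ^ 2) by (unfold M; ring);
      generalize (pow_lt M 2 HM) (pow2_ge_0 (Re z)); lra).
  all: destruct z as [x y]; unfold strip_deriv, Rsqr; unfold Re, Im in *; simpl in *; unfold M in *.
  all: clear - HPI HM HQ; field; repeat split; intros E; lra.
Qed.

Definition strip_point (z : C) : C := (strip_map z, 0).

(** The gradient is the complex conjugate of a holomorphic function: [holo_C2] supplies the second
    derivatives, and the Cauchy-Riemann equations make their sum vanish. *)
Lemma strip_map_facts : C2_on unit_disk strip_map /\ forall z, unit_disk z ->
  partial_x (partial_x strip_map) z + partial_y (partial_y strip_map) z = 0.
Proof.
  set (P := fun w => Re (strip_deriv w)); set (Q := fun w => Im (strip_deriv w)).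
  destruct (C2_on_of_grad unit_disk strip_map P (fun w => - Q w) (partial_x P)
    (fun w => - partial_x Q w) (fun w => - partial_x Q w) (fun w => - partial_x P w) unit_disk_open) as [H1 H2].
  - intros z Hz.
    assert (H : holo_C2_at P Q z).
    { apply holo_C2; generalize (unit_disk_open z Hz); apply filter_imp; intros w Hw.
      destruct (strip_deriv_complex_diff w Hw) as [l Hl]; exists (Re l), (Im l); exact Hl. }
    destruct H as ([A1 A2] & [B1 B2] & _).
    assert (C1 := grad_continuous _ _ _ _ B1); assert (C2 := grad_continuous _ _ _ _ B2).
    assert (C3 := continuous_Ropp _ _ _ C1); assert (C4 := continuous_Ropp _ _ _ C2).
    split; [apply strip_map_grad; exact Hz|split; [exact A1|split; [apply grad_opp; exact A2|auto]]].
  - split; [exact H1|]; intros z Hz; destruct (H2 z Hz) as [E1 E2]; rewrite E1, E2; ring.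
Qed.

Lemma strip_map_range (z : C) : -1 < strip_map z < 1.
Proof.
  assert (HPI := PI_RGT_0); unfold strip_map.
  set (t := 2 * Re z * / (1 - (Re z ^ 2 + Im z ^ 2))); destruct (atan_bound t) as [H1 H2].
  replace (2 / PI * atan t) with (atan t / (PI / 2)) by (field; lra).
  split; [apply Rlt_div_r; lra|apply Rlt_div_l; lra].
Qed.

Lemma strip_point_diameter (z : C) : diameter (strip_point z).
Proof. split; [reflexivity|apply strip_map_range]. Qed.

Lemma strip_point_harmonic : rho_harmonic unit_disk flat unit_disk strip_point.
Proof.
  destruct strip_map_facts as [H1 H2].
  destruct (C2_on_const unit_disk 0 unit_disk_open) as [K1 K2].
  assert (HC : C2_map_on unit_disk strip_point) by (split; [exact H1|exact K1]).
  split; [exact HC|split].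
  - intros z _; apply diameter_disk, strip_point_diameter.
  - intros z Hz; rewrite (d_zbar_d_z unit_disk strip_point z unit_disk_open HC Hz).
    rewrite (d_z_log_metric flat (strip_point z) 0 0); [|unfold flat; lra|apply grad_const].
    change (fun w => Re (strip_point w)) with strip_map; change (fun w => Im (strip_point w)) with (fun _ : C => 0).
    destruct (K2 z Hz) as [E1 E2]; rewrite (H2 z Hz), E1, E2.
    unfold flat; apply injective_projections; simpl; field.
Qed.

Lemma identity_conformal : conformal_bijection (fun z => z) unit_disk unit_disk.
Proof.
  split; [|split; [auto|split; [auto|intros w Hw; exists w; auto]]].
  intros z _; exists (RtoC 1); split; [|intros H; injection H; lra].
  split; [apply (is_linear_scal_l (K := C_AbsRing) (V := C_NormedModule))|].
  intros x _ eps; apply filter_forall; intros y.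
  change (Cmod ((y - x) - (y - x) * 1)%C <= eps * Cmod (y - x)%C).
  replace ((y - x) - (y - x) * 1)%C with (RtoC 0) by ring.
  rewrite Cmod_0; apply Rmult_le_pos; [left; apply cond_pos|apply Cmod_ge_0].
Qed.

Lemma inverse_on_id (w : C) : unit_disk w -> inverse_on unit_disk (fun z => z) w = w.
Proof.
  intros Hw; apply (epsilon_spec (inhabits (RtoC 0)) (fun z => unit_disk z /\ z = w)); exists w; auto.
Qed.

Lemma constant_sharp (c : R) : distance_estimate c -> 4 / PI <= c.
Proof.
  intros Hc; assert (HPI := PI_RGT_0).
  (* By the duplication formula this is [4 / pi arctan t] for [|t| < 1]. Its derivative at 0 is
     [4 / pi], against 1 for [artanh]. *)
  set (theta := fun t => 2 / PI * atan (2 * t * / (1 - t ^ 2))).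
  assert (K : forall t, 0 < t < 1 -> theta t <= c * artanh t).
  { intros t Ht.
    assert (Ut : unit_disk (RtoC t)) by (apply real_in_unit_disk; lra).
    assert (U0 : unit_disk (RtoC 0)) by (apply real_in_unit_disk; lra).
    assert (E := Hc unit_disk flat (RtoC 0) 1 diameter unit_disk (fun z => z) strip_point
      unit_disk_domain flat_metric U0 Rlt_0_1 diameter_geodesic).
    assert (B := E ltac:(intros w Hw; assert (Uw := diameter_disk w Hw); split; [exact Uw|];
       apply Rle_lt_trans with (1 := flat_dist_upper _ _ Uw U0);
       replace (RtoC 0 - w)%C with (- w)%C by ring; rewrite Cmod_opp; exact Uw)
      unit_disk_domain identity_conformal strip_point_harmonic
      (fun z _ => strip_point_diameter z) (RtoC 0) (RtoC t) U0 Ut).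
    assert (L := flat_dist_lower (strip_point (RtoC 0)) (strip_point (RtoC t))
      (diameter_disk _ (strip_point_diameter _)) (diameter_disk _ (strip_point_diameter _))).
    unfold hyp_dist in B; rewrite !inverse_on_id in B by assumption.
    assert (Eh : hyp_dist_disk (RtoC 0) (RtoC t) = artanh t).
    { unfold hyp_dist_disk; f_equal.
      replace ((RtoC 0 - RtoC t) / (RtoC 1 - Cconj (RtoC 0) * RtoC t))%C with (RtoC (- t)).
      - rewrite Cmod_R, Rabs_Ropp, Rabs_pos_eq; lra.
      - replace (Cconj (RtoC 0)) with (RtoC 0) by (unfold Cconj, RtoC; simpl; f_equal; ring).
        rewrite RtoC_opp; field. }
    rewrite Eh, Rmult_1_r in B.
    assert (E0 : Re (strip_point (RtoC 0)) = 0).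
    { unfold strip_point, strip_map; simpl; rewrite Rmult_0_r, Rmult_0_l, atan_0; ring. }
    assert (Et : Re (strip_point (RtoC t)) = theta t).
    { unfold strip_point, strip_map, theta, RtoC, Re, Im; simpl; do 4 f_equal; ring. }
    rewrite E0, Et in L; lra. }
  set (F := fun t => c * artanh t - theta t).
  assert (HF : is_derive F 0 (c - 4 / PI)).
  { replace (c - 4 / PI) with (c * / (1 - 0 ^ 2) - 4 / PI)
      by (replace (1 - 0 ^ 2) with 1 by ring; rewrite Rinv_1; ring).
    apply (is_derive_minus (K := R_AbsRing) (V := R_NormedModule) (fun t => c * artanh t) theta).
    - apply is_derive_scal, is_derive_artanh; lra.
    - unfold theta; auto_derive; [lra|]; field; lra. }
  apply Rnot_lt_le; intros Hlt.
  (* An error below half the slope gives [F t <= - (4 / PI - c) / 2 * t < 0] for a small positive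
     [t], contrary to the estimate. *)
  destruct (proj1 (is_derive_eps F 0 _) HF ((4 / PI - c) / 2)) as [d [Hd Hlin]]; [lra|].
  set (t := Rmin (d / 2) (1 / 2)).
  assert (Ht : 0 < t) by (apply Rmin_pos; lra).
  assert (t <= d / 2) by apply Rmin_l; assert (t <= 1 / 2) by apply Rmin_r.
  specialize (Hlin t); rewrite Rminus_0_r, Rabs_pos_eq in Hlin by lra.
  specialize (Hlin ltac:(lra)).
  assert (F0 : F 0 = 0).
  { unfold F, theta; rewrite artanh_0, Rmult_0_r, Rmult_0_r, Rmult_0_l, atan_0; ring. }
  assert (Ft := K t ltac:(lra)).
  rewrite F0 in Hlin; unfold F in Hlin; apply Rabs_le_between in Hlin.
  assert (0 < (4 / PI - c) * t) by (apply Rmult_lt_0_compat; lra).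
  lra.
Qed.

Theorem corollary1p2 :
  (forall (D : C -> Prop) (rho : C -> R) (omega : C) (r : R)
     (gamma Omega : C -> Prop) (k f : C -> C),
     planar_domain D -> conformal_metric D rho -> D omega -> 0 < r ->
     geodesic_line D rho gamma ->
     (forall w, gamma w -> geodesic_disk D rho omega r w) ->
     planar_domain Omega -> conformal_bijection k unit_disk Omega ->
     rho_harmonic D rho Omega f -> (forall z, Omega z -> gamma (f z)) ->
     forall z1 z2, Omega z1 -> Omega z2 ->
       rho_dist D rho (f z1) (f z2) <= 4 * r / PI * hyp_dist k z1 z2) /\
  (forall c : R, distance_estimate c -> 4 / PI <= c).
Proof.
  split; [intros D rho omega r gamma Omega k f|exact constant_sharp].
  intros Hdom Hmet Homega Hr [HgD (I & g & (HI & (t0 & _ & Ht0 & _) & (dg & Hg & Hreg) & _ & Hgam) & Hgeo)]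
    Hdisk HOm Hk Hf Hfg z1 z2 Hz1 Hz2.
  assert (HgD' : forall t, I t -> D (g t)) by (intros t Ht; apply HgD, Hgam; exists t; split; trivial).
  (* A bare choice of parameter; its continuity and differentiability are consequences proved for
     the sections above. *)
  set (tau := fun z => epsilon (inhabits 0) (fun t => I t /\ g t = f z)).
  assert (Htau : forall z, Omega z -> I (tau z) /\ g (tau z) = f z).
  { intros z Hz; apply (epsilon_spec (inhabits 0) (fun t => I t /\ g t = f z)).
    apply Hgam, Hfg; exact Hz. }
  assert (HO := proj1 HOm).
  set (u := fun z => RInt (speed rho g dg) t0 (tau z)).
  assert (Hharm : harmonic_on Omega u)
    by (apply (arclength_harmonic D rho I g dg Hdom Hmet HI Hg Hreg HgD' Hgeo Omega f HO Hf tau t0); assumption).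
  assert (Hdist : forall z w, Omega z -> Omega w -> Rabs (u w - u z) = rho_dist D rho (f z) (f w))
    by (intros z w Hz Hw; apply (arclength_dist D rho I g dg) with (Om := Omega); assumption).
  assert (Hbd : forall z w, Omega z -> Omega w -> Rabs (u w - u z) <= 2 * r).
  { intros z w Hz Hw; rewrite Hdist by assumption.
    destruct (Hdisk _ (Hfg z Hz)) as [Dz Rz]; destruct (Hdisk _ (Hfg w Hw)) as [Dw Rw].
    assert (C := metric_continuous D rho Hdom Hmet); assert (P := metric_pos D rho Hmet).
    assert (T := rho_dist_triangle D rho C P Hdom (f z) omega (f w) Dz Homega Dw).
    rewrite (rho_dist_sym D rho C P Hdom omega (f w) Homega Dw) in T; lra. }
  destruct (completeness (fun x => exists w, Omega w /\ x = u w)) as [s [Hs1 Hs2]].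
  { exists (u z1 + 2 * r); intros x [w [Hw ->]].
    assert (B := Hbd z1 w Hz1 Hw); apply Rabs_le_between in B; lra. }
  { exists (u z1), z1; split; [exact Hz1|reflexivity]. }
  (* [u] oscillates by at most [2 r], so with [s] its supremum the values lie in [[s - 2 r, s]], an
     interval with centre [s - r]. *)
  assert (Hc : forall w, Omega w -> Rabs (u w - (s - r)) <= r).
  { intros w Hw; assert (A := Hs1 (u w) (ex_intro _ w (conj Hw eq_refl))).
    assert (B : s <= u w + 2 * r).
    { apply Hs2; intros x [v [Hv ->]].
      assert (B := Hbd w v Hw Hv); apply Rabs_le_between in B; lra. }
    apply Rabs_le; lra. }
  destruct Hk as (Hk1 & Hk2 & _ & Hk4).
  assert (Hinv : forall w, Omega w -> unit_disk (inverse_on unit_disk k w) /\ k (inverse_on unit_disk k w) = w).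
  { intros w Hw; apply (epsilon_spec (inhabits (RtoC 0)) (fun z => unit_disk z /\ k z = w)), Hk4; exact Hw. }
  destruct (Hinv z1 Hz1) as [U1 E1]; destruct (Hinv z2 Hz2) as [U2 E2].
  rewrite <- Hdist by assumption.
  (* Only the arguments of [u] are rewritten as values of [k]; those of [hyp_dist] are already
     pulled back by its definition. *)
  rewrite <- E1 at 1; rewrite <- E2 at 1.
  apply (harmonic_hyp_lipschitz Omega u k (s - r) r); try assumption.
  intros z Hz; destruct (Hk1 z Hz) as [l [Hl _]]; exists l; apply is_derive_complex_diff; exact Hl.
Qed.
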